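(* Define the positive (unbounded) operator $T$ on $L^2\big(K,L^2(\mathbb R^* )\big)$ by $$\big((TF)[0,L]\big)(\nu)=|\det(L)\nu|^{-1/2}\big(F[0,L]\big)(\nu)\quad\text{for a.e. }([0,L],\nu)\in K\times\mathbb R^*,$$ for $F\in L^2\big(K,L^2(\mathbb R^* )\big)$ (in the domain of $T$). Let $\sigma$ be the irreducible representation of $G_2$ on $L^2(K,L^2(\mathbb R^* ))$ given by $$\big(\sigma[x,A]F[0,\gamma(\omega)]\big)(t)=\frac{|\det A|^{1/2}\|\omega\|}{\|\omega A\|}e^{2\pi i(\omega x+t^{-1}u_{\omega,A})}\big(F[0,\gamma(\omega A)]\big)(v_{\omega,A}^{-1}t)$$ for a.e. $\omega\in\mathcal O$, a.e. $t\in\mathbb R^*$. If $f\in L^1(G_2)\cap L^2(G_2)$, then $\sigma(f)T$ extends to a Hilbert–Schmidt operator on $L^2\big(K,L^2(\mathbb R^* )\big)$ and $\|f\|_{L^2(G_2)}=\|\sigma(f)T\|_{\mathrm{HS}}$.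
   Context: $\mathbb R^2$ denotes column vectors, $\widehat{\mathbb R^2}$ row vectors; $\|\omega\|$ is the Euclidean norm. $G_2=\{[x,A]:x\in\mathbb R^2,A\in\mathrm{GL}_2(\mathbb R)\}$ has product $[x,A][y,B]=[x+Ay,AB]$ and left Haar measure $\frac{dx\,d\mu_{\mathrm{GL}_2(\mathbb R)}(A)}{|\det A|}$, where $\mu_{\mathrm{GL}_2(\mathbb R)}$ is Lebesgue measure on the four entries divided by $|\det A|^2$. $\mathbb R^*=\mathbb R\setminus\{0\}$ has Haar measure $d\mu_{\mathbb R^*}(t)=dt/|t|$. $K_0=\left\{\begin{pmatrix}s&-t\\ t&s\end{pmatrix}:s,t\in\mathbb R,\ s^2+t^2>0\right\}$, $K=\{[0,M]:M\in K_0\}\subset G_2$. $\mathcal O=\widehat{\mathbb R^2}\setminus\{(0,0)\}$, and $\gamma:\mathcal O\to K_0$ is the homeomorphism $\gamma(\omega)=\frac1{\|\omega\|^2}\begin{pmatrix}\omega_1&-\omega_2\\ \omega_2&\omega_1\end{pmatrix}$. Haar measure on $K$ is given by $\int_Kf\,d\mu_K=\int_{\widehat{\mathbb R^2}}f[0,\gamma(\omega)]\frac{d\omega}{\|\omega\|^2}$. For $\omega\in\mathcal O$, $A\in\mathrm{GL}_2(\mathbb R)$, the reals $u_{\omega,A}$, $v_{\omega,A}$ are defined by $\gamma(\omega)^{-1}A\gamma(\omega A)=\begin{pmatrix}1&0\\ u_{\omega,A}&v_{\omega,A}\end{pmatrix}$. $T$ is the (self-adjoint) multiplication operator with its maximal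 domain, i.e. all $F$ for which the displayed function is again in $L^2(K,L^2(\mathbb R^* ))$. For $f\in L^1(G_2)$, $\sigma(f)$ is the bounded operator with $\langle\sigma(f)\xi,\eta\rangle=\int_{G_2}f(x)\langle\sigma(x)\xi,\eta\rangle\,d\mu_{G_2}(x)$. The Hilbert–Schmidt norm is $\|S\|_{\mathrm{HS}}=\big(\sum_j\|S\xi_j\|^2\big)^{1/2}$ for any orthonormal basis $\{\xi_j\}$; $\|\sigma(f)T\|_{\mathrm{HS}}$ means the norm of the extension. *)

(* Defs.v *)
(* Conventions.

   Functions on a subset (G_2, K, R^* = R \ {0}) are modelled, as usual in
   MathComp-Analysis, by functions on the ambient type ('cV_2 * 'M_2 or R)
   together with a measure which vanishes outside the subset; see mu_G2_setC,
   mu_K_setC and mu_Rstar_setC.  Their values outside the subset are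
   irrelevant.  Elements of L^p-spaces are represented by measurable
   functions, equality being almost everywhere equality.  Inner products are
   linear in the first argument. *)
From HB Require Import structures.
From mathcomp Require Import all_boot all_order all_algebra.
From mathcomp Require Import all_classical all_reals all_analysis.
From mathcomp Require Import measurable_realfun.
From mathcomp Require Export complex.

Set Implicit Arguments.
Unset Strict Implicit.
Unset Printing Implicit Defensive.

Import Order.TTheory GRing.Theory Num.Theory.
Import numFieldNormedType.Exports.

Local Open Scope classical_set_scope.
Local Open Scope ring_scope.
Local Open Scope complex_scope.

(* The sigma-algebra on matrices generated by the entries (for real entries:
   the Borel sigma-algebra). *)
Section measurable_matrix.
Context d (T : measurableType d) (m n : nat).

Definition mx_display : measure_display -> measure_display.
Proof. exact. Qed.

Definition mx_entries : set (set 'M[T]_(m, n)) :=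
  [set A | exists i j, exists2 B : set T, measurable B &
             A = (fun M : 'M[T]_(m, n) => M i j) @^-1` B].

Let mx_set0 : <<s mx_entries >> set0.
Proof. exact: sigma_algebra0. Qed.

Let mx_setC A : <<s mx_entries >> A -> <<s mx_entries >> (~` A).
Proof. exact: sigma_algebraC. Qed.

Let mx_bigcup (F : _^nat) : (forall i, <<s mx_entries >> (F i)) ->
  <<s mx_entries >> (\bigcup_i F i).
Proof. exact: sigma_algebra_bigcup. Qed.

HB.instance Definition _ := @isMeasurable.Build (mx_display d) 'M[T]_(m, n)
  <<s mx_entries >> mx_set0 mx_setC mx_bigcup.

Lemma measurable_entry i j :
  measurable_fun [set: 'M[T]_(m, n)] (fun M : 'M[T]_(m, n) => M i j).
Proof.
by move=> _ B mB; rewrite setTI; apply: sub_sigma_algebra; exists i, j, B.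
Qed.

Lemma measurable_fun_mx d' (U : measurableType d') (D : set U)
    (f : U -> 'M[T]_(m, n)) :
  (forall i j, measurable_fun D (fun u => f u i j)) -> measurable_fun D f.
Proof.
move=> mf mD; apply: (@measurability _ _ _ _ D f mx_entries) => //.
by move=> _ [_ [i [j [B mB ->]]] <-]; exact: mf.
Qed.

End measurable_matrix.

Section density.
Local Open Scope ereal_scope.
Context d (T : measurableType d) (R : realType).
Implicit Types (mu : {measure set T -> \bar R}) (D A : set T) (w : T -> R).

Definition density mu D w A : \bar R := \int[mu]_(x in D `&` A) (w x)%:E.

Lemma density0 mu D w : density mu D w set0 = 0.
Proof. by rewrite /density setI0 integral_set0. Qed.

Lemma density_setC mu D w : density mu D w (~` D) = 0.
Proof. by rewrite /density setICr integral_set0. Qed.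

Lemma density_ge0 mu D w A : (forall x, (0 <= w x)%R) -> 0 <= density mu D w A.
Proof. by move=> w0; apply: integral_ge0 => x _; rewrite lee_fin. Qed.

Lemma density_sigma_additive mu D w : measurable D -> measurable_fun setT w ->
  (forall x, (0 <= w x)%R) -> semi_sigma_additive (density mu D w).
Proof.
move=> mD mw w0.
have mwE : measurable_fun setT (EFin \o w) by exact/measurable_EFinP.
move=> F mF tF mUF; rewrite /density setI_bigcupr.
rewrite ge0_integral_bigcup//=.
- apply: is_cvg_ereal_nneg_natsum_cond => n _ _.
  by apply: integral_ge0 => x _; rewrite lee_fin.
- by move=> n; exact: measurableI.
- exact: measurable_funTS.
- by move=> x _; rewrite lee_fin.
- exact: trivIset_setIl.
Qed.

Lemma density_sigma_finite (mu : {sigma_finite_measure set T -> \bar R}) D w :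
  measurable D -> measurable_fun setT w -> (forall x, (0 <= w x)%R) ->
  sigma_finite setT (density mu D w).
Proof.
move=> mD mw w0.
have mwE : measurable_fun setT (EFin \o w) by exact/measurable_EFinP.
have /sigma_finiteP[F [TF ndF Foo]] := sigma_finiteT mu.
have mW n : measurable [set x | (w x <= n%:R)%R].
  rewrite -[X in measurable X]setTI.
  by apply: measurable_fun_le => //; exact: measurable_cst.
exists (fun n => F n `&` [set x | (w x <= n%:R)%R]).
  rewrite predeqE => x; split=> // _.
  have : (\bigcup_i F i) x by rewrite -TF.
  move=> [n _ Fnx].
  exists (maxn n (Num.truncn (w x)).+1) => //; split=> /=.
    have /subsetPset := ndF _ _ (leq_maxl n (Num.truncn (w x)).+1).
    exact.
  apply: le_trans (ltW (truncnS_gt _)) _.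
  by rewrite ler_nat leq_maxr.
move=> n; have [mFn Fnoo] := Foo n; split; first exact: measurableI.
have mI : measurable (D `&` (F n `&` [set x | (w x <= n%:R)%R])).
  by do 2 apply: measurableI => //.
apply: (@le_lt_trans _ _
  (\int[mu]_(x in D `&` (F n `&` [set x | (w x <= n%:R)%R])) (n%:R)%:E)).
  apply: ge0_le_integral => //.
  - by move=> x _; rewrite lee_fin.
  - exact: measurable_funTS.
  - by move=> x [_ [_ /=]]; rewrite lee_fin.
rewrite integral_cst//; apply: lte_mul_pinfty => //.
apply: le_lt_trans Fnoo; apply: le_measure; rewrite ?inE//.
by move=> x [_ []].
Qed.

End density.

Section pushforward_measure.
Local Open Scope ereal_scope.
Context d d' (T : measurableType d) (T' : measurableType d') (R : realType).

Lemma pushforward_sigma_additive (mu : {measure set T -> \bar R})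
    (f : T -> T') : measurable_fun setT f ->
  semi_sigma_additive (pushforward mu f).
Proof.
move=> mf F mF tF mUF; rewrite /pushforward preimage_bigcup.
apply: measure_semi_sigma_additive.
- by move=> n; rewrite -[X in measurable X]setTI; exact: mf.
- apply/trivIsetP => /= i j _ _ ij; rewrite -preimage_setI.
  by move/trivIsetP : tF => /(_ _ _ _ _ ij) ->//; rewrite preimage_set0.
- by rewrite -preimage_bigcup -[X in measurable X]setTI; exact: mf.
Qed.

Lemma pushforward_sigma_finite (mu : {sigma_finite_measure set T -> \bar R})
    (f : T -> T') (g : T' -> T) :
  measurable_fun setT g -> cancel f g -> sigma_finite setT (pushforward mu f).
Proof.
move=> mg fK; have [F TF Foo] := sigma_finiteT mu.
exists (fun n => g @^-1` F n).
  by rewrite -preimage_bigcup -TF preimage_setT.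
move=> n; have [mFn Fnoo] := Foo n; split.
  by rewrite -[X in measurable X]setTI; exact: mg.
rewrite /pushforward -comp_preimage (_ : g \o f = id) ?preimage_id//.
by apply/funext => x /=; rewrite fK.
Qed.

End pushforward_measure.

(* The library has this only for subprobability measures as a canonical
   instance. *)
Lemma product_sigma_finite d1 d2 (T1 : measurableType d1)
    (T2 : measurableType d2) (R : realType)
    (m1 : {sigma_finite_measure set T1 -> \bar R})
    (m2 : {sigma_finite_measure set T2 -> \bar R}) :
  sigma_finite setT (m1 \x m2)%E.
Proof.
have /sigma_finiteP[F [TF ndF Foo]] := sigma_finiteT m1.
have /sigma_finiteP[G [TG ndG Goo]] := sigma_finiteT m2.
exists (fun n => F n `*` G n).
  rewrite -setXTT TF TG predeqE => -[x y]; split.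
    move=> [/= [n _ Fnx] [k _ Gky]]; exists (maxn n k) => //; split.
    - by have /subsetPset := ndF _ _ (leq_maxl n k); exact.
    - by have /subsetPset := ndG _ _ (leq_maxr n k); exact.
  by move=> [n _ []/= ? ?]; split; exists n.
move=> k; have [? ?] := Foo k; have [? ?] := Goo k.
split; first exact: measurableX.
by rewrite product_measure1E// lte_mul_pinfty// ge0_fin_numE.
Qed.

Section coordinates.
Context (R : realType).
Local Notation leb := (@lebesgue_measure R).
Local Notation RL := (measurableTypeR R).

Definition mkcol (p : RL * RL) : 'cV[R]_2 :=
  \col_i if i == 0 then p.1 else p.2.

Definition mkrow (p : RL * RL) : 'rV[R]_2 :=
  \row_j if j == 0 then p.1 else p.2.

Definition mx2 (a b c d : R) : 'M[R]_2 :=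
  \matrix_(i, j) if i == 0 then (if j == 0 then a else b)
                 else (if j == 0 then c else d).

Definition mkmx (p : (RL * RL) * (RL * RL)) : 'M[R]_2 :=
  mx2 p.1.1 p.1.2 p.2.1 p.2.2.

Lemma mx2E (A : 'M[R]_2) : A = mx2 (A 0 0) (A 0 1) (A 1 0) (A 1 1).
Proof.
apply/matrixP => i j; rewrite mxE.
by case: i j => -[|[|//]] i2 [] [|[|//]] j2 /=; congr (A _ _); exact/val_inj.
Qed.

Lemma det_mx2 (A : 'M[R]_2) : \det A = A 0 0 * A 1 1 - A 0 1 * A 1 0.
Proof.
rewrite (expand_det_row _ 0) !big_ord_recl big_ord0 addr0 /cofactor !det_mx11.
rewrite !mxE/= expr0 expr1 mul1r mulN1r mulrN.
by congr (A _ _ * A _ _ - A _ _ * A _ _); exact/val_inj.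
Qed.

Lemma measurable_mkcol : measurable_fun setT mkcol.
Proof.
apply: measurable_fun_mx => i j.
rewrite (_ : (fun p => _) = if i == 0 then fst else snd); last first.
  by apply/funext => p; rewrite mxE; case: ifP.
by case: ifP => _; [exact: measurable_fst|exact: measurable_snd].
Qed.

Lemma measurable_mkrow : measurable_fun setT mkrow.
Proof.
apply: measurable_fun_mx => i j.
rewrite (_ : (fun p => _) = if j == 0 then fst else snd); last first.
  by apply/funext => p; rewrite mxE; case: ifP.
by case: ifP => _; [exact: measurable_fst|exact: measurable_snd].
Qed.

Lemma measurable_mx2 d (T : measurableType d) (a b c e : T -> R) :
  measurable_fun setT a -> measurable_fun setT b ->
  measurable_fun setT c -> measurable_fun setT e ->
  measurable_fun setT (fun t => mx2 (a t) (b t) (c t) (e t)).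
Proof.
move=> ma mb mc me; apply: measurable_fun_mx => i j.
rewrite (_ : (fun t => _) = if i == 0 then if j == 0 then a else b
                            else if j == 0 then c else e).
  by do 2 case: ifP => //.
by apply/funext => p; rewrite mxE; do 2 case: ifP.
Qed.

Lemma measurable_mkmx : measurable_fun setT mkmx.
Proof.
by apply: measurable_mx2; apply: measurableT_comp => //;
  (exact: measurable_fst || exact: measurable_snd).
Qed.

Lemma measurable_det2 : measurable_fun setT (fun A : 'M[R]_2 => \det A).
Proof.
under eq_fun do rewrite det_mx2.
by apply: measurable_funB; apply: measurable_funM; exact: measurable_entry.
Qed.

Definition lebesgue2 : set (RL * RL) -> \bar R := (leb \x leb)%E.

HB.instance Definition _ := Measure.copy lebesgue2 (leb \x leb)%E.

Let lebesgue2_sigma_finite : sigma_finite setT lebesgue2.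
Proof. exact: product_sigma_finite. Qed.

HB.instance Definition _ := Measure_isSigmaFinite.Build _ _ _ lebesgue2
  lebesgue2_sigma_finite.

Definition lebesgue4 : set ((RL * RL) * (RL * RL)) -> \bar R :=
  (lebesgue2 \x lebesgue2)%E.

HB.instance Definition _ := Measure.copy lebesgue4 (lebesgue2 \x lebesgue2)%E.

Let lebesgue4_sigma_finite : sigma_finite setT lebesgue4.
Proof. exact: product_sigma_finite. Qed.

HB.instance Definition _ := Measure_isSigmaFinite.Build _ _ _ lebesgue4
  lebesgue4_sigma_finite.

Definition lebesgue_cV2 : set 'cV[R]_2 -> \bar R :=
  pushforward lebesgue2 mkcol.

Let cV2_0 : lebesgue_cV2 set0 = 0%E.
Proof. by rewrite /lebesgue_cV2 /pushforward preimage_set0 measure0. Qed.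

Let cV2_ge0 A : (0 <= lebesgue_cV2 A)%E.
Proof. by rewrite /lebesgue_cV2 /pushforward; exact: measure_ge0. Qed.

Let cV2_sigma : semi_sigma_additive lebesgue_cV2.
Proof. apply: pushforward_sigma_additive; exact: measurable_mkcol. Qed.

HB.instance Definition _ := isMeasure.Build _ _ _ lebesgue_cV2
  cV2_0 cV2_ge0 cV2_sigma.

Definition lebesgue_rV2 : set 'rV[R]_2 -> \bar R :=
  pushforward lebesgue2 mkrow.

Let rV2_0 : lebesgue_rV2 set0 = 0%E.
Proof. by rewrite /lebesgue_rV2 /pushforward preimage_set0 measure0. Qed.

Let rV2_ge0 A : (0 <= lebesgue_rV2 A)%E.
Proof. by rewrite /lebesgue_rV2 /pushforward; exact: measure_ge0. Qed.

Let rV2_sigma : semi_sigma_additive lebesgue_rV2.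
Proof. apply: pushforward_sigma_additive; exact: measurable_mkrow. Qed.

HB.instance Definition _ := isMeasure.Build _ _ _ lebesgue_rV2
  rV2_0 rV2_ge0 rV2_sigma.

Definition lebesgue_M2 : set 'M[R]_2 -> \bar R :=
  pushforward lebesgue4 mkmx.

Let M2_0 : lebesgue_M2 set0 = 0%E.
Proof. by rewrite /lebesgue_M2 /pushforward preimage_set0 measure0. Qed.

Let M2_ge0 A : (0 <= lebesgue_M2 A)%E.
Proof. by rewrite /lebesgue_M2 /pushforward; exact: measure_ge0. Qed.

Let M2_sigma : semi_sigma_additive lebesgue_M2.
Proof. apply: pushforward_sigma_additive; exact: measurable_mkmx. Qed.

HB.instance Definition _ := isMeasure.Build _ _ _ lebesgue_M2
  M2_0 M2_ge0 M2_sigma.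

Let lebesgue_M2_sigma_finite : sigma_finite setT lebesgue_M2.
Proof.
pose g (A : 'M[R]_2) : (RL * RL) * (RL * RL) :=
  ((A 0 0, A 0 1), (A 1 0, A 1 1)).
have mg : measurable_fun setT g.
  by do ?apply: measurable_fun_pair => //; exact: measurable_entry.
apply: (pushforward_sigma_finite lebesgue4 mg).
by move=> [[a b] [c e]]; rewrite /g !mxE.
Qed.

HB.instance Definition _ := Measure_isSigmaFinite.Build _ _ _ lebesgue_M2
  lebesgue_M2_sigma_finite.

(* The library norm on 'rV is the sup norm. *)
Definition enorm (w : 'rV[R]_2) : R :=
  Num.sqrt (w 0 0 ^+ 2 + w 0 1 ^+ 2).

Lemma enorm_ge0 w : 0 <= enorm w.
Proof. exact: sqrtr_ge0. Qed.

Lemma enorm_sqr w : enorm w ^+ 2 = w 0 0 ^+ 2 + w 0 1 ^+ 2.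
Proof. by rewrite sqr_sqrtr// addr_ge0// sqr_ge0. Qed.

Lemma enorm_eq0 w : (enorm w == 0) = (w == 0).
Proof.
rewrite -sqrf_eq0 enorm_sqr paddr_eq0 ?sqr_ge0// !sqrf_eq0.
apply/andP/eqP => [[/eqP w0 /eqP w1]|->]; last by rewrite !mxE.
apply/rowP => -[[|[|//]] i2]; rewrite !mxE.
  by rewrite -[RHS]w0; congr (w _ _); exact/val_inj.
by rewrite -[RHS]w1; congr (w _ _); exact/val_inj.
Qed.

Lemma measurable_enorm_sqr :
  measurable_fun setT (fun w : 'rV[R]_2 => enorm w ^+ 2).
Proof.
under eq_fun do rewrite enorm_sqr.
by apply: measurable_funD; apply: measurable_funX; exact: measurable_entry.
Qed.

End coordinates.

Section measures.
Context (R : realType).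
Local Notation leb := (@lebesgue_measure R).
Local Notation RL := (measurableTypeR R).
Local Notation amb := ('cV[R]_2 * 'M[R]_2)%type.

Lemma measurable_inv_ge0 d (T : measurableType d) (f : T -> R) :
  (forall t, 0 <= f t) -> measurable_fun setT f ->
  measurable_fun setT (fun t => (f t)^-1).
Proof.
move=> f0 mf; under eq_fun do rewrite -powR_inv1//.
exact: (@measurableT_comp _ _ _ _ _ _ (@powR R ^~ (-1))).
Qed.

Definition Rstar : set RL := [set t | t != 0 :> R].

Definition mu_Rstar : set RL -> \bar R :=
  density leb Rstar (fun t => `|t : R|^-1).

Definition GL2 : set 'M[R]_2 := [set A | A \in unitmx].

Definition mu_GL2 : set 'M[R]_2 -> \bar R :=
  density (@lebesgue_M2 R) GL2 (fun A => (`|\det A| ^+ 2)^-1).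

(* [x, A] is the pair (x, A). *)
Definition G2 : set amb := [set g | GL2 g.2].

Definition K0 : set 'M[R]_2 :=
  [set M | exists s t, 0 < s ^+ 2 + t ^+ 2 /\ M = mx2 s (- t) t s].

Definition K : set amb := [set g | g.1 = 0 /\ K0 g.2].

Definition orow : set 'rV[R]_2 := [set w | w != 0].

Definition gamma (w : 'rV[R]_2) : 'M[R]_2 :=
  (enorm w ^+ 2)^-1 *: mx2 (w 0 0) (- w 0 1) (w 0 1) (w 0 0).

(* The inverse of the bijection gamma : orow -> K0. *)
Definition gammaV (L : 'M[R]_2) : 'rV[R]_2 :=
  (L 0 0 ^+ 2 + L 1 0 ^+ 2)^-1 *: mkrow (L 0 0, L 1 0).

Lemma gammaE w : gamma w = mx2 (w 0 0 / enorm w ^+ 2) (- (w 0 1 / enorm w ^+ 2))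
  (w 0 1 / enorm w ^+ 2) (w 0 0 / enorm w ^+ 2).
Proof.
apply/matrixP => i j; rewrite !mxE.
by case: ifP => _; case: ifP => _; rewrite ?mulrN mulrC.
Qed.

Lemma enorm_sqr_gamma w : orow w ->
  (w 0 0 / enorm w ^+ 2) ^+ 2 + (w 0 1 / enorm w ^+ 2) ^+ 2 =
  (enorm w ^+ 2)^-1.
Proof.
rewrite /orow /= -enorm_eq0 => w0.
rewrite !expr_div_n -mulrDl -enorm_sqr -[in (_ ^+ 2) ^+ 2]exprM.
by rewrite (exprM _ 2 2) expr2 invfM mulrA divff ?mul1r// sqrf_eq0.
Qed.

Lemma gamma_K0 w : orow w -> K0 (gamma w).
Proof.
move=> w0; exists (w 0 0 / enorm w ^+ 2), (w 0 1 / enorm w ^+ 2).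
rewrite gammaE enorm_sqr_gamma//; split=> //.
by rewrite invr_gt0 exprn_gt0// lt_neqAle enorm_ge0 eq_sym enorm_eq0 w0.
Qed.

Lemma gammaK w : orow w -> gammaV (gamma w) = w.
Proof.
move=> w0; have e0 : enorm w ^+ 2 != 0 by rewrite sqrf_eq0 enorm_eq0.
rewrite /gammaV gammaE !mxE/= enorm_sqr_gamma// invrK.
apply/rowP => -[[|[|//]] i2]; rewrite !mxE/= mulrC divfK//.
  by congr (w _ _); exact/val_inj.
by congr (w _ _); exact/val_inj.
Qed.

Lemma gammaVK L : K0 L -> orow (gammaV L) /\ gamma (gammaV L) = L.
Proof.
move=> [s [t [st ->]]]; set q := s ^+ 2 + t ^+ 2.
have q0 : q != 0 by rewrite gt_eqF.
have v0 : gammaV (mx2 s (- t) t s) 0 0 = s / q by rewrite !mxE/= mulrC.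
have v1 : gammaV (mx2 s (- t) t s) 0 1 = t / q by rewrite !mxE/= mulrC.
have e : enorm (gammaV (mx2 s (- t) t s)) ^+ 2 = q^-1.
  rewrite enorm_sqr v0 v1 !expr_div_n -mulrDl -/q expr2 invfM mulrA.
  by rewrite divff ?mul1r.
split; first by rewrite /orow /= -enorm_eq0 -sqrf_eq0 e invr_eq0.
by rewrite gammaE e v0 v1 invrK !divfK.
Qed.

Definition kgamma (w : 'rV[R]_2) : amb := (0, gamma w).

Definition mu_orow : set 'rV[R]_2 -> \bar R :=
  density (@lebesgue_rV2 R) orow (fun w => (enorm w ^+ 2)^-1).

Definition mu_K : set amb -> \bar R := pushforward mu_orow kgamma.

Lemma measurable_Rstar : measurable Rstar.
Proof.
rewrite (_ : Rstar = ~` [set 0]); first exact: measurableC.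
by apply/seteqP; split=> x /= /eqP.
Qed.

Lemma measurable_GL2 : measurable GL2.
Proof.
rewrite (_ : GL2 = (fun A : 'M[R]_2 => \det A) @^-1` (~` [set 0])).
  by rewrite -[X in measurable X]setTI; apply: measurable_det2 => //;
    exact: measurableC.
apply/seteqP; split=> A; rewrite /GL2 /= unitmxE unitfE.
  by move/eqP.
by move=> ?; apply/eqP.
Qed.

Lemma measurable_G2 : measurable G2.
Proof.
have m2 : measurable_fun setT (snd : amb -> 'M[R]_2) by exact: measurable_snd.
by rewrite -[X in measurable X]setTI; apply: m2 => //; exact: measurable_GL2.
Qed.

Lemma measurable_orow : measurable orow.
Proof.
rewrite (_ : orow = (fun w : 'rV[R]_2 => enorm w ^+ 2) @^-1` (~` [set 0])).
  by rewrite -[X in measurable X]setTI; apply: measurable_enorm_sqr => //;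
    exact: measurableC.
apply/seteqP; split=> w; rewrite /orow /= -enorm_eq0 -sqrf_eq0.
  by move/eqP.
by move=> ?; apply/eqP.
Qed.

Let mw_Rstar : measurable_fun setT (fun t : RL => `|t : R|^-1).
Proof. by apply: measurable_inv_ge0 => //; exact: measurable_normr. Qed.

Let Rstar_0 : mu_Rstar set0 = 0%E. Proof. exact: density0. Qed.

Let Rstar_ge0 A : (0 <= mu_Rstar A)%E.
Proof. by apply: density_ge0 => t; rewrite invr_ge0. Qed.

Let Rstar_sigma : semi_sigma_additive mu_Rstar.
Proof.
apply: density_sigma_additive mw_Rstar _; first exact: measurable_Rstar.
by move=> t; rewrite invr_ge0.
Qed.

HB.instance Definition _ := isMeasure.Build _ _ _ mu_Rstar
  Rstar_0 Rstar_ge0 Rstar_sigma.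

Let mw_GL2 : measurable_fun setT (fun A : 'M[R]_2 => (`|\det A| ^+ 2)^-1).
Proof.
apply: measurable_inv_ge0 => [A|]; first by rewrite sqr_ge0.
apply: measurable_funX; apply: measurableT_comp => //.
exact: measurable_det2.
Qed.

Let GL2_0 : mu_GL2 set0 = 0%E. Proof. exact: density0. Qed.

Let GL2_ge0 A : (0 <= mu_GL2 A)%E.
Proof. by apply: density_ge0 => t; rewrite invr_ge0 sqr_ge0. Qed.

Let GL2_sigma : semi_sigma_additive mu_GL2.
Proof.
apply: density_sigma_additive mw_GL2 _; first exact: measurable_GL2.
by move=> t; rewrite invr_ge0 sqr_ge0.
Qed.

HB.instance Definition _ := isMeasure.Build _ _ _ mu_GL2
  GL2_0 GL2_ge0 GL2_sigma.

Let GL2_sigma_finite : sigma_finite setT mu_GL2.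
Proof.
apply: density_sigma_finite mw_GL2 _; first exact: measurable_GL2.
by move=> t; rewrite invr_ge0 sqr_ge0.
Qed.

HB.instance Definition _ := Measure_isSigmaFinite.Build _ _ _ mu_GL2
  GL2_sigma_finite.

Definition mu_G2 : set amb -> \bar R :=
  density (@lebesgue_cV2 R \x mu_GL2)%E G2 (fun g => `|\det g.2|^-1).

Let mw_G2 : measurable_fun setT (fun g : amb => `|\det g.2|^-1).
Proof.
apply: measurable_inv_ge0 => //; apply: measurableT_comp => //.
exact: (measurableT_comp (@measurable_det2 R) measurable_snd).
Qed.

Let G2_0 : mu_G2 set0 = 0%E. Proof. exact: density0. Qed.

Let G2_ge0 A : (0 <= mu_G2 A)%E.
Proof. by apply: density_ge0 => t; rewrite invr_ge0. Qed.

Let G2_sigma : semi_sigma_additive mu_G2.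
Proof.
apply: density_sigma_additive mw_G2 _; first exact: measurable_G2.
by move=> t; rewrite invr_ge0.
Qed.

HB.instance Definition _ := isMeasure.Build _ _ _ mu_G2 G2_0 G2_ge0 G2_sigma.

Let mw_orow : measurable_fun setT (fun w : 'rV[R]_2 => (enorm w ^+ 2)^-1).
Proof.
apply: measurable_inv_ge0 => [A|]; first by rewrite sqr_ge0.
exact: measurable_enorm_sqr.
Qed.

Let orow_0 : mu_orow set0 = 0%E. Proof. exact: density0. Qed.

Let orow_ge0 A : (0 <= mu_orow A)%E.
Proof. by apply: density_ge0 => t; rewrite invr_ge0 sqr_ge0. Qed.

Let orow_sigma : semi_sigma_additive mu_orow.
Proof.
apply: density_sigma_additive mw_orow _; first exact: measurable_orow.
by move=> t; rewrite invr_ge0 sqr_ge0.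
Qed.

HB.instance Definition _ := isMeasure.Build _ _ _ mu_orow
  orow_0 orow_ge0 orow_sigma.

Lemma measurable_kgamma : measurable_fun setT kgamma.
Proof.
apply: measurable_fun_pair; first exact: measurable_cst.
have me (i : 'I_2) :
    measurable_fun setT (fun w : 'rV[R]_2 => w 0 i / enorm w ^+ 2).
  by apply: measurable_funM => //; exact: measurable_entry.
rewrite (_ : gamma = fun w => mx2 (w 0 0 / enorm w ^+ 2)
    (- (w 0 1 / enorm w ^+ 2)) (w 0 1 / enorm w ^+ 2) (w 0 0 / enorm w ^+ 2)).
  by apply: measurable_mx2 => //; apply: measurableT_comp.
by apply/funext => w; exact: gammaE.
Qed.

Let K_0 : mu_K set0 = 0%E.
Proof. by rewrite /mu_K /pushforward preimage_set0 measure0. Qed.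

Let K_ge0 A : (0 <= mu_K A)%E.
Proof. by rewrite /mu_K /pushforward; exact: measure_ge0. Qed.

Let K_sigma : semi_sigma_additive mu_K.
Proof. by apply: pushforward_sigma_additive; exact: measurable_kgamma. Qed.

HB.instance Definition _ := isMeasure.Build _ _ _ mu_K K_0 K_ge0 K_sigma.

Lemma mu_Rstar_setC : mu_Rstar (~` Rstar) = 0%E.
Proof. exact: density_setC. Qed.

Lemma mu_G2_setC : mu_G2 (~` G2) = 0%E.
Proof. exact: density_setC. Qed.

Lemma mu_K_setC : mu_K (~` K) = 0%E.
Proof.
rewrite /mu_K /pushforward /mu_orow /density.
rewrite (_ : _ `&` _ = set0) ?integral_set0//.
by apply/seteqP; split=> // w [w0] /=; apply; split=> //; exact: gamma_K0.
Qed.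

End measures.

Section complex_functions.
Context d (T : measurableType d) (R : realType).
Implicit Types (mu : {measure set T -> \bar R}) (f : T -> R[i]).

Definition expi (x : R) : R[i] := cos x +i* sin x.

Definition cmeasurable f : Prop :=
  measurable_fun setT (fun x => complex.Re (f x)) /\
  measurable_fun setT (fun x => complex.Im (f x)).

Definition cintegral mu f : R[i] :=
  (\int[mu]_x complex.Re (f x)) +i* (\int[mu]_x complex.Im (f x)).

Definition cnorm mu (p : \bar R) f : \bar R :=
  Lnorm mu p (fun x => (Normc.normc (f x))%:E).

Definition cLp mu (p : \bar R) f : Prop :=
  cmeasurable f /\ (cnorm mu p f < +oo)%E.

End complex_functions.

Section representation.
Context (R : realType).
Local Notation RL := (measurableTypeR R).
Local Notation amb := ('cV[R]_2 * 'M[R]_2)%type.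
Local Notation C := R[i].

(* Representatives F of elements of the Hilbert space L^2(K, L^2(R^* )):
   F k t stands for (F k)(t). *)
Definition hfun := amb -> R -> C.

Definition hnorm (F : hfun) : \bar R :=
  Lnorm (@mu_K R) 2%:E (fun k => cnorm (@mu_Rstar R) 2%:E (F k)).

Definition hspace : set hfun :=
  [set F | cmeasurable (fun p : amb * RL => F p.1 p.2) /\ (hnorm F < +oo)%E].

Definition heq (F G : hfun) : Prop :=
  {ae @mu_K R, forall k, {ae @mu_Rstar R, forall t, F k t = G k t}}.

Definition hinner (F G : hfun) : C :=
  cintegral (@mu_K R) (fun k =>
    cintegral (@mu_Rstar R) (fun t => F k t * (G k t)^*)).

Definition hop := hfun -> hfun.

(* A bounded linear operator on L^2(K, L^2(R^* )).  It is compatible with heq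
   by the last two clauses. *)
Definition bounded_op (S : hop) : Prop :=
  [/\ forall F, hspace F -> hspace (S F),
      forall (a : C) F G, hspace F -> hspace G ->
        heq (S (fun k t => a * F k t + G k t))
            (fun k t => a * S F k t + S G k t) &
      exists M : R, forall F, hspace F -> (hnorm (S F) <= M%:E * hnorm F)%E].

(* Since L^2(K, L^2(R^* )) is separable and infinite dimensional, all its
   orthonormal bases are sequences. *)
Definition orthonormal_basis (e : nat -> hfun) : Prop :=
  [/\ forall j, hspace (e j),
      forall i j, hinner (e i) (e j) = (i == j)%:R &
      forall F, hspace F ->
        hnorm (fun k t => F k t - \sum_(j < n) hinner F (e j) * e j k t)
          @[n --> \oo] --> 0%E].

Definition hs_norm (e : nat -> hfun) (S : hop) : \bar R :=
  ((\sum_(j <oo) hnorm (S (e j)) `^ 2) `^ 2^-1)%E.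

Definition hilbert_schmidt (S : hop) : Prop :=
  bounded_op S /\
  forall e, orthonormal_basis e -> (hs_norm e S < +oo)%E.

Definition uv_mx (w : 'rV[R]_2) (A : 'M[R]_2) : 'M[R]_2 :=
  invmx (gamma w) *m A *m gamma (w *m A).

Definition u_ (w : 'rV[R]_2) (A : 'M[R]_2) : R := uv_mx w A 1 0.
Definition v_ (w : 'rV[R]_2) (A : 'M[R]_2) : R := uv_mx w A 1 1.

Definition sigma (x : amb) : hop := fun F k t =>
  let w := gammaV k.2 in let A := x.2 in
  (Num.sqrt `|\det A| * enorm w / enorm (w *m A))%:C *
  expi (2 * pi * ((w *m x.1) 0 0 + t^-1 * u_ w A)) *
  F (kgamma (w *m A)) ((v_ w A)^-1 * t).

Lemma mul_gamma (w : 'rV[R]_2) : orow w -> w *m gamma w = delta_mx 0 0.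
Proof.
move=> w0; have e0 : enorm w ^+ 2 != 0 by rewrite sqrf_eq0 enorm_eq0.
apply/rowP => j; rewrite gammaE !mxE !big_ord_recl big_ord0 addr0 !mxE /=.
rewrite (_ : lift ord0 ord0 = 1); last exact/val_inj.
case: j => -[|[|//]] j2 /=.
  by rewrite !mulrA -mulrDl -!expr2 -enorm_sqr divff.
by rewrite mulrN mulrCA addrC subrr.
Qed.

Lemma gamma_unit (w : 'rV[R]_2) : orow w -> gamma w \in unitmx.
Proof.
move=> w0; rewrite unitmxE unitfE gammaE det_mx2 !mxE /=.
rewrite mulNr opprK -!expr2 enorm_sqr_gamma// invr_eq0 sqrf_eq0 enorm_eq0.
exact: w0.
Qed.

Lemma orow_mul (w : 'rV[R]_2) (A : 'M[R]_2) :
  orow w -> GL2 A -> orow (w *m A).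
Proof.
move=> w0 uA; apply: contra_neq w0 => wA0.
by rewrite -(mulmxK uA w) wA0 mul0mx.
Qed.

Lemma uv_mxE w A : orow w -> GL2 A -> uv_mx w A = mx2 1 0 (u_ w A) (v_ w A).
Proof.
move=> w0 uA; rewrite [LHS]mx2E -/(u_ w A) -/(v_ w A).
have r0 : delta_mx 0 0 *m uv_mx w A = delta_mx 0 0 :> 'rV[R]_2.
  rewrite /uv_mx -{1}(mul_gamma w0) !mulmxA mulmxK ?gamma_unit//.
  by rewrite mul_gamma//; exact: orow_mul.
have e j : uv_mx w A 0 j = (delta_mx 0 0 : 'rV[R]_2) 0 j.
  by rewrite -[in RHS]r0 -rowE [RHS]mxE.
by rewrite !e !mxE.
Qed.

Lemma sigmaE x A F w t : orow w ->
  sigma (x, A) F (kgamma w) t =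
  (Num.sqrt `|\det A| * enorm w / enorm (w *m A))%:C *
  expi (2 * pi * ((w *m x) 0 0 + t^-1 * u_ w A)) *
  F (kgamma (w *m A)) ((v_ w A)^-1 * t).
Proof. by move=> w0; rewrite /sigma /= gammaK. Qed.

(* sigma(f), the bounded operator determined by its matrix coefficients; as an
   operator on representatives it is unique up to heq. *)
Definition sigmaL1 (f : amb -> C) : hop :=
  xget (fun _ _ _ => 0)
    [set S | bounded_op S /\
       forall xi eta, hspace xi -> hspace eta ->
         hinner (S xi) eta =
         cintegral (@mu_G2 R) (fun x => f x * hinner (sigma x xi) eta)].

Definition opT : hop := fun F k t =>
  (`|\det k.2 * t| `^ (- 2^-1))%:C * F k t.

Definition domT : set hfun := [set F | hspace F /\ hspace (opT F)].

End representation.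

(* Main.v *)
(* In the coordinates w (for k = gamma w), w' = w A and the second row (u, v)
   of gamma(w)^-1 A gamma(w A), the operator sigma(f) T becomes an integral
   operator on L^2(K x R^* ): its kernel at ((w, t), (w', s)) is an explicit
   weight times the Fourier transform of f in the translation variable (at w)
   and in u (at 1/t), with v = t/s.  The Hilbert-Schmidt norm is the L^2 norm
   of the kernel.  The weight is such that, after substituting v for s and 1/t
   for t, Plancherel in u, the change of variables (w', u, v) -> A and
   Plancherel in the translation variable turn it into the L^2(G_2) norm of f.

   One-dimensional Plancherel is proved for f in L^1 and L^2, f >= 0, by damping
   |f^|^2 with exp(-e|t|), whose Fourier transform is a Cauchy kernel: the
   damped integral is the integral of f times the average of f against that
   kernel, at most |f|^2 by AM-GM, and at least |f|^2 in the limit by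
   Lebesgue differentiation and Fatou. *)
Require Import Defs.
From HB Require Import structures.
From mathcomp Require Import all_boot all_order all_algebra.
From mathcomp Require Import all_classical all_reals all_analysis.
From mathcomp Require Import measurable_realfun ring lra.

Set Implicit Arguments.
Unset Strict Implicit.
Unset Printing Implicit Defensive.

Import Order.TTheory GRing.Theory Num.Theory.
Import numFieldNormedType.Exports.

Local Open Scope classical_set_scope.
Local Open Scope ring_scope.
Local Open Scope complex_scope.

(** [G_2] is not unimodular, and [T] is the correction that this forces: squaring the kernel
    produces the Jacobian [jac] twice, while the change of variables [(w', v, u) |-> A] absorbs it
    only once. The weights of [sigma] and [opT] remove the second copy and leave [sqn w] divided by
    |t|. The first factor cancels the density of [mu_K]; the second becomes Lebesgue measure in the
    frequency 1/t after inversion of R^*. Since the kernel already contains the weight of [T], its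
    integral operator is defined on the whole space and is the extension sought.

    Two difficulties shape the rest. [sigmaL1] is a mere choice of an operator with prescribed
    matrix coefficients, so it must first be identified with a pointwise group integral. And the
    restrictions of [f] to fibres are integrable and square-integrable only almost everywhere, so
    changes of variables are proved for nonnegative functions and carried over to complex ones
    afterwards. Functions live on ambient types; as the inverse of 0 is 0, the weights vanish on
    most exceptional sets by themselves. *)

Local Notation mfunT := (measurable_fun setT).

(** * Integration of nonnegative functions *)

Section density_integral.
Local Open Scope ereal_scope.
Context d (T : measurableType d) (R : realType).
Variables (mu nu : {measure set T -> \bar R}) (w : T -> R).
Hypothesis mw : mfunT w.
Hypothesis w0 : forall x, (0 <= w x)%R.
Hypothesis nuE : forall A, measurable A -> nu A = \int[mu]_(x in A) (w x)%:E.

Import HBNNSimple.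

Let integral_density_nnsfun (h : {nnsfun T >-> R}) :
  \int[nu]_x (h x)%:E = \int[mu]_x ((h x)%:E * (w x)%:E).
Proof.
have mA k : measurable (h @^-1` [set k]) by [].
transitivity (\sum_(k \in range h) \int[mu]_x (k%:E * (\1_(h @^-1` [set k]) x * w x)%:E)).
  under eq_integral do rewrite fimfunE -fsumEFin//.
  rewrite ge0_integral_fsum//; last 2 first.
  - by move=> r; apply/measurable_EFinP; apply: measurable_funM.
  - by move=> r y _; rewrite EFinM nnfun_muleindic_ge0.
  apply: eq_fsbigr => k; rewrite inE => -[t _ <-].
  under eq_integral do rewrite EFinM.
  rewrite ge0_integralZl//; last 2 first.
  - exact/measurable_EFinP.
  - by rewrite lee_fin.
  rewrite ge0_integralZl//; last 3 first.
  - by apply/measurable_EFinP; exact: measurable_funM.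
  - by move=> x _; rewrite lee_fin mulr_ge0.
  - by rewrite lee_fin.
  congr (_ * _); rewrite integral_indic// setIT nuE// integral_mkcond.
  apply: eq_integral => x _; rewrite patchE indicE; case: ifPn => xA.
    by rewrite mul1r.
  by rewrite mul0r.
rewrite -ge0_integral_fsum//; last 2 first.
- by move=> r; apply/measurable_funeM/measurable_EFinP/measurable_funM.
- move=> r x _; rewrite EFinM muleA mule_ge0 ?lee_fin//.
  exact: nnfun_muleindic_ge0.
apply: eq_integral => x _.
under eq_fsbigr do rewrite -EFinM mulrA EFinM.
rewrite -ge0_mule_fsuml; last by move=> r; rewrite EFinM; exact: nnfun_muleindic_ge0.
by congr (_ * _); rewrite fsumEFin// -fimfunE.
Qed.

(** Simple functions first, then monotone convergence. The measures on R^*, on [GL_2], on [G_2] and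
    on nonzero rows are all densities, so this is the passage from them to Lebesgue integrals. *)
Lemma ge0_integral_density (g : T -> \bar R) :
  mfunT g -> (forall x, 0 <= g x) ->
  \int[nu]_x g x = \int[mu]_x (g x * (w x)%:E).
Proof.
move=> mg g0; pose h := nnsfun_approx measurableT mg.
have cvgh x : (EFin \o h ^~ x) n @[n --> \oo] --> g x.
  by apply: cvg_nnsfun_approx => //= y _; exact: g0.
transitivity (limn (fun n => \int[nu]_x (h n x)%:E)).
  rewrite -monotone_convergence//.
  - by apply: eq_integral => x _; apply/esym/cvg_lim => //; exact: cvgh.
  - by move=> n; exact/measurable_EFinP.
  - by move=> n x _; rewrite lee_fin.
  - by move=> x _ a b ab; rewrite lee_fin; exact/lefP/nd_nnsfun_approx.
under eq_fun do rewrite integral_density_nnsfun.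
rewrite -monotone_convergence//.
- apply: eq_integral => x _; apply/cvg_lim => //.
  by apply: cvgeZr => //; exact: cvgh.
- move=> n; apply: emeasurable_funM => //; exact/measurable_EFinP.
- by move=> n x _; rewrite mule_ge0 ?lee_fin.
- move=> x _ a b ab; rewrite lee_pmul ?lee_fin//.
  exact/lefP/nd_nnsfun_approx.
Qed.

End density_integral.

Section ge0_integral_setT.
Local Open Scope ereal_scope.
Context d (T : measurableType d) (R : realType) (mu : {measure set T -> \bar R}).
Implicit Types f g : T -> \bar R.

Lemma ge0_integralZT f (k : R) : mfunT f -> (forall x, 0 <= f x) ->
  (0 <= k)%R -> \int[mu]_x (k%:E * f x) = k%:E * \int[mu]_x f x.
Proof. by move=> mf f0 k0; rewrite ge0_integralZl. Qed.

Lemma ge0_integralDT f g : mfunT f -> (forall x, 0 <= f x) ->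
  mfunT g -> (forall x, 0 <= g x) ->
  \int[mu]_x (f x + g x) = \int[mu]_x f x + \int[mu]_x g x.
Proof. by move=> mf f0 mg g0; rewrite ge0_integralD. Qed.

Lemma ge0_le_integralT f g : mfunT f -> (forall x, 0 <= f x) ->
  mfunT g -> (forall x, f x <= g x) ->
  \int[mu]_x f x <= \int[mu]_x g x.
Proof.
move=> mf f0 mg fg; apply: ge0_le_integral => //.
Qed.

Lemma ge0_integralZTr f (k : R) : mfunT f -> (forall x, 0 <= f x) ->
  (0 <= k)%R -> \int[mu]_x (f x * k%:E) = \int[mu]_x f x * k%:E.
Proof.
move=> mf f0 k0; rewrite muleC -(ge0_integralZT mf f0 k0).
by apply: eq_integral => x _; rewrite muleC.
Qed.

Lemma integral_ge0T f : (forall x, 0 <= f x) -> 0 <= \int[mu]_x f x.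
Proof. by move=> f0; apply: integral_ge0 => x _. Qed.

End ge0_integral_setT.

Lemma tonelli d1 d2 (T1 : measurableType d1) (T2 : measurableType d2) (R : realType)
  (m1 : {sigma_finite_measure set T1 -> \bar R})
  (m2 : {sigma_finite_measure set T2 -> \bar R}) (f : T1 -> T2 -> \bar R) :
  mfunT (fun z : T1 * T2 => f z.1 z.2) -> (forall x y, 0 <= f x y)%E ->
  (\int[m1]_x \int[m2]_y f x y = \int[m2]_y \int[m1]_x f x y)%E.
Proof.
move=> mf f0; exact: (@fubini_tonelli _ _ _ _ R m1 m2 (fun z => f z.1 z.2) mf (fun z => f0 _ _)).
Qed.

Lemma measurable_integralr d1 d2 (T1 : measurableType d1) (T2 : measurableType d2) (R : realType)
  (m2 : {sigma_finite_measure set T2 -> \bar R}) (f : T1 -> T2 -> \bar R) :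
  mfunT (fun z : T1 * T2 => f z.1 z.2) -> (forall x y, 0 <= f x y)%E ->
  mfunT (fun x => \int[m2]_y f x y)%E.
Proof.
move=> mf f0; exact: (@measurable_fun_fubini_tonelli_F _ _ _ _ R m2 (fun z => f z.1 z.2) mf (fun z => f0 _ _)).
Qed.

Lemma measurable_integrall d1 d2 (T1 : measurableType d1) (T2 : measurableType d2) (R : realType)
  (m1 : {sigma_finite_measure set T1 -> \bar R}) (f : T1 -> T2 -> \bar R) :
  mfunT (fun z : T1 * T2 => f z.1 z.2) -> (forall x y, 0 <= f x y)%E ->
  mfunT (fun y => \int[m1]_x f x y)%E.
Proof.
move=> mf f0; exact: (@measurable_fun_fubini_tonelli_G _ _ _ _ R m1 (fun z => f z.1 z.2) mf (fun z => f0 _ _)).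
Qed.

Section ae.
Context d (T : measurableType d) (R : realType) (mu : {measure set T -> \bar R}).
Implicit Types P Q : T -> Prop.

Lemma ae_mono P Q : (forall x, P x -> Q x) ->
  {ae mu, forall x, P x} -> {ae mu, forall x, Q x}.
Proof. by move=> PQ; apply: filterS. Qed.

Lemma ae_and P Q : {ae mu, forall x, P x} -> {ae mu, forall x, Q x} ->
  {ae mu, forall x, P x /\ Q x}.
Proof. by move=> aP aQ; apply: filterS2 aP aQ => x. Qed.

Local Open Scope ereal_scope.
Implicit Types f g : T -> \bar R.

Lemma ge0_ae_eq_integral f g : mfunT f -> mfunT g ->
  {ae mu, forall x, f x = g x} -> \int[mu]_x f x = \int[mu]_x g x.
Proof.
move=> mf mg fg; apply: ae_eq_integral; [exact: measurableT|exact: mf|exact: mg|].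
by apply: ae_mono fg => x ->.
Qed.

Lemma ae_lty f : mfunT f -> (forall x, 0 <= f x) ->
  \int[mu]_x f x < +oo -> {ae mu, forall x, f x < +oo}.
Proof.
move=> mf f0 foo.
have h : mu.-integrable setT f.
  apply/integrableP; split; first exact: mf.
  suff -> : (\int[mu]_x `|f x| = \int[mu]_x f x) by exact: foo.
  by apply: eq_integral => x _; rewrite gee0_abs.
apply: ae_mono (integrable_ae measurableT h) => x /(_ I).
by rewrite ge0_fin_numE.
Qed.

End ae.

Lemma mule_half_double (R : realType) (x : \bar R) : ((2^-1)%:E * (2%:E * x) = x)%E.
Proof. by rewrite muleA -EFinM mulVf ?pnatr_eq0// mul1e. Qed.

(** Cauchy-Schwarz is used below in squared form, which bounds the product of an integral with
    itself; this recovers finiteness of the integral. *)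
Lemma mule_self_lty (R : realType) (x : \bar R) : (0 <= x)%E -> (x * x < +oo)%E -> (x < +oo)%E.
Proof. by case: x => [r _ _||]; [exact: ltry|rewrite mulyy|rewrite leeNy_eq]. Qed.

Section measurable_real.
Context (R : realType).
Local Notation RL := (measurableTypeR R).

Lemma measurable_invr : mfunT (fun t : RL => t^-1 : RL).
Proof.
(* This form inverts a nonnegative function only, and it remains correct at 0. *)
have -> : (fun t : RL => t^-1 : RL) = (fun t : RL => t * (t ^+ 2)^-1).
  apply/funext => t; have [->|t0] := eqVneq t (0 : R); first by rewrite invr0 mul0r.
  by rewrite expr2 invfM mulrA divff// mul1r.
apply: measurable_funM; first exact: measurable_id.
apply: measurable_inv_ge0 => [t|]; first exact: sqr_ge0.
by apply: measurable_funX; exact: measurable_id.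
Qed.

Lemma measurable_div d (T : measurableType d) (f g : T -> R) :
  mfunT f -> mfunT g -> mfunT (fun x => f x / g x).
Proof.
move=> mf mg; apply: measurable_funM => //.
exact: (measurableT_comp measurable_invr mg).
Qed.

Lemma measurable_sqrt d (T : measurableType d) (g : T -> R) : mfunT g ->
  mfunT (fun z => Num.sqrt (g z)).
Proof.
move=> mg; apply: (@measurableT_comp _ _ _ _ _ _ (@Num.sqrt R)) mg.
by apply: continuous_measurable_fun; exact: sqrt_continuous.
Qed.

End measurable_real.

(** * Complex numbers and measurability *)

Section complex_algebra.
Context (R : realType).
Implicit Types (z y : R[i]) (x : R).
Local Notation normc := (@Normc.normc R).

(** The squared modulus as a polynomial in the two parts, free of square roots, so that [ring]
    decides its identities. *)
Definition nsq z : R := complex.Re z ^+ 2 + complex.Im z ^+ 2.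

Lemma nsq_ge0 z : 0 <= nsq z.
Proof. by rewrite addr_ge0 ?sqr_ge0. Qed.

Lemma normcE z : normc z = Num.sqrt (nsq z).
Proof. by case: z. Qed.

Lemma normc_ge0 z : 0 <= normc z.
Proof. by rewrite normcE sqrtr_ge0. Qed.

Lemma sqr_normc z : normc z ^+ 2 = nsq z.
Proof. by rewrite normcE sqr_sqrtr// nsq_ge0. Qed.

Lemma nsqM z y : nsq (z * y) = nsq z * nsq y.
Proof. by rewrite -!sqr_normc Normc.normcM exprMn. Qed.

Lemma nsqJ z : nsq (z^*) = nsq z.
Proof. by case: z => a b; rewrite /nsq/= sqrrN. Qed.

Lemma nsq_real x : nsq x%:C = x ^+ 2.
Proof. by rewrite /nsq/= expr0n addr0. Qed.

Lemma nsq0 : nsq 0 = 0.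
Proof. by rewrite /nsq/= expr0n addr0. Qed.

Lemma nsq_eq0 z : (nsq z == 0) = (z == 0).
Proof.
by case: z => a b; rewrite /nsq paddr_eq0 ?sqr_ge0// !sqrf_eq0 eq_complex.
Qed.

Lemma nsq_expi x : nsq (expi x) = 1.
Proof. by rewrite /nsq/= cos2Dsin2. Qed.

Lemma normcJ z : normc (z^*) = normc z.
Proof. by rewrite !normcE nsqJ. Qed.

Lemma normc_expi x : normc (expi x) = 1.
Proof. by rewrite normcE nsq_expi sqrtr1. Qed.

Lemma normc_real x : normc x%:C = `|x|.
Proof. by rewrite normcE nsq_real sqrtr_sqr. Qed.

Lemma normc_eq0 z : (normc z == 0) = (z == 0).
Proof. by rewrite -sqrf_eq0 sqr_normc nsq_eq0. Qed.

(** This identity carries Plancherel from nonnegative to signed functions, and from real to complex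
    ones, without any inner product. *)
Lemma nsq_parallelogram z y : nsq (z + y) + nsq (z - y) = 2 * nsq z + 2 * nsq y.
Proof. by case: z y => a b [c e]; rewrite /nsq/=; ring. Qed.

Lemma nsqD_le z y : nsq (z + y) <= 2 * nsq z + 2 * nsq y.
Proof. by rewrite -nsq_parallelogram lerDl nsq_ge0. Qed.

Lemma normr_Re_le z : `|complex.Re z| <= normc z.
Proof.
by rewrite -sqrtr_sqr normcE ler_sqrt ?nsq_ge0// /nsq lerDl sqr_ge0.
Qed.

Lemma normr_Im_le z : `|complex.Im z| <= normc z.
Proof.
by rewrite -sqrtr_sqr normcE ler_sqrt ?nsq_ge0// /nsq lerDr sqr_ge0.
Qed.

Lemma normc_le_ReIm z : normc z <= `|complex.Re z| + `|complex.Im z|.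
Proof.
rewrite normcE -[leRHS]ger0_norm ?addr_ge0// -sqrtr_sqr ler_sqrt ?sqr_ge0//.
rewrite sqrrD !real_normK ?num_real// /nsq lerD2r lerDl mulrn_wge0//.
Qed.

Lemma normcM_le z y : normc (z * y) <= (nsq z + nsq y) / 2.
Proof.
rewrite Normc.normcM -!sqr_normc ler_pdivlMr//.
by have := sqr_ge0 (normc z - normc y); nra.
Qed.

Lemma expiD (x y : R) : expi (x + y) = expi x * expi y.
Proof. by rewrite /expi cosD sinD; apply/eqP; rewrite eq_complex/=; apply/andP; split; apply/eqP; ring. Qed.

Lemma expiN (x : R) : expi (- x) = (expi x)^*.
Proof. by rewrite /expi cosN sinN. Qed.

Lemma cReM z y : complex.Re (z * y) = complex.Re z * complex.Re y - complex.Im z * complex.Im y.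
Proof. by case: z y => a b []. Qed.
Lemma cImM z y : complex.Im (z * y) = complex.Re z * complex.Im y + complex.Im z * complex.Re y.
Proof. by case: z y => a b []. Qed.
Lemma cReD z y : complex.Re (z + y) = complex.Re z + complex.Re y.
Proof. by case: z y => a b []. Qed.
Lemma cImD z y : complex.Im (z + y) = complex.Im z + complex.Im y.
Proof. by case: z y => a b []. Qed.
Lemma cMJ z y : (z * y)^* = z^* * y^*.
Proof. exact: rmorphM. Qed.
Lemma cReJ z : complex.Re (z^*) = complex.Re z.
Proof. by case: z. Qed.
Lemma cImJ z : complex.Im (z^*) = - complex.Im z.
Proof. by case: z. Qed.

End complex_algebra.

Section cmeasurable_theory.
Context d (T : measurableType d) (R : realType).
Implicit Types (f g : T -> R[i]) (h : T -> R).
Local Notation normc := (@Normc.normc R).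

Lemma cmeasurableD f g : cmeasurable f -> cmeasurable g ->
  cmeasurable (fun x => f x + g x).
Proof.
move=> [fR fI] [gR gI]; split.
- by under eq_fun do rewrite cReD; exact: measurable_funD.
- by under eq_fun do rewrite cImD; exact: measurable_funD.
Qed.

Lemma cmeasurableM f g : cmeasurable f -> cmeasurable g ->
  cmeasurable (fun x => f x * g x).
Proof.
move=> [fR fI] [gR gI]; split.
- by under eq_fun do rewrite cReM; apply: measurable_funB; exact: measurable_funM.
- by under eq_fun do rewrite cImM; apply: measurable_funD; exact: measurable_funM.
Qed.

Lemma cmeasurableJ f : cmeasurable f -> cmeasurable (fun x => (f x)^*).
Proof.
move=> [fR fI]; split.
- by under eq_fun do rewrite cReJ.
- by under eq_fun do rewrite cImJ; exact: measurableT_comp.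
Qed.

Lemma cmeasurable_cst (a : R[i]) : cmeasurable (fun _ : T => a).
Proof. by split; exact: measurable_cst. Qed.

Lemma cmeasurableN f : cmeasurable f -> cmeasurable (fun x => - f x).
Proof.
move=> mf; under eq_fun do rewrite -mulN1r.
by apply: cmeasurableM => //; exact: cmeasurable_cst.
Qed.

Lemma cmeasurableB f g : cmeasurable f -> cmeasurable g ->
  cmeasurable (fun x => f x - g x).
Proof. by move=> mf mg; apply: cmeasurableD => //; exact: cmeasurableN. Qed.

Lemma cmeasurable_real h : mfunT h -> cmeasurable (fun x => (h x)%:C).
Proof. by move=> mh; split => //; exact: measurable_cst. Qed.

Lemma cmeasurable_expi h : mfunT h -> cmeasurable (fun x => expi (h x)).
Proof.
move=> mh; split => /=.
- apply: measurableT_comp mh; apply: continuous_measurable_fun; exact: continuous_cos.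
- apply: measurableT_comp mh; apply: continuous_measurable_fun; exact: continuous_sin.
Qed.

Lemma measurable_nsq f : cmeasurable f -> mfunT (fun x => nsq (f x)).
Proof. by move=> [fR fI]; apply: measurable_funD; exact: measurable_funX. Qed.

Lemma measurable_normc f : cmeasurable f -> mfunT (fun x => normc (f x)).
Proof.
move=> mf; under eq_fun do rewrite normcE -powR12_sqrt ?nsq_ge0//.
by apply: (@measurableT_comp _ _ _ _ _ _ (@powR R ^~ 2^-1)) => //; exact: measurable_nsq.
Qed.

End cmeasurable_theory.

Lemma cmeasurable_comp d (T : measurableType d) d' (T' : measurableType d') (R : realType)
  (f : T' -> R[i]) (g : T -> T') : cmeasurable f -> mfunT g ->
  cmeasurable (fun x => f (g x)).
Proof.
by move=> [fR fI] mg; split;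
  [exact: (measurableT_comp fR mg)|exact: (measurableT_comp fI mg)].
Qed.

Ltac measurable_atom := first [exact: measurable_id | exact: measurable_fst
  | exact: measurable_snd | exact: measurable_invr | exact: normr_measurable
  | exact: measurable_expR | exact: measurable_kgamma | exact: measurable_mkcol
  | exact: measurable_mkrow | exact: measurable_mkmx | exact: measurable_det2
  | exact: oppr_measurable | exact: (continuous_measurable_fun (@continuous_cos _))
  | exact: (continuous_measurable_fun (@continuous_sin _))
  | assumption].

(** Extension point: replaced by [::=] once new functions have their measurability lemmas, so that
    [measurable_step] finds them. *)
Ltac measurable_hook := fail.

(** The order matters: the hook is tried before local definitions are unfolded, and composition with
    an arbitrary function comes after all structural rules. *)
Ltac measurable_step := match goal with
  | |- measurable_fun _ (fun _ => ?c) => exact: measurable_cst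
  | |- measurable_fun _ _ => assumption
  | |- cmeasurable _ => assumption
  | |- measurable_fun _ (fun _ => (_)%:E) => apply/measurable_EFinP
  | |- measurable_fun _ (EFin \o _) => apply/measurable_EFinP
  | |- measurable_fun _ (fun _ => (_, _)) => apply: measurable_fun_pair
  | |- measurable_fun _ (fun _ => mule _ _) => apply: emeasurable_funM
  | |- measurable_fun _ (fun _ => GRing.add _ (GRing.opp _)) => apply: measurable_funB
  | |- measurable_fun _ (fun _ => GRing.add _ _) => apply: measurable_funD
  | |- measurable_fun _ (fun _ => GRing.add _ _) => apply: emeasurable_funD
  | |- measurable_fun _ (fun _ => adde _ _) => apply: emeasurable_funD
  | |- measurable_fun _ (fun _ => GRing.mul _ _) => apply: measurable_funM
  | |- measurable_fun _ (fun _ => GRing.exp _ _) => apply: measurable_funX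
  | |- measurable_fun _ (fun _ => Num.sqrt _) => apply: measurable_sqrt
  | |- measurable_fun _ (fun _ => nsq _) => apply: measurable_nsq
  | |- measurable_fun _ (fun _ => Normc.normc _) => apply: measurable_normc
  | |- cmeasurable (fun _ => ?c) => exact: cmeasurable_cst
  | |- cmeasurable (fun _ => GRing.mul _ _) => apply: cmeasurableM
  | |- cmeasurable (fun _ => GRing.add _ _) => apply: cmeasurableD
  | |- cmeasurable (fun _ => (_)%:C) => apply: cmeasurable_real
  | |- cmeasurable (fun _ => expi _) => apply: cmeasurable_expi
  | |- cmeasurable (fun _ => (_)^*) => apply: cmeasurableJ
  | H : cmeasurable ?f |- cmeasurable (fun _ => ?f _) => apply: (cmeasurable_comp H)
  | H : mfunT ?f |- measurable_fun _ (fun _ => ?f _) => apply: (measurableT_comp H)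
  | |- _ => measurable_hook
  | |- measurable_fun _ (fun _ => ?h _) => is_var h; rewrite /h
  | |- measurable_fun _ (fun _ => ?h _ _) => is_var h; rewrite /h
  | |- measurable_fun _ (fun _ => ?h _ _ _) => is_var h; rewrite /h
  | |- measurable_fun _ (fun _ => fun_of_matrix _ ?i ?j) =>
      apply: (measurableT_comp (measurable_entry i j))
  | |- measurable_fun _ (fun _ => ?h _) =>
      apply: (@measurableT_comp _ _ _ _ _ _ h); [measurable_atom|]
  | |- measurable_fun _ _ => measurable_atom
  end.

Ltac measurability := intros; repeat measurable_step.

(** * Complex-valued integrals *)

Section cintegral_theory.
Context d (T : measurableType d) (R : realType) (mu : {measure set T -> \bar R}).
Implicit Types (f g : T -> R[i]).
Local Notation normc := (@Normc.normc R).

Definition cintegrable f : Prop :=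
  cmeasurable f /\ (\int[mu]_x (normc (f x))%:E < +oo)%E.

Lemma integrable_Re f : cintegrable f ->
  mu.-integrable setT (EFin \o (fun x => complex.Re (f x))).
Proof.
move=> [mf foo]; apply/integrableP; split; first by apply/measurable_EFinP; case: mf.
apply: le_lt_trans foo; apply: ge0_le_integral => //=.
- apply/measurable_EFinP; apply: measurableT_comp => //; by case: mf.
- by measurability.
- by move=> x _; rewrite lee_fin normr_Re_le.
Qed.

Lemma integrable_Im f : cintegrable f ->
  mu.-integrable setT (EFin \o (fun x => complex.Im (f x))).
Proof.
move=> [mf foo]; apply/integrableP; split; first by apply/measurable_EFinP; case: mf.
apply: le_lt_trans foo; apply: ge0_le_integral => //=.
- apply/measurable_EFinP; apply: measurableT_comp => //; by case: mf.
- by measurability.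
- by move=> x _; rewrite lee_fin normr_Im_le.
Qed.

Lemma cintegrable_ReIm f :
  mu.-integrable setT (EFin \o (fun x => complex.Re (f x))) ->
  mu.-integrable setT (EFin \o (fun x => complex.Im (f x))) -> cintegrable f.
Proof.
move=> /integrableP[mR Roo] /integrableP[mI Ioo].
have mf : cmeasurable f by split; exact/measurable_EFinP.
split => //.
apply: (@le_lt_trans _ _ (\int[mu]_x (`|(complex.Re (f x))%:E| + `|(complex.Im (f x))%:E|))%E).
  apply: ge0_le_integral => //=.
  - by move=> x _; rewrite lee_fin normc_ge0.
  - by measurability.
  - by apply: emeasurable_funD; apply/measurable_EFinP; apply: measurableT_comp => //; case: mf.
  - by move=> x _; rewrite -EFinD lee_fin normc_le_ReIm.
rewrite ge0_integralD//=; first exact: lte_add_pinfty.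
- by apply/measurable_EFinP; apply: measurableT_comp => //; case: mf.
- by apply/measurable_EFinP; apply: measurableT_comp => //; case: mf.
Qed.

Lemma cintegrable_le f g : cmeasurable f -> cintegrable g ->
  (forall x, normc (f x) <= normc (g x)) -> cintegrable f.
Proof.
move=> mf [mg goo] fg; split => //; apply: le_lt_trans goo.
apply: ge0_le_integral => //=.
- by move=> x _; rewrite lee_fin normc_ge0.
- by measurability.
- by measurability.
- by move=> x _; rewrite lee_fin.
Qed.

Lemma cintegrableD f g : cintegrable f -> cintegrable g ->
  cintegrable (fun x => f x + g x).
Proof.
move=> cf cg; apply: cintegrable_ReIm.
- under eq_fun do rewrite cReD.
  exact: (integrableD measurableT (integrable_Re cf) (integrable_Re cg)).
- under eq_fun do rewrite cImD.
  exact: (integrableD measurableT (integrable_Im cf) (integrable_Im cg)).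
Qed.

Lemma cintegrableZ (a : R[i]) f : cintegrable f -> cintegrable (fun x => a * f x).
Proof.
move=> [mf foo]; split; first by apply: cmeasurableM => //; exact: cmeasurable_cst.
under eq_integral do rewrite Normc.normcM EFinM.
rewrite ge0_integralZl//.
- by rewrite lte_mul_pinfty// lee_fin normc_ge0.
- by measurability.
- by move=> x _; rewrite lee_fin normc_ge0.
- by rewrite lee_fin normc_ge0.
Qed.

Lemma cintegrable_real (h : T -> R) : mu.-integrable setT (EFin \o h) ->
  cintegrable (fun x => (h x)%:C).
Proof.
by move=> ih; apply: cintegrable_ReIm => //=; exact: integrable0.
Qed.

Lemma eq_cintegral f g : f =1 g -> cintegral mu f = cintegral mu g.
Proof. by move=> /funext ->. Qed.

Lemma cintegralD f g : cintegrable f -> cintegrable g ->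
  cintegral mu (fun x => f x + g x) = cintegral mu f + cintegral mu g.
Proof.
move=> cf cg; rewrite /cintegral.
apply/eqP; rewrite eq_complex/=; apply/andP; split; apply/eqP.
- under eq_Rintegral do rewrite cReD.
  by rewrite RintegralD//; exact: integrable_Re.
- under eq_Rintegral do rewrite cImD.
  by rewrite RintegralD//; exact: integrable_Im.
Qed.

Lemma cintegralZ (a : R[i]) f : cintegrable f ->
  cintegral mu (fun x => a * f x) = a * cintegral mu f.
Proof.
move=> cf; have iR := integrable_Re cf; have iI := integrable_Im cf.
have sR (c : R) : mu.-integrable setT (EFin \o (fun x => c * complex.Re (f x))).
  exact: (integrableZl measurableT c iR).
have sI (c : R) : mu.-integrable setT (EFin \o (fun x => c * complex.Im (f x))).
  exact: (integrableZl measurableT c iI).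
rewrite /cintegral; apply/eqP; rewrite eq_complex/= cReM cImM/=.
apply/andP; split; apply/eqP.
- under eq_Rintegral do rewrite cReM.
  by rewrite RintegralB// !RintegralZl.
- under eq_Rintegral do rewrite cImM.
  by rewrite RintegralD// !RintegralZl.
Qed.

Lemma cintegralZr (a : R[i]) f : cintegrable f ->
  cintegral mu (fun x => f x * a) = cintegral mu f * a.
Proof.
by move=> cf; rewrite mulrC -cintegralZ//; apply: eq_cintegral => x; rewrite mulrC.
Qed.

Lemma cintegralJ f : cintegrable f ->
  cintegral mu (fun x => (f x)^*) = (cintegral mu f)^*.
Proof.
move=> cf; rewrite /cintegral/=; congr (_ +i* _).
- by apply: eq_Rintegral => x _; rewrite cReJ.
- under eq_Rintegral do rewrite cImJ -mulN1r.
  by rewrite RintegralZl ?mulN1r//; exact: integrable_Im.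
Qed.

Lemma cintegral0 : cintegral mu (fun _ => 0) = 0.
Proof.
by rewrite /cintegral/= /Rintegral integral0.
Qed.

(** Rotation argument: multiplying [f] by the conjugate of its integral [z] makes the integral the
    real number [normc z ^+ 2]; the estimate for real parts applies, and one factor [normc z] is
    cancelled. *)
Lemma normc_cintegral_le f : cintegrable f ->
  ((normc (cintegral mu f))%:E <= \int[mu]_x (normc (f x))%:E)%E.
Proof.
move=> cf; have [mf foo] := cf; set z := cintegral mu f.
have inorm : mu.-integrable setT (EFin \o (fun x => normc (f x))).
  apply/integrableP; split; first by apply/measurable_EFinP; exact: measurable_normc.
  by under eq_integral do rewrite /= ger0_norm ?normc_ge0//.
have [z0|z0] := eqVneq z 0.
  by rewrite z0 Normc.normc0; apply: integral_ge0 => x _; rewrite lee_fin normc_ge0.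
have nz : 0 < normc z by rewrite lt_neqAle eq_sym normc_eq0 z0 normc_ge0.
have -> : (\int[mu]_x (normc (f x))%:E)%E = (\int[mu]_x normc (f x))%:E.
  by rewrite /Rintegral fineK//; exact: integrable_fin_num inorm.
rewrite lee_fin -(ler_pM2l nz).
have -> : normc z * normc z = complex.Re (cintegral mu (fun x => z^* * f x)).
  rewrite cintegralZ// -/z -expr2 sqr_normc.
  by case: (z) => a b; rewrite /nsq/=; ring.
rewrite /cintegral/=; have cg := cintegrableZ (z^*) cf.
apply: le_trans (ler_norm _) _.
apply: le_trans (le_normr_Rintegral _ (integrable_Re cg)) _ => //.
rewrite -RintegralZl//; apply: le_Rintegral => //.
- exact: integrable_norm (integrable_Re cg).
- exact: (integrableZl measurableT (normc z) inorm).
- by move=> x _; apply: le_trans (normr_Re_le _) _; rewrite Normc.normcM normcJ.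
Qed.

Lemma ae_eq_cintegral f g : cmeasurable f -> cmeasurable g ->
  {ae mu, forall x, f x = g x} -> cintegral mu f = cintegral mu g.
Proof.
move=> [fR fI] [gR gI] fg; rewrite /cintegral /Rintegral; congr (fine _ +i* fine _).
- apply: ae_eq_integral => //; [exact/measurable_EFinP|exact/measurable_EFinP|].
  by apply: filterS fg => x /= -> _.
- apply: ae_eq_integral => //; [exact/measurable_EFinP|exact/measurable_EFinP|].
  by apply: filterS fg => x /= -> _.
Qed.

Lemma cintegrable_sum n (F : 'I_n -> T -> R[i]) : (forall i, cintegrable (F i)) ->
  cintegrable (fun x => \sum_(i < n) F i x).
Proof.
elim: n F => [|n ih] F mF.
  under eq_fun do rewrite big_ord0; apply: cintegrable_real; exact: integrable0.
under eq_fun do rewrite big_ord_recr/=.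
by apply: cintegrableD => //; exact: ih.
Qed.

Lemma cintegral_sum n (F : 'I_n -> T -> R[i]) : (forall i, cintegrable (F i)) ->
  cintegral mu (fun x => \sum_(i < n) F i x) = \sum_(i < n) cintegral mu (F i).
Proof.
elim: n F => [|n ih] F mF.
  rewrite big_ord0 (_ : (fun x => _) = fun _ => 0) ?cintegral0//.
  by apply/funext => x; rewrite big_ord0.
rewrite big_ord_recr/= -ih// -cintegralD//; last exact: cintegrable_sum.
by apply: eq_cintegral => x; rewrite big_ord_recr.
Qed.

End cintegral_theory.

Section cintegral_fubini.
Context d1 d2 (T1 : measurableType d1) (T2 : measurableType d2) (R : realType).
Variables (m1 : {sigma_finite_measure set T1 -> \bar R}).
Variables (m2 : {sigma_finite_measure set T2 -> \bar R}).
Local Notation normc := (@Normc.normc R).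

Lemma cmeasurable_section1 (f : T1 * T2 -> R[i]) x :
  cmeasurable f -> cmeasurable (fun y => f (x, y)).
Proof. by move=> [fR fI]; split; [exact: (measurable_fun_pair2 x fR)|exact: (measurable_fun_pair2 x fI)]. Qed.

Lemma cmeasurable_section2 (f : T1 * T2 -> R[i]) y :
  cmeasurable f -> cmeasurable (fun x => f (x, y)).
Proof. by move=> [fR fI]; split; [exact: (measurable_fun_pair1 y fR)|exact: (measurable_fun_pair1 y fI)]. Qed.

Lemma measurable_integral1 (g : T1 * T2 -> \bar R) : mfunT g ->
  (forall z, (0 <= g z)%E) -> mfunT (fun x => \int[m2]_y g (x, y))%E.
Proof. by move=> mg g0; exact: (@measurable_fun_fubini_tonelli_F _ _ _ _ R m2 g mg g0). Qed.

Lemma measurable_integral2 (g : T1 * T2 -> \bar R) : mfunT g ->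
  (forall z, (0 <= g z)%E) -> mfunT (fun y => \int[m1]_x g (x, y))%E.
Proof. by move=> mg g0; exact: (@measurable_fun_fubini_tonelli_G _ _ _ _ R m1 g mg g0). Qed.

(** Tonelli gives measurability for the positive and the negative part separately; where a section
    is not integrable, [fine] supplies a default value and measurability persists. *)
Lemma measurable_Rintegral_section (h : T1 * T2 -> R) : mfunT h ->
  mfunT (fun x => \int[m2]_y h (x, y)).
Proof.
move=> mh; have mhE : mfunT (EFin \o h) by exact/measurable_EFinP.
apply: (@measurableT_comp _ _ _ _ _ _ (@fine R)) => //.
under eq_fun do rewrite integralE.
apply: emeasurable_funB.
- have h0 z : (0 <= (EFin \o h)^\+ z)%E by [].
  have := @measurable_fun_fubini_tonelli_F _ _ _ _ R m2 _ (measurable_funepos mhE) h0.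
  by apply: eq_measurable_fun => x _; rewrite /fubini_F; apply: eq_integral => y _; rewrite !unlock.
- have h0 z : (0 <= (EFin \o h)^\- z)%E by [].
  have := @measurable_fun_fubini_tonelli_F _ _ _ _ R m2 _ (measurable_funeneg mhE) h0.
  by apply: eq_measurable_fun => x _; rewrite /fubini_F; apply: eq_integral => y _; rewrite !unlock.
Qed.

Lemma cmeasurable_cintegral (f : T1 * T2 -> R[i]) : cmeasurable f ->
  cmeasurable (fun x => cintegral m2 (fun y => f (x, y))).
Proof.
move=> [fR fI].
by split; [exact: (measurable_Rintegral_section fR)|exact: (measurable_Rintegral_section fI)].
Qed.

Variable f : T1 * T2 -> R[i].
Hypothesis mf : cmeasurable f.

Lemma measurable_EFin_normc : mfunT (fun z => (normc (f z))%:E).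
Proof. by apply/measurable_EFinP; exact: measurable_normc. Qed.

Hypothesis foo : (\int[m1]_x \int[m2]_y (normc (f (x, y)))%:E < +oo)%E.

Lemma cintegrable_prod : cintegrable (m1 \x m2)%E f.
Proof.
split => //; rewrite fubini_tonelli1//; first exact: measurable_EFin_normc.
by move=> z; rewrite lee_fin normc_ge0.
Qed.

Lemma ae_cintegrable1 : {ae m1, forall x, cintegrable m2 (fun y => f (x, y))}.
Proof.
have cf := cintegrable_prod.
have h1 := ae_integrable1 (integrable_Re cf).
have h2 := ae_integrable1 (integrable_Im cf).
by apply: filterS2 h1 h2 => x /= ? ?; exact: cintegrable_ReIm.
Qed.

Lemma cintegrable_cintegral : cintegrable m1 (fun x => cintegral m2 (fun y => f (x, y))).
Proof.
split; first exact: cmeasurable_cintegral.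
apply: le_lt_trans foo; apply: ae_ge0_le_integral => //.
- by move=> x _; rewrite lee_fin normc_ge0.
- by apply/measurable_EFinP; apply: measurable_normc; exact: cmeasurable_cintegral.
- by move=> x _; apply: integral_ge0 => y _; rewrite lee_fin normc_ge0.
- apply: (measurable_integral1 measurable_EFin_normc) => z.
  by rewrite lee_fin normc_ge0.
- by apply: filterS ae_cintegrable1 => x cx _; exact: normc_cintegral_le.
Qed.

Let Rintegral_prod1 (h : T1 * T2 -> R) : (m1 \x m2)%E.-integrable setT (EFin \o h) ->
  \int[m1]_x (\int[m2]_y h (x, y)) = \int[(m1 \x m2)%E]_z h z.
Proof.
move=> ih; rewrite /Rintegral -(integral12_prod_meas1 ih); congr fine.
(* The inner real integral is [fine] of the extended one. The two agree where the section is
   integrable, which is almost everywhere. *)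
apply: ae_eq_integral => //.
- have mh : mfunT h by apply/measurable_EFinP; exact: measurable_int ih.
  by apply/measurable_EFinP; exact: measurable_Rintegral_section.
- exact: measurable_fubini_F ih.
- apply: filterS (ae_integrable1 ih) => x /= hx _.
  by rewrite /fubini_F /fubini_G fineK//; exact: (integrable_fin_num measurableT hx).
Qed.

Lemma cintegral_prod1 :
  cintegral m1 (fun x => cintegral m2 (fun y => f (x, y))) = cintegral (m1 \x m2)%E f.
Proof.
have cf := cintegrable_prod; rewrite /cintegral /=; congr (_ +i* _).
- exact: (Rintegral_prod1 (integrable_Re cf)).
- exact: (Rintegral_prod1 (integrable_Im cf)).
Qed.

Let Rintegral_prod2 (h : T1 * T2 -> R) : (m1 \x m2)%E.-integrable setT (EFin \o h) ->
  \int[m2]_y (\int[m1]_x h (x, y)) = \int[(m1 \x m2)%E]_z h z.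
Proof.
move=> ih; rewrite /Rintegral -(integral21_prod_meas1 ih); congr fine.
apply: ae_eq_integral => //.
- apply/measurable_EFinP; apply: (@measurableT_comp _ _ _ _ _ _ (@fine R)) => //.
  exact: measurable_fubini_G ih.
- exact: measurable_fubini_G ih.
- apply: filterS (ae_integrable2 ih) => x /= hx _.
  by rewrite /fubini_F /fubini_G fineK//; exact: (integrable_fin_num measurableT hx).
Qed.

Lemma cintegral_fubini :
  cintegral m1 (fun x => cintegral m2 (fun y => f (x, y))) =
  cintegral m2 (fun y => cintegral m1 (fun x => f (x, y))).
Proof.
rewrite cintegral_prod1; have cf := cintegrable_prod; rewrite /cintegral /=; congr (_ +i* _).
- exact/esym/(Rintegral_prod2 (integrable_Re cf)).
- exact/esym/(Rintegral_prod2 (integrable_Im cf)).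
Qed.

End cintegral_fubini.

Section cintegral_transfer.
Context d1 d2 (T1 : measurableType d1) (T2 : measurableType d2) (R : realType).
Variables (mu : {measure set T1 -> \bar R}) (nu : {measure set T2 -> \bar R}).
Variables (S : T2 -> T1) (w : T2 -> R).
Hypothesis w0 : forall y, 0 <= w y.
Hypothesis transfer : forall phi : T1 -> \bar R, mfunT phi ->
  (forall x, 0 <= phi x)%E ->
  (\int[mu]_x phi x = \int[nu]_y (phi (S y) * (w y)%:E))%E.

Let Rintegral_transfer (h : T1 -> R) : mfunT h ->
  \int[mu]_x h x = \int[nu]_y (w y * h (S y)).
Proof.
move=> mh; have mhE : mfunT (EFin \o h) by exact/measurable_EFinP.
rewrite /Rintegral integralE [in RHS]integralE; congr (fine (_ - _))%E.
- rewrite (transfer (measurable_funepos mhE))//.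
  apply: eq_integral => y _; rewrite !unlock/= -EFin_max -EFinM -EFin_max.
  by rewrite mulrC maxr_pMr// mulr0.
- rewrite (transfer (measurable_funeneg mhE))//.
  apply: eq_integral => y _; rewrite !unlock/= -EFin_max -EFinM -EFin_max.
  by rewrite mulrC maxr_pMr// mulr0 mulrN.
Qed.

(** A nonnegative weight commutes with positive and negative parts, so a change of variables known
    for nonnegative functions holds for complex ones. It moves the integral defining sigma(f) from
    the group to coordinates. *)
Lemma cintegral_transfer (f : T1 -> R[i]) : cmeasurable f ->
  cintegral mu f = cintegral nu (fun y => (w y)%:C * f (S y)).
Proof.
move=> [fR fI]; rewrite /cintegral; congr (_ +i* _).
- rewrite Rintegral_transfer//; apply: eq_Rintegral => y _.
  by rewrite cReM/= mul0r subr0.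
- rewrite Rintegral_transfer//; apply: eq_Rintegral => y _.
  by rewrite cImM/= mul0r addr0.
Qed.

End cintegral_transfer.

(** * Square-integrable complex functions *)

Section L2.
Context d (T : measurableType d) (R : realType) (mu : {measure set T -> \bar R}).
Implicit Types (f g : T -> R[i]) (a b : T -> R).
Local Notation normc := (@Normc.normc R).

Lemma poweR2 (x : \bar R) : (0 <= x -> x `^ 2 = x * x)%E.
Proof.
case: x => [r| |]// r0.
  by rewrite poweR_EFin powR_mulrn ?expr2 ?EFinM// -lee_fin.
by rewrite mulyy poweRyr.
Qed.

(** Hoelder with exponents 2 and 2, squared and written with products so that no roots of extended
    reals remain. *)
Lemma cauchy_schwarz a b : mfunT a -> mfunT b ->
  ((\int[mu]_x `|a x * b x|%:E) * (\int[mu]_x `|a x * b x|%:E) <=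
    (\int[mu]_x (a x ^+ 2)%:E) * (\int[mu]_x (b x ^+ 2)%:E))%E.
Proof.
move=> ma mb.
have h := @hoelder _ _ _ mu a b 2 2 ma mb (ltr0n _ 2) (ltr0n _ 2).
have {}h : ('N[mu]_1[EFin \o (a \* b)%R] <= 'N[mu]_2%:E[EFin \o a] * 'N[mu]_2%:E[EFin \o b])%E.
  by apply: h; rewrite -div1r -splitr.
have N2 c : ('N[mu]_2%:E[EFin \o c] * 'N[mu]_2%:E[EFin \o c] = \int[mu]_x (c x ^+ 2)%:E)%E.
  rewrite -poweR2 ?Lnorm_ge0// poweR_Lnorm//.
  by apply: eq_integral => x _ /=; rewrite powR_mulrn// real_normK ?num_real.
rewrite -(N2 a) -(N2 b) muleACA.
have -> : (\int[mu]_x `|a x * b x|%:E = 'N[mu]_1[EFin \o (a \* b)%R])%E.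
  by rewrite Lnorm1.
by apply: lee_pmul => //; exact: Lnorm_ge0.
Qed.

Definition cL2 f : Prop := cmeasurable f /\ (\int[mu]_x (nsq (f x))%:E < +oo)%E.

Lemma measurable_EFin_nsq f : cmeasurable f -> mfunT (fun x => (nsq (f x))%:E).
Proof. by move=> mf; apply/measurable_EFinP; exact: measurable_nsq. Qed.

Lemma cL2D f g : cL2 f -> cL2 g -> cL2 (fun x => f x + g x).
Proof.
move=> [mf foo] [mg goo]; split; first exact: cmeasurableD.
apply: (@le_lt_trans _ _ (\int[mu]_x (2%:E * (nsq (f x))%:E + 2%:E * (nsq (g x))%:E))%E).
  apply: ge0_le_integral => //.
  - by move=> x _; rewrite lee_fin nsq_ge0.
  - by measurability.
  - by measurability.
  - by move=> x _; rewrite -!EFinM -EFinD lee_fin nsqD_le.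
have nz (h : T -> R[i]) x : (0 <= (nsq (h x))%:E)%E by rewrite lee_fin nsq_ge0.
rewrite ge0_integralD//; last 4 first.
- by move=> x _; rewrite mule_ge0.
- by measurability.
- by move=> x _; rewrite mule_ge0.
- by measurability.
rewrite !ge0_integralZl//; try exact: measurable_EFin_nsq.
by apply: lte_add_pinfty; apply: lte_mul_pinfty.
Qed.

Lemma cL2Z (c : R[i]) f : cL2 f -> cL2 (fun x => c * f x).
Proof.
move=> [mf foo]; split; first by apply: cmeasurableM => //; exact: cmeasurable_cst.
under eq_integral do rewrite nsqM EFinM.
rewrite ge0_integralZl//; last 3 first.
- by measurability.
- by move=> x _; rewrite lee_fin nsq_ge0.
- by rewrite lee_fin nsq_ge0.
by apply: lte_mul_pinfty => //; rewrite lee_fin nsq_ge0.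
Qed.

Lemma cL2J f : cL2 f -> cL2 (fun x => (f x)^*).
Proof.
move=> [mf foo]; split; first exact: cmeasurableJ.
by under eq_integral do rewrite nsqJ.
Qed.

Lemma cL2B f g : cL2 f -> cL2 g -> cL2 (fun x => f x - g x).
Proof.
move=> cf cg; under eq_fun do rewrite -mulN1r.
by apply: cL2D => //; exact: cL2Z.
Qed.

Lemma cL2_0 : cL2 (fun _ => 0).
Proof.
split; first exact: cmeasurable_cst.
by under eq_integral do rewrite nsq0; rewrite integral0.
Qed.

Lemma cL2_sum n (F : 'I_n -> T -> R[i]) : (forall i, cL2 (F i)) ->
  cL2 (fun x => \sum_(i < n) F i x).
Proof.
elim: n F => [|n ih] F mF.
  by under eq_fun do rewrite big_ord0; exact: cL2_0.
under eq_fun do rewrite big_ord_recr/=.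
by apply: cL2D => //; exact: ih.
Qed.

Lemma cL2_normcM f g : cmeasurable f -> cmeasurable g ->
  ((\int[mu]_x (normc (f x * g x))%:E) * (\int[mu]_x (normc (f x * g x))%:E)
    <= (\int[mu]_x (nsq (f x))%:E) * (\int[mu]_x (nsq (g x))%:E))%E.
Proof.
move=> mf mg; have := cauchy_schwarz (measurable_normc mf) (measurable_normc mg).
have -> : (\int[mu]_x `|normc (f x) * normc (g x)|%:E = \int[mu]_x (normc (f x * g x))%:E)%E.
  by apply: eq_integral => x _; rewrite -Normc.normcM ger0_norm ?normc_ge0.
have E h : (\int[mu]_x (normc (h x) ^+ 2)%:E = \int[mu]_x (nsq (h x))%:E)%E.
  by apply: eq_integral => x _; rewrite sqr_normc.
by rewrite !E.
Qed.

Lemma cintegrableM f g : cL2 f -> cL2 g -> cintegrable mu (fun x => f x * g x).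
Proof.
move=> [mf foo] [mg goo]; split; first exact: cmeasurableM.
have h := cL2_normcM mf mg; rewrite ltey; apply/eqP => hoo.
have : ((\int[mu]_x (nsq (f x))%:E) * (\int[mu]_x (nsq (g x))%:E) < +oo)%E.
  apply: lte_mul_pinfty => //; first by apply: integral_ge0 => x _; rewrite lee_fin nsq_ge0.
  by rewrite ge0_fin_numE//; apply: integral_ge0 => x _; rewrite lee_fin nsq_ge0.
by rewrite ltNge; move: h; rewrite hoo mulyy => ->.
Qed.

Lemma nsq_cintegralM_le f g : cL2 f -> cL2 g ->
  ((nsq (cintegral mu (fun x => f x * g x)))%:E <=
   (\int[mu]_x (nsq (f x))%:E) * (\int[mu]_x (nsq (g x))%:E))%E.
Proof.
move=> cf cg; apply: le_trans (cL2_normcM cf.1 cg.1).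
rewrite -sqr_normc expr2 EFinM.
have := normc_cintegral_le (cintegrableM cf cg) => h.
by apply: lee_pmul => //; rewrite lee_fin normc_ge0.
Qed.

End L2.

(** * Affine changes of variables *)

Section lebesgue_affine.
Context (R : realType).
Local Notation leb := (@lebesgue_measure R).
Local Notation RL := (measurableTypeR R).

Lemma measurable_affine (a b : R) :
  mfunT ((fun x => a * x + b) : RL -> RL).
Proof. by apply: measurable_funD => //; exact: measurable_funM. Qed.

(** By uniqueness of Lebesgue measure it suffices to compare both sides on half-open intervals. A
    negative [a] swaps the open and the closed end, which leaves the length unchanged. *)
Lemma lebesgue_measure_affine (a b : R) (A : set RL) : a != 0 -> measurable A ->
  leb A = (`|a|%:E * leb ((fun x => (a * x + b)%R) @^-1` A))%E.
Proof.
move=> a0 mA; pose f : RL -> RL := fun x => a * x + b.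
have mf : mfunT f := measurable_affine a b.
pose c : {nonneg R} := NngNum (normr_ge0 a).
have := @lebesgue_measure_unique R (mscale c (pushforward leb f)).
move=> /(_ mf _ A mA) ->// _ [[x y]] _ <-/=.
rewrite /mscale/= /pushforward/=.
have [ap|an|/eqP] := ltrgt0P a; last by rewrite (negbTE a0).
- have -> : f @^-1` `]x, y] = `](x - b) / a, (y - b) / a]%classic.
    apply/seteqP; split=> z /=; rewrite !in_itv/= /f => /andP[h1 h2]; apply/andP; split.
    + by rewrite ltr_pdivrMr// ltrBlDr mulrC.
    + by rewrite ler_pdivlMr// lerBrDr mulrC.
    + by move: h1; rewrite ltr_pdivrMr// ltrBlDr mulrC.
    + by move: h2; rewrite ler_pdivlMr// lerBrDr mulrC.
  rewrite !lebesgue_measure_itv/= !lte_fin ltr_pM2r ?invr_gt0// ltrD2r.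
  case: ifPn => _; last by rewrite mule0.
  by rewrite -!EFinB -EFinM; congr EFin; field.
- have -> : f @^-1` `]x, y] = `[(y - b) / a, (x - b) / a[%classic.
    apply/seteqP; split=> z /=; rewrite !in_itv/= /f => /andP[h1 h2]; apply/andP; split.
    + by rewrite ler_ndivrMr// lerBrDr mulrC.
    + by rewrite ltr_ndivlMr// ltrBlDr mulrC.
    + by move: h2; rewrite ltr_ndivlMr// ltrBlDr mulrC.
    + by move: h1; rewrite ler_ndivrMr// lerBrDr mulrC.
  rewrite !lebesgue_measure_itv/= !lte_fin ltr_nM2r ?invr_lt0// ltrD2r.
  case: ifPn => _; last by rewrite mule0.
  by rewrite -!EFinB -EFinM; congr EFin; field.
Qed.

Lemma ge0_integral_affine (a b : R) (phi : RL -> \bar R) : a != 0 ->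
  mfunT phi -> (forall x, 0 <= phi x)%E ->
  (\int[leb]_x phi x = `|a|%:E * \int[leb]_x phi (a * x + b)%R)%E.
Proof.
move=> a0 mphi phi0; pose f : RL -> RL := fun x => a * x + b.
have mf : mfunT f := measurable_affine a b.
pose c : {nonneg R} := NngNum (normr_ge0 a).
pose nu := measure_function_pushforward__canonical__measure_function_Measure leb mf.
have -> : (\int[leb]_x phi x = \int[mscale c nu]_x phi x)%E.
  apply: eq_measure_integral => A mA _.
  exact: (lebesgue_measure_affine b a0 mA).
by rewrite ge0_integral_mscale// ge0_integral_pushforward.
Qed.

Lemma ge0_integral_scale (a : R) (phi : RL -> \bar R) : a != 0 ->
  mfunT phi -> (forall x, 0 <= phi x)%E ->
  (\int[leb]_x phi x = `|a|%:E * \int[leb]_x phi (a * x)%R)%E.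
Proof.
move=> a0 mphi phi0; rewrite (ge0_integral_affine 0 a0)//; congr (_ * _)%E.
by apply: eq_integral => x _; rewrite addr0.
Qed.

Let affine2 (a b c e g h : R) (p : RL * RL) : RL * RL :=
  (a * p.1 + b * p.2 + g, c * p.1 + e * p.2 + h).

Lemma measurable_affine2 (a b c e g h : R) : mfunT (affine2 a b c e g h).
Proof.
by apply: measurable_fun_pair => /=; apply: measurable_funD => //; apply: measurable_funD;
 apply: measurable_funM => //.
Qed.

(** Gaussian elimination with pivot [a]: substitute in [x] for fixed [y], then in [y] for fixed [x].
    The second slope is the Schur complement [e - b * c / a], and the product of the slopes is the
    determinant. [psi] is the integrand between the two substitutions. *)
Let ge0_integral_affine2_neq0 (a b c e g h : R) (phi : RL * RL -> \bar R) :
  a != 0 -> a * e - b * c != 0 ->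
  mfunT phi -> (forall p, 0 <= phi p)%E ->
  (\int[leb]_x \int[leb]_y phi (x, y) =
  `|a * e - b * c|%:E *
    \int[leb]_x \int[leb]_y phi (a * x + b * y + g, c * x + e * y + h)%R)%E.
Proof.
move=> a0 D0 mphi phi0.
have mcomp : mfunT (phi \o affine2 a b c e g h).
  by apply: measurableT_comp => //; exact: measurable_affine2.
rewrite (fubini_tonelli (phi \o affine2 a b c e g h))//=.
pose psi p := phi (p.1, (c / a) * p.1 + ((e - b * c / a) * p.2 + (h - c / a * g)))%R.
have mpsi : mfunT psi.
  apply: measurableT_comp => //; apply: measurable_fun_pair => //.
  apply: measurable_funD; first exact: measurable_funM.
  by apply: measurable_funD => //; exact: measurable_funM.
have psi0 p : (0 <= psi p)%E by exact: phi0.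
have i1 y : (\int[leb]_x phi (affine2 a b c e g h (x, y)) =
    `|a|^-1%:E * \int[leb]_x psi (x, y))%E.
  rewrite (@ge0_integral_affine a (b * y + g) (fun x => psi (x, y)))//; last first.
    exact: (measurable_fun_pair1 y mpsi).
  rewrite muleA -EFinM mulVf ?normr_eq0// mul1e.
  by apply: eq_integral => x _; rewrite /psi /affine2/=; congr (phi (_, _)); field.
under [in RHS]eq_integral do rewrite i1.
rewrite ge0_integralZl//; last 2 first.
- exact: (measurable_integral2 leb mpsi psi0).
- by move=> y _; exact: integral_ge0.
rewrite -(@fubini_tonelli _ _ _ _ R leb leb psi)//.
rewrite muleA -EFinM.
have k0 : e - b * c / a != 0.
  apply: contra_neq D0 => k0; rewrite -[RHS](mulr0 a) -k0; by field.
have i2 x : (\int[leb]_y psi (x, y) = `|e - b * c / a|^-1%:E * \int[leb]_y phi (x, y))%E.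
  rewrite (@ge0_integral_affine (e - b * c / a) (c / a * x + (h - c / a * g)) (fun y => phi (x, y)))//; last first.
    exact: (measurable_fun_pair2 x mphi).
  rewrite muleA -EFinM mulVf ?normr_eq0// mul1e.
  by apply: eq_integral => y _; rewrite /psi/=; congr (phi (_, _)); ring.
under [in RHS]eq_integral do rewrite i2.
rewrite ge0_integralZl//; last 2 first.
- exact: (measurable_integral1 leb mphi phi0).
- by move=> y _; exact: integral_ge0.
rewrite muleA -EFinM -!normfV -!normrM.
rewrite (_ : _ * _ * _ = 1) ?normr1 ?mul1e//.
by field; rewrite a0/= mulrC.
Qed.

Lemma ge0_integral_affine2 (a b c e g h : R) (phi : RL * RL -> \bar R) :
  a * e - b * c != 0 ->
  mfunT phi -> (forall p, 0 <= phi p)%E ->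
  (\int[leb]_x \int[leb]_y phi (x, y) =
  `|a * e - b * c|%:E *
    \int[leb]_x \int[leb]_y phi (a * x + b * y + g, c * x + e * y + h)%R)%E.
Proof.
(* If [a] vanishes then [b] does not; exchanging the two variables of integration makes [b] the
   pivot. *)
move=> D0 mphi phi0; have [a0|a0] := eqVneq a 0; last exact: ge0_integral_affine2_neq0.
have b0 : b != 0 by apply: contra_neq D0 => ->; rewrite a0 !mul0r subr0.
have D0' : b * c - a * e != 0 by rewrite -oppr_eq0 opprB.
rewrite (ge0_integral_affine2_neq0 g h b0 D0' mphi phi0) distrC; congr (_ * _)%E.
have mcomp : mfunT (phi \o affine2 a b c e g h).
  by apply: measurableT_comp => //; exact: measurable_affine2.
apply: eq_trans _ (esym (@fubini_tonelli _ _ _ _ R leb leb _ mcomp (fun p => phi0 _))).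
apply: eq_integral => x _; apply: eq_integral => y _; congr (phi (_ + _, _ + _)); exact: addrC.
Qed.

End lebesgue_affine.

(** * Cauchy kernels *)

Section poisson_kernel.
Context (R : realType).
Local Notation leb := (@lebesgue_measure R).

(** The summand 1 keeps the integrand nonnegative, as the fundamental theorem on a half-line and
    Tonelli in [J] require; it accounts for the term [- e^-1] of the antiderivative. *)
Lemma is_derive_expR_cos (e z x : R) : e ^+ 2 + z ^+ 2 != 0 -> e != 0 ->
  is_derive x 1 (fun t : R => expR (- (e * t)) *
    ((z * sin (z * t) - e * cos (z * t)) / (e ^+ 2 + z ^+ 2) - e^-1))
    (expR (- (e * x)) * (1 + cos (z * x))).
Proof.
move=> D0 e0.
have h1 : is_derive x 1 (fun t : R => - (e * t)) (- e).
  have -> : (fun t : R => - (e * t)) = (fun t : R => (- e) *: t) by apply/funext => t; rewrite scaleNr.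
  by apply: is_derive_eq; rewrite scaler1.
have h2 : is_derive x 1 (fun t : R => z * t) z.
  have -> : (fun t : R => z * t) = (fun t : R => z *: t) by [].
  by apply: is_derive_eq; rewrite scaler1.
have h3 := is_derive1_comp (is_derive_expR _) h1.
have h4 := is_derive1_comp (is_derive_sin _) h2.
have h5 := is_derive1_comp (is_derive_cos _) h2.
apply: is_derive_eq.
rewrite /GRing.scale/=; by field; rewrite e0 D0.
Qed.

Lemma integral0y_expR_cos (e z : R) : 0 < e ->
  (\int[leb]_(x in `[0%R, +oo[) (expR (- (e * x)) * (1 + cos (z * x)))%:E =
   (e^-1 + e / (e ^+ 2 + z ^+ 2))%:E)%E.
Proof.
move=> e0; have D0 : e ^+ 2 + z ^+ 2 != 0.
  by rewrite gt_eqF// ltr_wpDr ?sqr_ge0// exprn_gt0.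
have en0 : e != 0 by rewrite gt_eqF.
pose F t : R := expR (- (e * t)) *
    ((z * sin (z * t) - e * cos (z * t)) / (e ^+ 2 + z ^+ 2) - e^-1).
have dF (x : R) : is_derive x 1 F (expR (- (e * x)) * (1 + cos (z * x))).
  exact: is_derive_expR_cos.
have cF : continuous F.
  by move=> x; apply: differentiable_continuous; apply/derivable1_diffP; case: (dF x).
have cont_mul c : continuous (fun x : R => c * x) by move=> x; exact: mulrl_continuous.
rewrite (@ge0_continuous_FTC2y R _ F 0 0).
- rewrite -EFinB; congr EFin; rewrite /F !mulr0 oppr0 expR0 sin0 cos0; by field; rewrite en0 D0.
- by move=> x _; rewrite mulr_ge0 ?expR_ge0// -lerBlDl sub0r ?cos_geN1.
- apply: continuous_subspaceT => x; apply: cvgM.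
    apply: continuous_comp; last exact: continuous_expR.
    by apply: cvgN; exact: cont_mul.
  apply: cvgD; first exact: cvg_cst.
  by apply: continuous_comp; [exact: cont_mul|exact: continuous_cos].
- pose B := (`|z| + `|e|) / (e ^+ 2 + z ^+ 2) + e^-1.
  have FB x : `|F x| <= expR (- (e * x)) * B.
    rewrite /F normrM (ger0_norm (expR_ge0 _)) ler_wpM2l ?expR_ge0//.
    apply: le_trans (ler_normB _ _) _.
    rewrite [X in _ + X <= _]ger0_norm ?invr_ge0 ?(ltW e0)// /B lerD2r.
    rewrite normrM [X in _ * X <= _]ger0_norm; last by rewrite invr_ge0 addr_ge0 ?sqr_ge0.
    rewrite ler_wpM2r ?invr_ge0 ?addr_ge0 ?sqr_ge0//.
    apply: le_trans (ler_normB _ _) _; apply: lerD; rewrite normrM ler_piMr//.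
      by rewrite ler_norml sin_geN1 sin_le1.
    by rewrite ler_norml cos_geN1 cos_le1.
  apply/norm_cvg0P.
  apply: (@squeeze_cvgr _ _ _ _ (fun=> 0) (fun x => expR (- (e * x)) * B)); last 2 first.
  + exact: cvg_cst.
  + rewrite -[X in _ --> X](mul0r B); apply: cvgM; last exact: cvg_cst.
    apply: (@cvg_comp _ _ _ (fun x => e * x) (fun y : R => expR (- y)) _ (pinfty_nbhs R)); last exact: cvgr_expR.
    exact: gt0_cvgMry.
  by near=> x; rewrite normr_ge0 FB.
- by move=> x _; case: (dF x).
- by apply: cvg_at_right_filter; exact: cF.
- by move=> x _; rewrite derive1E; case: (dF x).
Unshelve. all: by end_near.
Qed.

Lemma integral_expR_cos (e z : R) : 0 < e ->
  (\int[leb]_x (expR (- (e * `|x|)) * (1 + cos (z * x)))%:E =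
   (2 / e + 2 * e / (e ^+ 2 + z ^+ 2))%:E)%E.
Proof.
move=> e0; rewrite ge0_symfun_integralT.
- rewrite -set_itvcy -[in RHS]mulrA -mulrDr EFinM -(integral0y_expR_cos z e0).
  congr (_ * _)%E; apply: eq_integral => x; rewrite inE/= in_itv/= andbT => x0.
  by rewrite ger0_norm.
- by move=> x; rewrite mulr_ge0 ?expR_ge0// -lerBlDl sub0r ?cos_geN1.
- move=> x; apply: cvgM.
    apply: continuous_comp; last exact: continuous_expR.
    by apply: cvgN; apply: cvgM; [exact: cvg_cst|exact: norm_continuous].
  apply: cvgD; first exact: cvg_cst.
  by apply: continuous_comp; [exact: mulrl_continuous|exact: continuous_cos].
- by move=> x /=; rewrite normrN mulrN cosN.
Qed.

Lemma integral_expR_norm (e : R) : 0 < e ->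
  (\int[leb]_x (expR (- (e * `|x|)))%:E = (2 / e)%:E)%E.
Proof.
move=> e0; have := integral_expR_cos 0 e0.
under eq_integral do rewrite mul0r cos0 mulrDr mulr1 -mulr2n -[_ *+ 2]mulr_natl EFinM.
rewrite ge0_integralZl//; last first.
  apply/measurable_EFinP; apply: measurableT_comp => //; apply: measurableT_comp => //.
  by apply: measurable_funM => //; exact: normr_measurable.
rewrite (_ : 2 / e + _ = 2 * (2 / e)); last by field; rewrite gt_eqF.
rewrite EFinM => h; have := congr1 (fun x => (2^-1)%:E * x)%E h.
by rewrite !muleA -!EFinM !mulVf// !mul1e mul1r.
Qed.

(** The Fourier transform of exp(-|t|) at frequency [c * x]. Its mass is 1 when [c = 2 * pi], the
    normalization for which the Fourier transform is isometric. *)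
Definition cauchy_kernel (c x : R) : R := 2 / (1 + (c * x) ^+ 2).

Lemma cauchy_kernel_ge0 c x : 0 <= cauchy_kernel c x.
Proof. by rewrite divr_ge0// addr_ge0// sqr_ge0. Qed.

Lemma cauchy_kernel_le2 c x : cauchy_kernel c x <= 2.
Proof.
rewrite ler_pdivrMr; last by rewrite ltr_wpDr ?sqr_ge0.
by rewrite ler_peMr// lerDl sqr_ge0.
Qed.

Lemma measurable_cauchy_kernel c : mfunT (cauchy_kernel c).
Proof.
apply: measurable_funM => //; apply: measurable_inv_ge0 => [x|].
  by rewrite addr_ge0// sqr_ge0.
by apply: measurable_funD => //; apply: measurable_funX; exact: measurable_funM.
Qed.

Lemma integral_derive_atan : (\int[leb]_x ((1 + x ^+ 2)^-1)%:E = (pi : R)%:E)%E.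
Proof.
have p0 (x : R) : 0 < 1 + x ^+ 2 by rewrite ltr_wpDr ?sqr_ge0.
have cf : continuous (fun x : R => (1 + x ^+ 2)^-1).
  move=> x; apply: cvgV; first by rewrite gt_eqF.
  by apply: cvgD; [exact: cvg_cst|exact: exprn_continuous].
rewrite ge0_symfun_integralT//.
- rewrite -set_itvcy (@ge0_continuous_FTC2y R _ (@atan R) 0 (pi / 2)).
  + by rewrite atan0 sube0 -EFinM; congr EFin; field.
  + by move=> x _; rewrite invr_ge0 ltW.
  + exact: continuous_subspaceT.
  + exact: cvgy_atan.
  + by move=> x _; exact: derivable_atan.
  + by apply: cvg_at_right_filter; exact: continuous_atan.
  + by move=> x _; exact: derive1_atan.
- by move=> x; rewrite invr_ge0 ltW.
- by move=> x /=; rewrite sqrrN.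
Qed.

Lemma integral_cauchy_kernel : (\int[leb]_x (cauchy_kernel (2 * pi) x)%:E = 1)%E.
Proof.
have m1 : mfunT (fun x : R => ((1 + x ^+ 2)^-1)%:E).
  apply/measurable_EFinP; apply: measurable_inv_ge0 => [x|].
    by rewrite addr_ge0// sqr_ge0.
  by apply: measurable_funD => //; exact: measurable_funX.
have p0 (x : R) : (0 <= ((1 + x ^+ 2)^-1)%:E)%E.
  by rewrite lee_fin invr_ge0 addr_ge0// sqr_ge0.
have tp0 : 0 < 2 * pi :> R by rewrite mulr_gt0// pi_gt0.
have tpn : 2 * pi != 0 :> R by rewrite gt_eqF.
have := @ge0_integral_scale R (2 * pi) _ tpn m1 p0.
rewrite integral_derive_atan gtr0_norm// => /(congr1 (fun x => (pi^-1)%:E * x)%E).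
rewrite muleA -!EFinM mulVf ?gt_eqF ?pi_gt0// (_ : pi^-1 * (2 * pi) = 2); last first.
  by rewrite mulrCA mulVf ?mulr1// gt_eqF ?pi_gt0.
move=> ->; rewrite -ge0_integralZl//.
by apply: (measurableT_comp m1); exact: measurable_funM.
Qed.

End poisson_kernel.

Ltac measurable_hook ::= match goal with
  | |- measurable_fun _ (fun _ => cauchy_kernel _ _) =>
      apply: (measurableT_comp (@measurable_cauchy_kernel _ _))
  end.

(** * Plancherel on the line *)

Section limn_einf_bounds.
Context (R : realType).
Local Open Scope ereal_scope.
Implicit Types u v : (\bar R)^nat.

Lemma limn_einf_ge_cvg u v c : (forall n, v n <= u n) -> v n @[n --> \oo] --> c ->
  c <= limn_einf u.
Proof.
move=> vu /cvg_limn_einf_sup[<- _]; rewrite !limn_einf_lim.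
apply: lee_lim; [exact: is_cvg_einfs|exact: is_cvg_einfs|].
apply: nearW => n; apply: le_ereal_inf_tmp => _ [m nm <-].
by apply: le_trans (vu m); apply: ereal_inf_lbound; exists m.
Qed.

Lemma limn_einf_ge_mul (c : R) (l : \bar R) u : (0 <= c)%R -> l <= limn_einf u ->
  c%:E * l <= limn_einf (fun n => c%:E * u n).
Proof.
move=> c0 lu; apply: (@le_trans _ _ (c%:E * limn_einf u)).
  by apply: lee_wpmul2l; rewrite ?lee_fin.
rewrite !limn_einf_lim.
have -> : c%:E * limn (einfs u) = limn (fun n => c%:E * einfs u n).
  by apply/esym/cvg_lim => //; apply: cvgeZl => //; exact: is_cvg_einfs.
apply: lee_lim; [by apply: is_cvgeZl => //; exact: is_cvg_einfs|exact: is_cvg_einfs|].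
apply: nearW => n; apply: le_ereal_inf_tmp => _ [m nm <-].
by apply: lee_wpmul2l; rewrite ?lee_fin//; apply: ereal_inf_lbound; exists m.
Qed.

Lemma limn_einf_le u c : (forall n, u n <= c) -> limn_einf u <= c.
Proof.
move=> uc; rewrite limn_einf_lim; apply: lime_le; first exact: is_cvg_einfs.
apply: nearW => n; apply: le_trans (uc n); apply: ereal_inf_lbound.
by exists n => /=.
Qed.

Lemma measurable_fun_limn_einf d (T : measurableType d) (f : (T -> \bar R)^nat) :
  (forall n, mfunT (f n)) ->
  mfunT (fun x => limn_einf (f ^~ x)).
Proof.
move=> mf; rewrite /limn_einf.
have mNf n : mfunT (fun x => - f n x) by exact: measurableT_comp.
have := measurable_fun_limn_esup mNf.
exact: measurableT_comp.
Qed.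

End limn_einf_bounds.

Section fourier.
Context (R : realType).
Local Notation leb := (@lebesgue_measure R).
Local Notation RL := (measurableTypeR R).

(** The sign of the exponent is that of [sigma]. The constant stays abstract: Plancherel uses it
    only through the mass of the Cauchy kernel of parameter [c]. *)
Definition fourier (c : R) (f : RL -> R[i]) (tau : R) : R[i] :=
  cintegral leb (fun u => f u * expi (c * (u * tau))).

Lemma cmeasurable_character d (T : measurableType d) (c : R) (g : T -> R) : mfunT g ->
  cmeasurable (fun u => expi (c * g u)).
Proof. by measurability. Qed.

Section nonnegative.
Variable c : R.
Hypothesis integral_ck : (\int[leb]_x (cauchy_kernel c x)%:E = 1)%E.
Variable f : RL -> R.
Hypothesis mf : mfunT f.
Hypothesis f0 : forall x, 0 <= f x.
Hypothesis foo : (\int[leb]_x (f x)%:E < +oo)%E.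

Let M := \int[leb]_x f x.
Let C tau := \int[leb]_x (f x * cos (c * (x * tau))).
Let S tau := \int[leb]_x (f x * sin (c * (x * tau))).

Let ME : (\int[leb]_x (f x)%:E)%E = M%:E.
Proof.
rewrite fineK// ge0_fin_numE//; by apply: integral_ge0 => x _; rewrite lee_fin.
Qed.

Let mfE : mfunT (EFin \o f). Proof. exact/measurable_EFinP. Qed.

Let iff : leb.-integrable setT (EFin \o f).
Proof.
apply/integrableP; split => //.
by under eq_integral do rewrite /= ger0_norm//.
Qed.

Let ifb (k : RL -> R) : mfunT k -> (forall x, `|k x| <= 1) ->
  leb.-integrable setT (EFin \o (fun x => f x * k x)).
Proof.
move=> mk k1; apply: (@le_integrable _ _ _ leb _ measurableT _ (EFin \o f)) => //.
  by apply/measurable_EFinP; exact: measurable_funM.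
by move=> x _ /=; rewrite lee_fin normrM ler_piMr.
Qed.

Let mcos d (T : measurableType d) (g : T -> R) : mfunT g -> mfunT (fun x => cos (g x)).
Proof. by measurability. Qed.
Let msin d (T : measurableType d) (g : T -> R) : mfunT g -> mfunT (fun x => sin (g x)).
Proof. by measurability. Qed.
Let marg tau : mfunT (fun x : RL => c * (x * tau)).
Proof. by measurability. Qed.

Let icos tau : leb.-integrable setT (EFin \o (fun x => f x * cos (c * (x * tau)))).
Proof.
apply: ifb; first by apply: mcos; exact: marg.
by move=> x; rewrite ler_norml cos_geN1 cos_le1.
Qed.
Let isin tau : leb.-integrable setT (EFin \o (fun x => f x * sin (c * (x * tau)))).
Proof.
apply: ifb; first by apply: msin; exact: marg.
by move=> x; rewrite ler_norml sin_geN1 sin_le1.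
Qed.

Let fourierE tau : fourier c (fun x => (f x)%:C) tau = C tau +i* S tau.
Proof.
rewrite /fourier /cintegral; congr (_ +i* _); apply: eq_Rintegral => x _.
- by rewrite cReM/= mul0r subr0.
- by rewrite cImM/= mul0r addr0.
Qed.

Let h tau := nsq (fourier c (fun x => (f x)%:C) tau).

Let hE tau : h tau = C tau ^+ 2 + S tau ^+ 2.
Proof. by rewrite /h fourierE. Qed.

Let Rcomb (a b b' : R) tau :
  (\int[leb]_x (f x * (a + b * cos (c * (x * tau)) + b' * sin (c * (x * tau))))%:E =
  (a * M + b * C tau + b' * S tau)%:E)%E.
Proof.
have i1 := integrableZl measurableT a iff.
have i2 := integrableZl measurableT b (icos tau).
have i3 := integrableZl measurableT b' (isin tau).
have i12 := integrableD measurableT i1 i2.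
have E x : f x * (a + b * cos (c * (x * tau)) + b' * sin (c * (x * tau))) =
  a * f x + b * (f x * cos (c * (x * tau))) + b' * (f x * sin (c * (x * tau))).
  by ring.
under eq_integral do rewrite E.
have -> : a * M + b * C tau + b' * S tau =
   \int[leb]_x (a * f x + b * (f x * cos (c * (x * tau))) +
     b' * (f x * sin (c * (x * tau)))).
  by rewrite RintegralD// RintegralD// !RintegralZl.
rewrite fineK//; apply: integrable_fin_num => //.
exact: (integrableD measurableT i12 i3).
Qed.

(** The squared modulus is a double integral of [f x * f y] against a cosine, by the addition
    formula. Adding 1 to the cosine makes the integrand nonnegative at the price of the finite term
    [M ^+ 2]. *)
Let sqr_fourier tau : (\int[leb]_x \int[leb]_y
   (f x * f y * (1 + cos (c * (x - y) * tau)))%:E = (M ^+ 2 + h tau)%:E)%E.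
Proof.
have e x y : f x * f y * (1 + cos (c * (x - y) * tau)) =
  f x * (f y * (1 + cos (c * (x * tau)) * cos (c * (y * tau)) +
    sin (c * (x * tau)) * sin (c * (y * tau)))).
  rewrite -mulrA -addrA -cosB; congr (_ * (_ * (1 + cos _))); ring.
have inner x : (\int[leb]_y (f x * f y * (1 + cos (c * (x - y) * tau)))%:E =
  (f x * (1 * M + cos (c * (x * tau)) * C tau + sin (c * (x * tau)) * S tau))%:E)%E.
  under eq_integral do rewrite e EFinM.
  rewrite integralZl//; first by rewrite Rcomb -EFinM.
  have i1 := integrableD measurableT iff (integrableZl measurableT (cos (c * (x * tau))) (icos tau)).
  have i2 := integrableD measurableT i1 (integrableZl measurableT (sin (c * (x * tau))) (isin tau)).
  apply: eq_integrable i2 => // y _ /=; rewrite -!EFinM -!EFinD; congr EFin; ring.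
under eq_integral do rewrite inner.
transitivity (\int[leb]_x (f x * (M + C tau * cos (c * (x * tau)) +
    S tau * sin (c * (x * tau))))%:E)%E.
  by apply: eq_integral => x _; congr EFin; ring.
by rewrite Rcomb hE; congr EFin; ring.
Qed.

(** The average of [f] around [x] at scale [e]. The kernel is rescaled to be independent of [e], so
    that only the argument of [f] moves in the limit. *)
Let g e x : \bar R := (\int[leb]_s (f (x + e * s) * cauchy_kernel c s)%:E)%E.

Let mcomb e : mfunT (fun z : RL * RL => (f (z.1 + e * z.2) * cauchy_kernel c z.2)%:E).
Proof. by measurability. Qed.

Let comb_ge0 e (z : RL * RL) : (0 <= (f (z.1 + e * z.2)%R * cauchy_kernel c z.2)%:E)%E.
Proof. by rewrite lee_fin mulr_ge0// cauchy_kernel_ge0. Qed.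

Let mg e : mfunT (g e).
Proof. exact: (measurable_integral1 leb (mcomb e) (comb_ge0 e)). Qed.

Let g_ge0 e x : (0 <= g e x)%E.
Proof. by apply: integral_ge0 => s _; exact: (comb_ge0 e (x, s)). Qed.

Let mh : mfunT h.
Proof.
apply: measurable_nsq.
apply: (@cmeasurable_cintegral _ _ _ _ _ leb (fun z : RL * RL => (f z.2)%:C * expi (c * (z.2 * z.1)))).
apply: cmeasurableM.
  by apply: cmeasurable_real; apply: measurableT_comp.
by apply: cmeasurable_character; apply: measurable_funM.
Qed.

Let mq0 e x : mfunT (fun y : RL => (f y * (2 * e / (e ^+ 2 + (c * (x - y)) ^+ 2)))%:E).
Proof. by measurability. Qed.

Let q e x y := f y * (2 * e / (e ^+ 2 + (c * (x - y)) ^+ 2)).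

Let q_ge0 e x y : 0 < e -> (0 <= (q e x y)%:E)%E.
Proof.
move=> e0; rewrite lee_fin /q; apply: mulr_ge0; [exact: f0|apply: divr_ge0].
  by apply: mulr_ge0; [exact: ler0n|exact: ltW].
by apply: addr_ge0; exact: sqr_ge0.
Qed.

(** The substitution [y = e * s + x] turns the kernel of width [e], which comes out of the damped
    cosine integral, into the fixed one of [g]. *)
Let integral_q e x : 0 < e -> (\int[leb]_y (q e x y)%:E = g e x)%E.
Proof.
move=> e0; have en0 : e != 0 by apply: lt0r_neq0.
rewrite (@ge0_integral_affine R e x _ en0 (mq0 e x) (fun y => q_ge0 x y e0)).
rewrite gtr0_norm// /g -ge0_integralZT; first last.
- exact: ltW.
- by move=> y; exact: q_ge0.
- exact: (measurableT_comp (mq0 e x) (measurable_affine e x)).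
apply: eq_integral => s _; rewrite -EFinM; congr EFin; rewrite /q /cauchy_kernel (addrC (e * s)).
have d1 : 1 + (c * s) ^+ 2 != 0.
  by apply: lt0r_neq0; apply: ltr_wpDr; [exact: sqr_ge0|exact: ltr01].
have -> : e ^+ 2 + (c * (x - (x + e * s))) ^+ 2 = e ^+ 2 * (1 + (c * s) ^+ 2) by ring.
by field; rewrite en0 d1.
Qed.

Let L3 e x : 0 < e -> (\int[leb]_y ((f x)%:E * ((2 / e)%:E * (f y)%:E + (q e x y)%:E)) =
  (f x * (2 / e * M))%:E + (f x)%:E * g e x)%E.
Proof.
move=> e0; have e1 : 0 <= 2 / e by apply: divr_ge0; [exact: ler0n|exact: ltW].
have me1 : mfunT (fun y => (2 / e)%:E * (f y)%:E)%E by measurability.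
have f0E y : (0 <= (f y)%:E)%E by rewrite lee_fin.
have e1_ge0 y : (0 <= (2 / e)%:E * (f y)%:E)%E by apply: mule_ge0.
rewrite ge0_integralZT; first last.
- exact: f0.
- by move=> y; apply: adde_ge0; [exact: e1_ge0|exact: q_ge0].
- by apply: emeasurable_funD; [exact: me1|exact: mq0].
rewrite (ge0_integralDT _ me1 e1_ge0 (mq0 e x) (fun y => q_ge0 x y e0)).
rewrite (ge0_integralZT _ mfE f0E e1) ME integral_q//.
have M0 : 0 <= M by apply: Rintegral_ge0 => y _; exact: f0.
have eM : (0 <= (2 / e)%:E * M%:E)%E by rewrite -EFinM lee_fin; exact: mulr_ge0.
by rewrite (ge0_muleDr _ eM (g_ge0 e x)) -!EFinM.
Qed.

Let L4 e : 0 < e -> (\int[leb]_x ((f x * (2 / e * M))%:E + (f x)%:E * g e x) =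
    (2 / e * M ^+ 2)%:E + \int[leb]_x ((f x)%:E * g e x))%E.
Proof.
move=> e0; have e1 : 0 <= 2 / e by apply: divr_ge0; [exact: ler0n|exact: ltW].
have M0 : 0 <= M by apply: Rintegral_ge0 => y _; exact: f0.
have e2 : 0 <= 2 / e * M by exact: mulr_ge0.
have f0E y : (0 <= (f y)%:E)%E by rewrite lee_fin.
rewrite ge0_integralDT.
- congr (_ + _)%E; under eq_integral do rewrite mulrC EFinM.
  by rewrite (ge0_integralZT _ mfE f0E e2) ME -EFinM; congr EFin; ring.
- by measurability.
- by move=> x; rewrite lee_fin; exact: mulr_ge0.
- by apply: emeasurable_funM; [exact: mfE|exact: mg].
- by move=> x; apply: mule_ge0; [exact: f0E|exact: g_ge0].
Qed.

Let mexp e : mfunT (fun t : RL => expR (- (e * `|t|))).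
Proof. by measurability. Qed.

Let h0 t : 0 <= h t. Proof. exact: nsq_ge0. Qed.

Let L5 e : 0 < e -> (\int[leb]_t (expR (- (e * `|t|)) * (M ^+ 2 + h t))%:E =
    (2 / e * M ^+ 2)%:E + \int[leb]_t (expR (- (e * `|t|)) * h t)%:E)%E.
Proof.
move=> e0; under eq_integral do rewrite mulrDr EFinD.
rewrite ge0_integralDT.
- congr (_ + _)%E; under eq_integral do rewrite mulrC EFinM.
  rewrite ge0_integralZT.
  + by rewrite (integral_expR_norm e0) -EFinM mulrC.
  + by measurability.
  + by move=> x; rewrite lee_fin expR_ge0.
  + exact: sqr_ge0.
- by measurability.
- by move=> x; rewrite lee_fin; apply: mulr_ge0; [exact: expR_ge0|exact: sqr_ge0].
- by measurability.
- by move=> x; rewrite lee_fin; apply: mulr_ge0; [exact: expR_ge0|exact: h0].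
Qed.

(** Tonelli moves the integral over [t] innermost, where it is explicit. The constant 1 next to the
    cosine contributes [2 / e * M ^+ 2] to both sides; [L3], [L4] and [L5] isolate this term, which
    is finite and cancels. *)
Let J e : (0 < e) -> (\int[leb]_t (expR (- (e * `|t|)) * h t)%:E =
  \int[leb]_x ((f x)%:E * g e x))%E.
Proof.
move=> e0.
pose k x y t := f x * f y * (expR (- (e * `|t|)) * (1 + cos (c * (x - y) * t))).
have c1 (z : R) : 0 <= 1 + cos z by rewrite -lerBlDl sub0r cos_geN1.
have k0 x y t : (0 <= (k x y t)%:E)%E.
  by rewrite lee_fin !mulr_ge0 ?expR_ge0.
have mkty : mfunT (fun z : RL * RL * RL => (k z.1.2 z.2 z.1.1)%:E) by measurability.
have mkyt x : mfunT (fun z : RL * RL => (k x z.2 z.1)%:E) by measurability.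
have M0 : 0 <= M by apply: Rintegral_ge0 => x _.
have mktx : mfunT (fun z : RL * RL => \int[leb]_y (k z.2 y z.1)%:E)%E.
  exact: (@measurable_integralr _ _ _ _ _ leb (fun (z : RL * RL) y => (k z.2 y z.1)%:E) mkty (fun _ _ => k0 _ _ _)).
have L : (\int[leb]_t (expR (- (e * `|t|)) * (M ^+ 2 + h t))%:E =
  \int[leb]_t \int[leb]_x \int[leb]_y (k x y t)%:E)%E.
  apply: eq_integral => t _; rewrite EFinM -sqr_fourier.
  have mq : mfunT (fun z : RL * RL => (f z.1 * f z.2 * (1 + cos (c * (z.1 - z.2) * t)))%:E) by measurability.
  have q0 x y : (0 <= (f x * f y * (1 + cos (c * (x - y) * t)))%:E)%E.
    by rewrite lee_fin !mulr_ge0.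
  rewrite -ge0_integralZT ?expR_ge0//.
  - apply: eq_integral => x _; rewrite -ge0_integralZT ?expR_ge0//.
    + by apply: eq_integral => y _; rewrite -EFinM; congr EFin; rewrite /k; ring.
    + by measurability.
  - exact: (@measurable_integralr _ _ _ _ _ leb _ mq q0).
  - by move=> x; apply: integral_ge0.
have L2 : (\int[leb]_t \int[leb]_x \int[leb]_y (k x y t)%:E =
   \int[leb]_x \int[leb]_y \int[leb]_t (k x y t)%:E)%E.
  have k0' t x : (0 <= \int[leb]_y (k x y t)%:E)%E by exact: integral_ge0.
  apply: eq_trans (@tonelli _ _ _ _ R leb leb _ mktx k0') _.
  apply: eq_integral => x _.
  exact: (@tonelli _ _ _ _ R leb leb _ (mkyt x) (fun t y => k0 x y t)).
have inner x y : (\int[leb]_t (k x y t)%:E = (f x)%:E * ((2 / e)%:E * (f y)%:E + (q e x y)%:E))%E.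
  under eq_integral do rewrite EFinM.
  have mE : mfunT (fun t : RL => (expR (- (e * `|t|)) * (1 + cos (c * (x - y) * t)))%:E).
    apply/measurable_EFinP; apply: measurable_funM; first exact: mexp.
    by apply: measurable_funD; [exact: measurable_cst|apply: mcos; exact: measurable_funM].
  have E0 (t : RL) : (0 <= (expR (- (e * `|t|)) * (1 + cos (c * (x - y) * t)))%:E)%E.
    by rewrite lee_fin; apply: mulr_ge0; [exact: expR_ge0|exact: c1].
  have ff0 : 0 <= f x * f y by exact: mulr_ge0.
  rewrite (ge0_integralZT _ mE E0 ff0) (integral_expR_cos _ e0).
  by rewrite -!EFinM /q; congr EFin; ring.
move: L; rewrite L2 (L5 e0).
under [in X in _ = X -> _]eq_integral => x _.
  under eq_integral do rewrite inner.
  rewrite (L3 x e0).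
  over.
rewrite (L4 e0) => /(congr1 (fun z => z - (2 / e * M ^+ 2)%:E)%E).
rewrite ![((2 / e * M ^+ 2)%:E + _)%E]addeC.
by rewrite (addeK _ (isT : (2 / e * M ^+ 2)%:E \is a fin_num)) (addeK _ (isT : (2 / e * M ^+ 2)%:E \is a fin_num)).
Qed.

Let Q := (\int[leb]_x (f x ^+ 2)%:E)%E.

Let mf2 : mfunT (fun x => (f x ^+ 2)%:E).
Proof. by measurability. Qed.

Let Q0 : (0 <= Q)%E.
Proof. by apply: integral_ge0 => x _; rewrite lee_fin sqr_ge0. Qed.

(** After AM-GM and Tonelli, each of the two squares integrates to the same [Q] by translation
    invariance, and the kernel has mass one. *)
Let upper e : (\int[leb]_x ((f x)%:E * g e x) <= Q)%E.
Proof.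
have [->|Qfin] := eqVneq Q +oo%E; first by rewrite leey.
pose k x s := (((f x ^+ 2 + f (x + e * s) ^+ 2) / 2) * cauchy_kernel c s)%:E.
have k0 x s : (0 <= k x s)%E.
  by rewrite lee_fin mulr_ge0 ?cauchy_kernel_ge0// divr_ge0// addr_ge0 ?sqr_ge0.
have mk : mfunT (fun z : RL * RL => k z.1 z.2) by measurability.
apply: (@le_trans _ _ (\int[leb]_x \int[leb]_s k x s)%E).
  apply: ge0_le_integralT.
  - by apply: emeasurable_funM; [exact: mfE|exact: mg].
  - by move=> x; rewrite mule_ge0// lee_fin.
  - exact: (@measurable_integralr _ _ _ _ _ leb _ mk k0).
  - move=> x; rewrite -ge0_integralZT//.
    + apply: ge0_le_integralT.
      * by apply: measurable_funeM; exact: (measurable_fun_pair2 x (mcomb e)).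
      * by move=> s; rewrite mule_ge0 ?lee_fin//; exact: (comb_ge0 e (x, s)).
      * exact: (measurable_fun_pair2 x mk).
      * move=> s; rewrite -EFinM lee_fin mulrA ler_wpM2r ?cauchy_kernel_ge0//.
        rewrite ler_pdivlMr//; have := sqr_ge0 (f x - f (x + e * s)).
        by move: (f x) (f _) => a b; nra.
    + exact: (measurable_fun_pair2 x (mcomb e)).
    + by move=> s; exact: (comb_ge0 e (x, s)).
rewrite (@tonelli _ _ _ _ _ leb leb _ mk k0).
have QE : Q = (fine Q)%:E by rewrite fineK// ge0_fin_numE// ltey.
have sq0 y : (0 <= (f y ^+ 2)%:E)%E by rewrite lee_fin; exact: sqr_ge0.
have shift s : (\int[leb]_x (f (x + e * s) ^+ 2)%:E = Q)%E.
  rewrite /Q (@ge0_integral_affine R 1 (e * s) (fun y => (f y ^+ 2)%:E) (oner_neq0 R) mf2 sq0) normr1 mul1e.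
  by apply: eq_integral => x _; rewrite mul1r.
have inner s : (\int[leb]_x k x s = (fine Q)%:E * (cauchy_kernel c s)%:E)%E.
  transitivity (\int[leb]_x ((cauchy_kernel c s / 2)%:E * ((f x ^+ 2)%:E + (f (x + e * s) ^+ 2)%:E)))%E.
    by apply: eq_integral => x _; rewrite -EFinD -EFinM /k; congr EFin; ring.
  have ms : mfunT (fun x : RL => (f (x + e * s) ^+ 2)%:E) by measurability.
  have s0 x : (0 <= (f (x + e * s) ^+ 2)%:E)%E by rewrite lee_fin; exact: sqr_ge0.
  rewrite ge0_integralZT.
  - rewrite (ge0_integralDT _ mf2 sq0 ms s0) shift -/Q.
    by rewrite QE -EFinD -!EFinM; congr EFin; field.
  - by measurability.
  - by move=> x; apply: adde_ge0; [exact: sq0|exact: s0].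
  - by apply: divr_ge0; [exact: cauchy_kernel_ge0|exact: ler0n].
under eq_integral do rewrite inner.
rewrite ge0_integralZT.
- by rewrite integral_ck mule1 -QE.
- by apply/measurable_EFinP; exact: measurable_cauchy_kernel.
- by move=> s; rewrite lee_fin; exact: cauchy_kernel_ge0.
- exact: fine_ge0.
Qed.

Let mckE : mfunT (fun s : RL => (cauchy_kernel c s)%:E).
Proof. by apply/measurable_EFinP; exact: measurable_cauchy_kernel. Qed.

Let ckE_ge0 s : (0 <= (cauchy_kernel c s)%:E)%E.
Proof. by rewrite lee_fin; exact: cauchy_kernel_ge0. Qed.

(** The ball of radius [r] in the rescaled variable is the ball of radius [e * r] around [x]. The
    factor [e] of the substitution reduces its length [2 * (e * r)] to [2 * r]. *)
Let integral_ball_davg (r : R) x (e : R) : 0 < r -> 0 < e ->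
  (\int[leb]_(s in ball 0%R r) (`|f (e * s + x) - f x|%R)%:E =
   (2 * r)%:E * davg f x (e * r))%E.
Proof.
move=> r0 e0; have er0 : 0 < e * r by exact: mulr_gt0.
have er2 : 0 < 2 * (e * r) by apply: mulr_gt0; [exact: ltr0n|].
pose phi y := `|f y - f x|.
have mphi : mfunT phi.
  apply: measurableT_comp; first exact: normr_measurable.
  by apply: measurable_funB; [exact: mf|exact: measurable_cst].
have -> : davg f x (e * r) = (((2 * (e * r))^-1)%:E * \int[leb]_(y in ball x (e * r)) (phi y)%:E)%E.
  rewrite /davg /iavg lebesgue_measure_ball; last exact: ltW.
  by rewrite inver -[(e * r) *+ 2]mulr_natl (negbTE (lt0r_neq0 er2)).
rewrite integral_mkcond [in RHS]integral_mkcond [X in _ = (_ * (_ * X))%E](@ge0_integral_affine R e x); first last.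
- move=> y; rewrite patchE; case: ifP => _; [rewrite lee_fin; exact: normr_ge0|exact: lexx].
- have mB : measurable (ball x (e * r)) by exact: measurable_ball.
  have mphiE : measurable_fun (ball x (e * r)) (EFin \o phi).
    by apply: measurable_funTS; apply/measurable_EFinP; exact: mphi.
    exact: ((measurable_restrictT _ mB).1 mphiE).
- exact: lt0r_neq0.
rewrite (gtr0_norm e0) !muleA -!EFinM (_ : _ * _ * _ = 1); last first.
  by field; rewrite (lt0r_neq0 e0) (lt0r_neq0 r0).
rewrite mul1e; apply: eq_integral => s _; rewrite !patchE; congr (if _ then _ else _).
apply/idP/idP; rewrite !inE /ball/= sub0r normrN opprD addrCA subrr addr0 normrN;
  by rewrite normrM (gtr0_norm e0) (ltr_pM2l e0).
Qed.

(** On the ball, [f x] exceeds the shifted value by at most the absolute difference, and the kernel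
    is at most 2; hence the constant 4, twice the 2 of [integral_ball_davg]. *)
Let lower_pt (r : R) x (e : R) : 0 < r -> 0 < e ->
  ((f x)%:E * \int[leb]_(s in ball 0%R r) (cauchy_kernel c s)%:E <=
   g e x + (4 * r)%:E * davg f x (e * r))%E.
Proof.
move=> r0 e0; pose phi s := `|f (e * s + x) - f x|.
have mB : measurable (ball (0:R) r) by exact: measurable_ball.
have mphi : mfunT (fun s : RL => (phi s)%:E).
  apply/measurable_EFinP; apply: measurableT_comp; first exact: normr_measurable.
  apply: measurable_funB; last exact: measurable_cst.
  exact: (measurableT_comp mf (measurable_affine e x)).
have phi0 s : (0 <= (phi s)%:E)%E by rewrite lee_fin; exact: normr_ge0.
have mfc : mfunT (fun s : RL => (f (x + e * s) * cauchy_kernel c s)%:E).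
  exact: (measurable_fun_pair2 x (mcomb e)).
have fc0 s : (0 <= (f (x + e * s) * cauchy_kernel c s)%:E)%E by exact: (comb_ge0 e (x, s)).
have m2phi : mfunT (fun s : RL => 2%:E * (phi s)%:E)%E by measurability.
have p2phi s : (0 <= 2%:E * (phi s)%:E)%E.
  by apply: mule_ge0; [rewrite lee_fin; exact: ler0n|exact: phi0].
apply: (@le_trans _ _ (\int[leb]_(s in ball 0%R r) ((f (x + e * s) * cauchy_kernel c s)%:E +
   2%:E * (phi s)%:E))%E).
  rewrite -ge0_integralZl; first last.
  - by rewrite lee_fin; exact: f0.
  - by move=> s _; exact: ckE_ge0.
  - exact: (measurable_funTS mckE).
  - exact: mB.
  apply: ge0_le_integral.
  - exact: mB.
  - by move=> s _; apply: mule_ge0; [rewrite lee_fin; exact: f0|exact: ckE_ge0].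
  - by apply: measurable_funTS; apply: measurable_funeM; exact: mckE.
  - by apply: measurable_funTS; apply: emeasurable_funD; [exact: mfc|exact: m2phi].
  - move=> s _; rewrite -!EFinM -EFinD lee_fin /phi (addrC (e * s)).
    have := cauchy_kernel_le2 c s; have := cauchy_kernel_ge0 c s.
    have := ler_norm (f x - f (x + e * s)); rewrite distrC.
    have := normr_ge0 (f (x + e * s) - f x).
    move: (cauchy_kernel c s) (f x) (f _) => c' a b; move: `|_| => n; nra.
rewrite ge0_integralD; first last.
- exact: (measurable_funTS m2phi).
- by move=> s _; exact: p2phi.
- exact: (measurable_funTS mfc).
- by move=> s _; exact: fc0.
- exact: mB.
apply: leeD.
  apply: ge0_subset_integral.
  - exact: mB.
  - exact: measurableT.
  - exact: mfc.
  - by move=> s _; exact: fc0.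
  - by [].
rewrite ge0_integralZl; first last.
- by rewrite lee_fin; exact: ler0n.
- by move=> s _; exact: phi0.
- exact: (measurable_funTS mphi).
- exact: mB.
by rewrite (integral_ball_davg x r0 e0) muleA -EFinM mulrA -natrM.
Qed.

Let einv n : R := n.+1%:R^-1.
Let einv0 n : 0 < einv n. Proof. by rewrite invr_gt0. Qed.

(** At a Lebesgue point the error of [lower_pt] tends to 0 for each fixed ball. Only afterwards does
    the radius grow, and the mass of the kernel on the ball tends to 1. *)
Let lower_ae : {ae leb, forall x, ((f x)%:E <= limn_einf (fun n => g (einv n) x))%E}.
Proof.
have lf : locally_integrable setT f.
  apply: open_integrable_locally => //; exact: openT.
apply: ae_mono (lebesgue_differentiation lf) => x Lx.
pose ck k : \bar R := (\int[leb]_(s in ball 0%R k.+1%:R) (cauchy_kernel c s)%:E)%E.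
have c_cvg : ck k @[k --> \oo] --> 1%E.
  rewrite -(integral_ck) (_ : [set: R] = \bigcup_k ball (0:R) k.+1%:R); last first.
    apply/seteqP; split=> // y _; exists (Num.truncn `|y|) => //.
    by rewrite /ball/= sub0r normrN truncnS_gt.
  apply: ge0_nondecreasing_set_cvg_integral.
  - by apply/nondecreasing_seqP => n; apply/subsetPset; apply: le_ball; rewrite ler_nat.
  - by move=> n; exact: measurable_ball.
  - by move=> n; apply: measurable_funTS; apply/measurable_EFinP; exact: measurable_cauchy_kernel.
  - by move=> n y _; rewrite lee_fin cauchy_kernel_ge0.
have bound k : ((f x)%:E * ck k <= limn_einf (fun n => g (einv n) x))%E.
  have S0 : 0 < k.+1%:R :> R by [].
  set S' := k.+1%:R : R; pose u n := einv n * S'.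
  have u0 n : 0 < u n by rewrite mulr_gt0.
  have u_cvg0 : u n @[n --> \oo] --> (0 : R).
    by rewrite -[X in _ --> X](mul0r S'); apply: cvgM; [exact: cvg_harmonic|exact: cvg_cst].
  have u_cvg : u n @[n --> \oo] --> (0 : R)^'+.
    move=> A A0; have Ah : \forall n \near \oo, 0 < u n -> A (u n) := u_cvg0 _ A0.
    apply: (@filterS _ _ _ (fun n => 0 < u n -> A (u n)) (fun n => A (u n)) _ Ah).
    by move=> n hn; apply: hn; exact: u0.
  have davg_cvg : davg f x (u n) @[n --> \oo] --> 0%E by exact: (cvg_comp _ _ u_cvg Lx).
  have ck_fin : ck k \is a fin_num.
    rewrite ge0_fin_numE; last by apply: integral_ge0 => s _; rewrite lee_fin cauchy_kernel_ge0.
    apply: (@le_lt_trans _ _ 1%E); last exact: ltry.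
    rewrite -integral_ck; apply: ge0_subset_integral.
    - exact: measurable_ball.
    - exact: measurableT.
    - exact: mckE.
    - by move=> s _; exact: ckE_ge0.
    - by [].
  have fck_fin : ((f x)%:E * ck k)%E \is a fin_num by rewrite fin_numM.
  apply: (@limn_einf_ge_cvg _ _ (fun n => (f x)%:E * ck k - (4 * S')%:E * davg f x (u n))%E).
    move=> n; have [dfin|dfin] := boolP (davg f x (u n) \is a fin_num).
      rewrite leeBlDr; last by rewrite fin_numM.
      exact: lower_pt.
    (* An infinite average turns the lower bound into [-oo]. *)
    have -> : davg f x (u n) = +oo%E.
      by move: dfin; rewrite ge0_fin_numE ?davg_ge0// ltey negbK => /eqP.
    rewrite gt0_muley ?lte_fin ?mulr_gt0//= -(fineK fck_fin).
    exact: leNye.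
  rewrite -[X in _ --> X]sube0; apply: cvgeB; [by rewrite fin_num_adde_defl|exact: cvg_cst|].
  by rewrite -[X in _ --> X](mule0 (4 * S')%:E); apply: cvgeZl.
have : ((f x)%:E * ck k)%E @[k --> \oo] --> ((f x)%:E * 1)%E by apply: cvgeZl.
rewrite mule1 => fc; rewrite -(cvg_lim _ fc)//.
apply: lime_le; first by apply/cvg_ex; eexists; exact: fc.
by apply: nearW => k; exact: bound.
Qed.

(** [J] is read in both directions: Fatou for the damped transforms together with [upper] bounds the
    left side, Fatou for [f * g] together with [lower_ae] bounds the right side. Both sides may be
    infinite. *)
Lemma plancherel_nonneg : (\int[leb]_t (nsq (fourier c (fun x => (f x)%:C) t))%:E =
  \int[leb]_x (f x ^+ 2)%:E)%E.
Proof.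
pose a n t := (expR (- (einv n * `|t|)) * h t)%:E.
have ma n : mfunT (a n) by apply/measurable_EFinP; apply: measurable_funM; [exact: mexp|exact: mh].
have a0 n t : (0 <= a n t)%E by rewrite lee_fin mulr_ge0 ?expR_ge0.
have mhE : mfunT (EFin \o h) by measurability.
apply/eqP; rewrite eq_le; apply/andP; split.
- have a_cvg t : a n t @[n --> \oo] --> (h t)%:E.
    apply/cvg_EFin; first by near=> n.
    rewrite -[X in _ --> X](mul1r (h t)); apply: cvgM; last exact: cvg_cst.
    rewrite -expR0; apply: continuous_cvg; first exact: continuous_expR.
    rewrite -oppr0; apply: cvgN; rewrite -[X in _ --> X](mul0r `|t|).
    by apply: cvgM; [exact: cvg_harmonic|exact: cvg_cst].
  apply: (@le_trans _ _ (\int[leb]_t limn_einf (a ^~ t))%E).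
    by under [leRHS]eq_integral do rewrite (cvg_limn_einf_sup (a_cvg _)).1.
  apply: le_trans (fatou _ _ _ _) _ => //.
  by apply: limn_einf_le => n; rewrite J//; exact: upper.
- pose b n x := ((f x)%:E * g (einv n) x)%E.
  have mb n : mfunT (b n) by apply: emeasurable_funM; [exact: mfE|exact: mg].
  have b0 n x : (0 <= b n x)%E by rewrite mule_ge0// lee_fin.
  apply: (@le_trans _ _ (\int[leb]_x limn_einf (b ^~ x))%E).
    apply: ae_ge0_le_integral => //.
    + by move=> x _; rewrite lee_fin sqr_ge0.
    + by move=> x _; apply: (limn_einf_ge_cvg (v := fun _ => 0%E)) => //; exact: cvg_cst.
    + exact: (measurable_fun_limn_einf mb).
    + apply: ae_mono lower_ae => x fx _.
      by rewrite expr2 EFinM; exact: limn_einf_ge_mul.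
  apply: le_trans (fatou _ _ _ _) _ => //.
  apply: limn_einf_le => n; rewrite -(J (einv0 n)).
  apply: ge0_le_integralT; [exact: (ma n)|exact: (a0 n)|exact: mhE|move=> t].
  rewrite lee_fin; apply: ler_piMl; first exact: h0.
  by rewrite -expR0 ler_expR oppr_le0; apply: mulr_ge0; [exact: ltW|exact: normr_ge0].
Unshelve. all: by end_near.
Qed.

End nonnegative.
End fourier.

Section plancherel.
Context (R : realType).
Local Notation leb := (@lebesgue_measure R).
Local Notation RL := (measurableTypeR R).
Local Notation normc := (@Normc.normc R).
Variable c : R.
Hypothesis integral_ck : (\int[leb]_x (cauchy_kernel c x)%:E = 1)%E.

Let marg tau : mfunT (fun u : RL => u * tau).
Proof. by measurability. Qed.

Lemma cintegrable_character d (T : measurableType d) (mu : {measure set T -> \bar R})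
    (f : T -> R[i]) (g : T -> R) : mfunT g -> cintegrable mu f ->
  cintegrable mu (fun u => f u * expi (c * g u)).
Proof.
move=> mg cf; apply: (cintegrable_le _ cf).
  by apply: cmeasurableM; [exact: cf.1|exact: cmeasurable_character].
by move=> x; rewrite Normc.normcM normc_expi mulr1.
Qed.

Lemma fourierD (f g : RL -> R[i]) tau : cintegrable leb f -> cintegrable leb g ->
  fourier c (fun u => f u + g u) tau = fourier c f tau + fourier c g tau.
Proof.
move=> cf cg; rewrite /fourier -cintegralD.
- by apply: eq_cintegral => u; rewrite mulrDl.
- exact: (cintegrable_character (marg tau) cf).
- exact: (cintegrable_character (marg tau) cg).
Qed.

Lemma fourierZ (a : R[i]) (f : RL -> R[i]) tau : cintegrable leb f ->
  fourier c (fun u => a * f u) tau = a * fourier c f tau.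
Proof.
move=> cf; rewrite /fourier -cintegralZ.
  by apply: eq_cintegral => u; rewrite -mulrA.
exact: (cintegrable_character (marg tau) cf).
Qed.

Lemma cmeasurable_fourier d (Y : measurableType d) (f : Y * RL -> R[i]) : cmeasurable f ->
  cmeasurable (fun z : Y * RL => fourier c (fun u => f (z.1, u)) z.2).
Proof.
move=> mf; rewrite /fourier.
apply: (@cmeasurable_cintegral _ _ _ _ _ leb
  (fun z : (Y * RL) * RL => f (z.1.1, z.2) * expi (c * (z.2 * z.1.2)))).
have m11 : mfunT (fun z : (Y * RL) * RL => z.1.1) by measurability.
have m12 : mfunT (fun z : (Y * RL) * RL => z.1.2) by measurability.
have m2 : mfunT (fun z : (Y * RL) * RL => z.2) by measurability.
apply: cmeasurableM.
  by apply: (cmeasurable_comp mf); exact: measurable_fun_pair.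
by apply: cmeasurable_character; exact: measurable_funM.
Qed.

Lemma cmeasurable_fourier1 (f : RL -> R[i]) : cmeasurable f -> cmeasurable (fourier c f).
Proof.
move=> mf; have m2 : cmeasurable (fun z : RL * RL => f z.2).
  by apply: (cmeasurable_comp mf); exact: measurable_snd.
have := cmeasurable_section2 (0 : RL) (cmeasurable_fourier m2).
move=> _; have := cmeasurable_section1 (0 : RL) (cmeasurable_fourier m2).
exact.
Qed.

(** The positive part [p] and the negative part [q] have product 0, so [(p + q) ^+ 2],
    [(p - q) ^+ 2] and [p ^+ 2 + q ^+ 2] coincide. The parallelogram law for the transforms then
    yields [f = p - q] from the nonnegative [p], [q] and [p + q]; finiteness of the integral of
    [f ^+ 2] permits the subtraction. *)
Lemma plancherel_real (f : RL -> R) : mfunT f ->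
  (\int[leb]_x `|f x|%:E < +oo)%E -> (\int[leb]_x (f x ^+ 2)%:E < +oo)%E ->
  (\int[leb]_t (nsq (fourier c (fun x => (f x)%:C) t))%:E = \int[leb]_x (f x ^+ 2)%:E)%E.
Proof.
move=> mf f1 f2.
pose p (x : RL) := Num.max (f x) 0; pose q (x : RL) := Num.max (- f x) 0.
have mp : mfunT p by apply: measurable_maxr; [exact: mf|exact: measurable_cst].
have mq : mfunT q.
  by apply: measurable_maxr; [apply: measurableT_comp; [exact: oppr_measurable|exact: mf]|exact: measurable_cst].
have p0 x : 0 <= p x by rewrite le_max lexx orbT.
have q0 x : 0 <= q x by rewrite le_max lexx orbT.
have fpq x : f x = p x - q x.
  rewrite /p /q; have [h|] := boolP (0 <= f x); last rewrite -ltNge => h.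
    by rewrite (max_l h) max_r ?oppr_le0// subr0.
  by rewrite (max_r (ltW h)) max_l ?oppr_ge0 ?(ltW h)// sub0r opprK.
have apq x : `|f x| = p x + q x.
  rewrite /p /q; have [h|] := boolP (0 <= f x); last rewrite -ltNge => h.
    by rewrite (max_l h) max_r ?oppr_le0// addr0 ger0_norm.
  by rewrite (max_r (ltW h)) max_l ?oppr_ge0 ?(ltW h)// add0r ltr0_norm.
have pq0 x : p x * q x = 0.
  rewrite /p /q; have [h|] := boolP (0 <= f x); last rewrite -ltNge => h.
    by rewrite [X in _ * X]max_r ?oppr_le0// mulr0.
  by rewrite (max_r (ltW h)) mul0r.
have p1 : (\int[leb]_x (p x)%:E < +oo)%E.
  apply: le_lt_trans f1; apply: ge0_le_integralT.
  - exact/measurable_EFinP.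
  - by move=> x; rewrite lee_fin.
  - by measurability.
  - by move=> x; rewrite lee_fin apq lerDl.
have q1 : (\int[leb]_x (q x)%:E < +oo)%E.
  apply: le_lt_trans f1; apply: ge0_le_integralT.
  - exact/measurable_EFinP.
  - by move=> x; rewrite lee_fin.
  - by measurability.
  - by move=> x; rewrite lee_fin apq lerDr.
have ci (h : RL -> R) : mfunT h -> (forall x, 0 <= h x) ->
    (\int[leb]_x (h x)%:E < +oo)%E -> cintegrable leb (fun x => (h x)%:C).
  move=> mh h0 h1; split; first exact: cmeasurable_real.
  by under eq_integral do rewrite normc_real ger0_norm//.
have cp := ci p mp p0 p1; have cq := ci q mq q0 q1.
have map_ : mfunT (fun x => p x + q x) by measurability.
have s1 : (\int[leb]_x (p x + q x)%:E < +oo)%E by under eq_integral do rewrite -apq.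
have s0 x : 0 <= p x + q x by exact: addr_ge0.
pose NF (h : RL -> R) t := (nsq (fourier c (fun x => (h x)%:C) t))%:E.
have Ep : (\int[leb]_t NF p t = \int[leb]_x (p x ^+ 2)%:E)%E := plancherel_nonneg integral_ck mp p0 p1.
have Eq : (\int[leb]_t NF q t = \int[leb]_x (q x ^+ 2)%:E)%E := plancherel_nonneg integral_ck mq q0 q1.
have Es : (\int[leb]_t NF (fun x => p x + q x)%R t = \int[leb]_x ((p x + q x) ^+ 2)%:E)%E
  := plancherel_nonneg integral_ck map_ s0 s1.
have mN (h : RL -> R) : mfunT h -> mfunT (NF h).
  move=> mh; apply: measurable_EFin_nsq; apply: cmeasurable_fourier1; exact: cmeasurable_real.
have N0 h t : (0 <= NF h t)%E by rewrite lee_fin nsq_ge0.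
have sq0 (h : RL -> R) t : (0 <= (h t ^+ 2)%:E)%E by rewrite lee_fin sqr_ge0.
have msq (h : RL -> R) : mfunT h -> mfunT (fun x => (h x ^+ 2)%:E) by measurability.
have key : (\int[leb]_t NF (fun x => p x + q x)%R t + \int[leb]_t NF f t =
    2%:E * (\int[leb]_t NF p t + \int[leb]_t NF q t))%E.
  apply: eq_trans (esym (ge0_integralDT leb (mN _ map_) (N0 (fun x => p x + q x)) (mN _ mf) (N0 f))) _.
  rewrite -(ge0_integralDT leb (mN _ mp) (N0 p) (mN _ mq) (N0 q)).
  rewrite -ge0_integralZT; first last.
  - exact: ler0n.
  - by move=> t; apply: adde_ge0; exact: N0.
  - by apply: emeasurable_funD; exact: mN.
  apply: eq_integral => t _; rewrite /NF -!EFinD -EFinM mulrDr -nsq_parallelogram.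
  congr (nsq _ + nsq _)%:E.
    by rewrite -fourierD//; apply: eq_cintegral => u; rewrite rmorphD.
  rewrite -mulN1r -fourierZ// -fourierD//; last exact: cintegrableZ.
  by apply: eq_cintegral => u; rewrite mulN1r -rmorphN -rmorphD fpq.
transitivity (\int[leb]_t NF f t)%E; first by [].
move: key; rewrite Ep Eq Es -(ge0_integralDT leb (msq _ mp) (sq0 p) (msq _ mq) (sq0 q)).
have -> : (\int[leb]_x ((p x ^+ 2)%:E + (q x ^+ 2)%:E) = \int[leb]_x (f x ^+ 2)%:E)%E.
  by apply: eq_integral => x _; rewrite -EFinD fpq; congr EFin; have := pq0 x; move: (p x) (q x) => a b ab; rewrite sqrrB ab mul0rn subr0.
have -> : (\int[leb]_x ((p x + q x) ^+ 2)%:E = \int[leb]_x (f x ^+ 2)%:E)%E.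
  by apply: eq_integral => x _; rewrite -apq real_normK ?num_real.
have Qfin : (\int[leb]_x (f x ^+ 2)%:E)%E \is a fin_num.
  by rewrite ge0_fin_numE//; apply: integral_ge0 => x _; exact: sq0.
move: Qfin; move: (\int[leb]_x (f x ^+ 2)%:E)%E => Q Qfin.
rewrite mule_natl mule2n => /(congr1 (fun z => z - Q)%E).
by rewrite [(Q + _)%E]addeC !addeK.
Qed.

(** The transforms [A] and [B] of the real and imaginary parts are conjugated by t -> -t. Adding the
    values at [t] and [- t] therefore removes the cross terms by the parallelogram law, and the
    integral is invariant under this reflection. *)
Lemma plancherel (f : RL -> R[i]) : cintegrable leb f -> cL2 leb f ->
  (\int[leb]_t (nsq (fourier c f t))%:E = \int[leb]_x (nsq (f x))%:E)%E.
Proof.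
move=> cf [mf f2].
pose a x := complex.Re (f x); pose b x := complex.Im (f x).
have [ma mb] : mfunT a /\ mfunT b by [].
have sq0 (h : RL -> R) t : (0 <= (h t ^+ 2)%:E)%E by rewrite lee_fin sqr_ge0.
have msq (h : RL -> R) : mfunT h -> mfunT (fun x => (h x ^+ 2)%:E) by measurability.
have a1 : (\int[leb]_x `|a x|%:E < +oo)%E by have /integrableP[_] := integrable_Re cf.
have b1 : (\int[leb]_x `|b x|%:E < +oo)%E by have /integrableP[_] := integrable_Im cf.
have a2 : (\int[leb]_x (a x ^+ 2)%:E < +oo)%E.
  apply: le_lt_trans f2; apply: ge0_le_integralT; [exact: msq|exact: sq0|exact: measurable_EFin_nsq|].
  by move=> x; rewrite lee_fin /nsq lerDl sqr_ge0.
have b2 : (\int[leb]_x (b x ^+ 2)%:E < +oo)%E.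
  apply: le_lt_trans f2; apply: ge0_le_integralT; [exact: msq|exact: sq0|exact: measurable_EFin_nsq|].
  by move=> x; rewrite lee_fin /nsq lerDr sqr_ge0.
have ca : cintegrable leb (fun x => (a x)%:C) by apply: cintegrable_real; exact: integrable_Re.
have cb : cintegrable leb (fun x => (b x)%:C) by apply: cintegrable_real; exact: integrable_Im.
have Ea := plancherel_real ma a1 a2; have Eb := plancherel_real mb b1 b2.
pose A t := fourier c (fun x => (a x)%:C) t; pose B t := fourier c (fun x => (b x)%:C) t.
have FE t : fourier c f t = A t + 'i%C * B t.
  rewrite /A /B -fourierZ// -fourierD//; last exact: cintegrableZ.
  by apply: eq_cintegral => u; rewrite -complexE.
have neg (h : RL -> R) t : cintegrable leb (fun x => (h x)%:C) ->
    fourier c (fun x => (h x)%:C) (- t) = (fourier c (fun x => (h x)%:C) t)^*.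
  move=> ch; rewrite /fourier -cintegralJ; last exact: (cintegrable_character (marg t) ch).
  apply: eq_cintegral => u; rewrite cMJ !mulrN expiN; congr (_ * _).
  by apply/eqP; rewrite eq_complex/= oppr0 !eqxx.
have FNE t : nsq (fourier c f t) + nsq (fourier c f (- t)) = 2 * nsq (A t) + 2 * nsq (B t).
  have -> : nsq (B t) = nsq ('i%C * B t) by rewrite nsqM {2}/nsq/= expr0n expr1n add0r mul1r.
  rewrite -nsq_parallelogram -FE; congr (_ + _).
  rewrite FE /A /B !neg//.
  by move: (fourier _ _ _) (fourier _ _ _) => -[x1 x2] [y1 y2]; rewrite /nsq/=; ring.
have mF : mfunT (fun t => (nsq (fourier c f t))%:E).
  by apply: measurable_EFin_nsq; exact: cmeasurable_fourier1.
have mA : mfunT (fun t => (nsq (A t))%:E).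
  by apply: measurable_EFin_nsq; apply: cmeasurable_fourier1; exact: cmeasurable_real.
have mB : mfunT (fun t => (nsq (B t))%:E).
  by apply: measurable_EFin_nsq; apply: cmeasurable_fourier1; exact: cmeasurable_real.
have n0 (h : RL -> R[i]) t : (0 <= (nsq (h t))%:E)%E by rewrite lee_fin nsq_ge0.
have N1 : (-1 : R) != 0 by rewrite oppr_eq0 oner_eq0.
have refl : (\int[leb]_t (nsq (fourier c f (- t)))%:E = \int[leb]_t (nsq (fourier c f t))%:E)%E.
  rewrite [RHS](@ge0_integral_scale R (-1) _ N1 mF (n0 _)) normrN1 mul1e.
  by apply: eq_integral => t _; rewrite mulN1r.
have mFN : mfunT (fun t : RL => (nsq (fourier c f (- t)))%:E).
  by apply: (measurableT_comp mF); exact: oppr_measurable.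
have key : (2%:E * \int[leb]_t (nsq (fourier c f t))%:E = 2%:E * \int[leb]_x (nsq (f x))%:E)%E.
  rewrite mule_natl mule2n -{2}refl.
  apply: eq_trans (esym (ge0_integralDT leb mF (n0 _) mFN (fun t => n0 (fourier c f) (- t)))) _.
  have mAB : mfunT (fun t => (nsq (A t))%:E + (nsq (B t))%:E)%E by measurability.
  have AB0 t : (0 <= (nsq (A t))%:E + (nsq (B t))%:E)%E by apply: adde_ge0; exact: n0.
  transitivity (\int[leb]_t (2%:E * ((nsq (A t))%:E + (nsq (B t))%:E)))%E.
    apply: eq_integral => t _; have := congr1 EFin (FNE t).
    by rewrite -mulrDr EFinM !EFinD => ->.
  apply: eq_trans (ge0_integralZT leb mAB AB0 (ler0n R 2)) _.
  congr (_ * _)%E; apply: eq_trans (ge0_integralDT leb mA (n0 A) mB (n0 B)) _.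
  rewrite /A /B Ea Eb; apply: eq_trans (esym (ge0_integralDT leb (msq _ ma) (sq0 a) (msq _ mb) (sq0 b))) _.
  by [].
have := congr1 (fun z => (2^-1)%:E * z)%E key.
by rewrite (mule_half_double (\int[leb]_t (nsq (fourier c f t))%:E)%E) (mule_half_double (\int[leb]_x (nsq (f x))%:E)%E).
Qed.

(** Applied on almost every fibre: square-integrability of the fibre follows from finiteness of the
    double integral, integrability is a separate assumption. *)
Lemma plancherel_partial d (Y : measurableType d) (nu : {sigma_finite_measure set Y -> \bar R})
    (f : Y * RL -> R[i]) : cmeasurable f ->
  {ae nu, forall y, (\int[leb]_u (normc (f (y, u)))%:E < +oo)%E} ->
  (\int[nu]_y \int[leb]_u (nsq (f (y, u)))%:E < +oo)%E ->
  (\int[nu]_y \int[leb]_t (nsq (fourier c (fun u => f (y, u)) t))%:E =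
   \int[nu]_y \int[leb]_u (nsq (f (y, u)))%:E)%E.
Proof.
move=> mf f1 f2.
have n0 (h : Y * RL -> R[i]) z : (0 <= (nsq (h z))%:E)%E by rewrite lee_fin nsq_ge0.
have mn : mfunT (fun y => \int[leb]_u (nsq (f (y, u)))%:E)%E.
  exact: (measurable_integral1 leb (measurable_EFin_nsq mf) (n0 f)).
have mF := measurable_EFin_nsq (cmeasurable_fourier mf).
have mnF : mfunT (fun y => \int[leb]_t (nsq (fourier c (fun u => f (y, u)) t))%:E)%E.
  exact: (measurable_integral1 leb mF (n0 (fun z => fourier c (fun u => f (z.1, u)) z.2))).
have i2 : nu.-integrable setT (fun y => \int[leb]_u (nsq (f (y, u)))%:E)%E.
  apply/integrableP; split; first exact: mn.
  suff -> : (\int[nu]_y `|\int[leb]_u (nsq (f (y, u)))%:E| =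
    \int[nu]_y \int[leb]_u (nsq (f (y, u)))%:E)%E by exact: f2.
  apply: eq_integral => y _; rewrite gee0_abs//.
  by apply: integral_ge0 => u _; exact: (n0 f (y, u)).
apply: ae_eq_integral; [exact: measurableT|exact: mnF|exact: mn|].
have a2 := integrable_ae measurableT i2.
apply: ae_mono (ae_and f1 a2) => y [fy1 fy2] _.
have mfy := cmeasurable_section1 y mf.
apply: plancherel; split; [exact: mfy|exact: fy1|exact: mfy|].
have {}fy2 := fy2 I; rewrite ge0_fin_numE in fy2 => //.
by apply: integral_ge0 => u _; rewrite lee_fin nsq_ge0.
Qed.

End plancherel.

(** * Parseval's identity and kernel operators *)

Section inner_product.
Context d (T : measurableType d) (R : realType) (mu : {measure set T -> \bar R}).
Implicit Types (f g : T -> R[i]).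

Definition ip f g : R[i] := cintegral mu (fun x => f x * (g x)^*).

Definition N2 f : R := \int[mu]_x nsq (f x).

Lemma nsq_integral_ge0 f : (0 <= \int[mu]_x (nsq (f x))%:E)%E.
Proof. by apply: integral_ge0 => x _; rewrite lee_fin nsq_ge0. Qed.

Lemma N2E f : cL2 mu f -> ((N2 f)%:E = \int[mu]_x (nsq (f x))%:E)%E.
Proof. by move=> [mf f2]; rewrite /N2 /Rintegral fineK// ge0_fin_numE// nsq_integral_ge0. Qed.

Lemma integrable_nsq f : cL2 mu f -> mu.-integrable setT (EFin \o (fun x => nsq (f x))).
Proof.
move=> [mf f2]; apply/integrableP; split; first exact: measurable_EFin_nsq.
suff -> : (\int[mu]_x `|(EFin \o (fun x => nsq (f x))) x| = \int[mu]_x (nsq (f x))%:E)%E by exact: f2.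
by apply: eq_integral => x _ /=; rewrite ger0_norm ?nsq_ge0.
Qed.

Lemma cintegrable_ip f g : cL2 mu f -> cL2 mu g -> cintegrable mu (fun x => f x * (g x)^*).
Proof. by move=> cf cg; apply: cintegrableM => //; exact: cL2J. Qed.

Lemma ipDl f g k : cL2 mu f -> cL2 mu g -> cL2 mu k ->
  ip (fun x => f x + g x) k = ip f k + ip g k.
Proof.
move=> cf cg ck; rewrite /ip -cintegralD; last 2 first.
- exact: cintegrable_ip.
- exact: cintegrable_ip.
by apply: eq_cintegral => x; rewrite mulrDl.
Qed.

Lemma ipZl (a : R[i]) f g : cL2 mu f -> cL2 mu g -> ip (fun x => a * f x) g = a * ip f g.
Proof.
move=> cf cg; rewrite /ip -cintegralZ; last exact: cintegrable_ip.
by apply: eq_cintegral => x; rewrite -mulrA.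
Qed.

Lemma ip_suml n (F : 'I_n -> T -> R[i]) g : (forall i, cL2 mu (F i)) -> cL2 mu g ->
  ip (fun x => \sum_(i < n) F i x) g = \sum_(i < n) ip (F i) g.
Proof.
move=> cF cg; rewrite /ip -cintegral_sum; last by move=> i; exact: cintegrable_ip.
by apply: eq_cintegral => x; rewrite mulr_suml.
Qed.

Lemma ip_self f : cL2 mu f -> complex.Re (ip f f) = N2 f.
Proof.
move=> cf; rewrite /ip /cintegral /N2/=; apply: eq_Rintegral => x _.
by case: (f x) => a b; rewrite /nsq/=; ring.
Qed.

Lemma N2B_scale (a : R[i]) f g : cL2 mu f -> cL2 mu g ->
  N2 (fun x => f x - a * g x) = N2 f - 2 * complex.Re (a^* * ip f g) + nsq a * N2 g.
Proof.
move=> cf cg; have cfg := cintegrable_ip cf cg.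
have iF := integrable_nsq cf; have iG := integrable_nsq cg.
have ifg := integrable_Re (cintegrableZ (a^*) cfg).
have ifg2 := integrableZl measurableT 2 ifg.
have ig2 := integrableZl measurableT (nsq a) iG.
have iB := integrableB measurableT iF ifg2.
rewrite /ip -(cintegralZ _ cfg) /cintegral/= /N2.
rewrite -(RintegralZl _ measurableT ifg) -(RintegralZl _ measurableT iG) -(RintegralB measurableT iF ifg2) -(RintegralD measurableT iB ig2).
apply: eq_Rintegral => x _.
by case: (f x) (g x) a {ifg ifg2 ig2 iB} => [x1 x2] [y1 y2] [a1 a2]; rewrite /nsq/=; ring.
Qed.

Section parseval.
Variables (e : nat -> T -> R[i]) (F : T -> R[i]).
Hypotheses (ce : forall j, cL2 mu (e j)) (cF : cL2 mu F).
Hypothesis orth : forall i j, ip (e i) (e j) = (i == j)%:R.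

Let Rem n x := F x - \sum_(j < n) ip F (e j) * e j x.

Let cRem n : cL2 mu (Rem n).
Proof.
apply: cL2B => //; apply: (@cL2_sum _ _ _ _ _ (fun j x => ip F (e j) * e j x)) => j.
exact: cL2Z.
Qed.

(** The terms subtracted so far are orthogonal to [e n], so the remainder keeps the coefficient of
    [F]. *)
Let ip_Rem n : ip (Rem n) (e n) = ip F (e n).
Proof.
have cs j : cL2 mu (fun x => - ip F (e j) * e j x) by exact: cL2Z.
have -> : Rem n = (fun x => F x + \sum_(j < n) (- ip F (e j) * e j x)).
  by apply/funext => x; rewrite /Rem -sumrN; congr (_ + _); apply: eq_bigr => j _; rewrite mulNr.
rewrite ipDl//; last exact: (@cL2_sum _ _ _ _ _ (fun j x => - ip F (e j) * e j x)).
rewrite (@ip_suml _ (fun j x => - ip F (e j) * e j x))// big1 ?addr0// => j _.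
by rewrite ipZl// orth ltn_eqF// mulr0.
Qed.

Let N2_Rem n : N2 F = N2 (Rem n) + \sum_(j < n) nsq (ip F (e j)).
Proof.
elim: n => [|n ih].
  rewrite big_ord0 addr0; congr N2; apply/funext => x; by rewrite /Rem big_ord0 subr0.
have E : N2 (Rem n.+1) = N2 (Rem n) - nsq (ip F (e n)).
  have -> : Rem n.+1 = (fun x => Rem n x - ip F (e n) * e n x).
    by apply/funext => x; rewrite /Rem big_ord_recr/= opprD addrA.
  rewrite N2B_scale// ip_Rem -(ip_self (ce n)) orth eqxx.
  move: (ip F (e n)) => [a b]; rewrite /nsq/=; ring.
by rewrite big_ord_recr/= ih E; ring.
Qed.

(** Subtracting the next term lowers the squared norm of the remainder by exactly the squared
    modulus of that coefficient ([N2_Rem]). A vanishing remainder thus gives the full sum. *)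
Lemma parseval :
  N2 (fun x => F x - \sum_(j < n) ip F (e j) * e j x) @[n --> \oo] --> 0 ->
  (\sum_(j <oo) (nsq (ip F (e j)))%:E = \int[mu]_x (nsq (F x))%:E)%E.
Proof.
move=> R0; rewrite -N2E//; apply/cvg_lim => //.
have -> : (fun n => \sum_(0 <= j < n) (nsq (ip F (e j)))%:E)%E =
    (fun n => (N2 F - N2 (Rem n))%:E).
  by apply/funext => n; rewrite sumEFin big_mkord {1}(N2_Rem n) addrAC subrr add0r.
apply/cvg_EFin; first by near=> n.
by rewrite -[X in _ --> X]subr0; apply: cvgB; [exact: cvg_cst|exact: R0].
Unshelve. all: by end_near.
Qed.

End parseval.
End inner_product.

Section integral_operator.
Context d (T : measurableType d) (R : realType) (mu : {sigma_finite_measure set T -> \bar R}).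
Variable k : T * T -> R[i].
Hypothesis mk : cmeasurable k.
Hypothesis k2 : (\int[mu]_p \int[mu]_q (nsq (k (p, q)))%:E < +oo)%E.

Definition kernel_op (F : T -> R[i]) p := cintegral mu (fun q => k (p, q) * F q).

Let n0 (h : T * T -> R[i]) z : (0 <= (nsq (h z))%:E)%E.
Proof. by rewrite lee_fin nsq_ge0. Qed.

Let mnk : mfunT (fun p => \int[mu]_q (nsq (k (p, q)))%:E)%E.
Proof. exact: (measurable_integral1 mu (measurable_EFin_nsq mk) (n0 k)). Qed.

Lemma ae_kernel_cL2 : {ae mu, forall p, cL2 mu (fun q => k (p, q))}.
Proof.
have i2 : mu.-integrable setT (fun p => \int[mu]_q (nsq (k (p, q)))%:E)%E.
  apply/integrableP; split; first exact: mnk.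
  suff -> : (\int[mu]_p `|\int[mu]_q (nsq (k (p, q)))%:E| =
    \int[mu]_p \int[mu]_q (nsq (k (p, q)))%:E)%E by exact: k2.
  apply: eq_integral => p _; rewrite gee0_abs//; exact: nsq_integral_ge0.
apply: ae_mono (integrable_ae measurableT i2) => p /(_ I) fp.
split; first exact: cmeasurable_section1.
by rewrite -ge0_fin_numE//; exact: nsq_integral_ge0.
Qed.

Lemma cmeasurable_kernel_op F : cmeasurable F -> cmeasurable (kernel_op F).
Proof.
move=> mF; apply: (@cmeasurable_cintegral _ _ _ _ _ mu (fun z : T * T => k z * F z.2)).
by apply: cmeasurableM => //; apply: (cmeasurable_comp mF); exact: measurable_snd.
Qed.

Lemma kernel_op_le F : cL2 mu F ->
  (\int[mu]_p (nsq (kernel_op F p))%:E <=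
   (\int[mu]_p \int[mu]_q (nsq (k (p, q)))%:E) * \int[mu]_q (nsq (F q))%:E)%E.
Proof.
move=> cF; rewrite -(N2E cF) muleC.
have NF0 : 0 <= N2 mu F by rewrite -lee_fin N2E// nsq_integral_ge0.
rewrite -(ge0_integralZT mu mnk (fun p => nsq_integral_ge0 mu _) NF0).
apply: ae_ge0_le_integral.
- exact: measurableT.
- by move=> p _; rewrite lee_fin nsq_ge0.
- by apply: measurable_EFin_nsq; apply: cmeasurable_kernel_op; case: cF.
- by move=> p _; apply: mule_ge0; [rewrite lee_fin|exact: nsq_integral_ge0].
- exact: measurable_funeM.
- apply: ae_mono ae_kernel_cL2 => p cp _.
  by rewrite muleC (N2E cF); exact: nsq_cintegralM_le.
Qed.

Lemma cL2_kernel_op F : cL2 mu F -> cL2 mu (kernel_op F).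
Proof.
move=> cF; split; first by apply: cmeasurable_kernel_op; case: cF.
apply: le_lt_trans (kernel_op_le cF) _; apply: lte_mul_pinfty.
- by apply: integral_ge0 => p _; exact: nsq_integral_ge0.
- by rewrite ge0_fin_numE//; apply: integral_ge0 => p _; exact: nsq_integral_ge0.
- by case: cF.
Qed.

Lemma kernel_op_linear (a : R[i]) F G : cL2 mu F -> cL2 mu G ->
  {ae mu, forall p, kernel_op (fun q => a * F q + G q) p = a * kernel_op F p + kernel_op G p}.
Proof.
move=> cF cG; apply: ae_mono ae_kernel_cL2 => p cp.
have iF := cintegrableM cp cF; have iG := cintegrableM cp cG.
rewrite /kernel_op -(cintegralZ _ iF) -(cintegralD (cintegrableZ a iF) iG).
by apply: eq_cintegral => q; rewrite mulrDr mulrCA.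
Qed.

(** At fixed [p] the value of the operator on [e j] is, up to conjugation, the [j]-th coefficient of
    the conjugate of [k (p, .)]. Parseval in [q] sums the squares over [j], and the sum passes
    through the integral over [p]. *)
Lemma kernel_op_hs (e : nat -> T -> R[i]) : (forall j, cL2 mu (e j)) ->
  (forall F, cL2 mu F ->
     (\sum_(j <oo) (nsq (ip mu F (e j)))%:E = \int[mu]_x (nsq (F x))%:E)%E) ->
  (\sum_(j <oo) \int[mu]_p (nsq (kernel_op (e j) p))%:E =
   \int[mu]_p \int[mu]_q (nsq (k (p, q)))%:E)%E.
Proof.
move=> ce pars.
have mS j : mfunT (fun p => (nsq (kernel_op (e j) p))%:E).
  by apply: measurable_EFin_nsq; apply: cmeasurable_kernel_op; case: (ce j).
rewrite -integral_nneseries//; last first.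
  by move=> j p _; rewrite lee_fin nsq_ge0.
apply: ae_eq_integral.
- exact: measurableT.
- by apply: ge0_emeasurable_sum => // j p _ _; rewrite lee_fin nsq_ge0.
- exact: mnk.
- apply: ae_mono ae_kernel_cL2 => p cp _.
  have E : (\int[mu]_q (nsq (k (p, q)))%:E = \int[mu]_q (nsq ((k (p, q))^*))%:E)%E.
    by apply: eq_integral => q _; rewrite nsqJ.
  rewrite E -(pars _ (cL2J cp)); apply: eq_eseriesr => j _; congr EFin.
  rewrite -[LHS]nsqJ /kernel_op /ip -cintegralJ; last exact: cintegrableM.
  by congr nsq; apply: eq_cintegral => q; exact: rmorphM.
Qed.

End integral_operator.

(** * The Hilbert space L^2(K, L^2(R^* )) *)

Section sigma_finiteness.
Context (R : realType).
Local Notation RL := (measurableTypeR R).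
Local Notation amb := ('cV[R]_2 * 'M[R]_2)%type.

Let cV2_sigma_finite : sigma_finite setT (@lebesgue_cV2 R).
Proof.
pose g (x : 'cV[R]_2) : RL * RL := (x 0 0, x 1 0).
have mg : mfunT g.
  by apply: measurable_fun_pair; exact: measurable_entry.
by apply: (pushforward_sigma_finite (@lebesgue2 R) mg) => -[a b]; rewrite /g !mxE.
Qed.

HB.instance Definition _ := Measure_isSigmaFinite.Build _ _ _ (@lebesgue_cV2 R)
  cV2_sigma_finite.

Let rV2_sigma_finite : sigma_finite setT (@lebesgue_rV2 R).
Proof.
pose g (x : 'rV[R]_2) : RL * RL := (x 0 0, x 0 1).
have mg : mfunT g.
  by apply: measurable_fun_pair; exact: measurable_entry.
by apply: (pushforward_sigma_finite (@lebesgue2 R) mg) => -[a b]; rewrite /g !mxE.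
Qed.

HB.instance Definition _ := Measure_isSigmaFinite.Build _ _ _ (@lebesgue_rV2 R)
  rV2_sigma_finite.

Let orow_sigma_finite : sigma_finite setT (@mu_orow R).
Proof.
apply: density_sigma_finite.
- exact: measurable_orow.
- apply: measurable_inv_ge0 => [w|]; [exact: sqr_ge0|exact: measurable_enorm_sqr].
- by move=> w; rewrite invr_ge0 sqr_ge0.
Qed.

HB.instance Definition _ := Measure_isSigmaFinite.Build _ _ _ (@mu_orow R)
  orow_sigma_finite.

Lemma measurable_gammaV : mfunT (fun g : amb => gammaV g.2).
Proof.
have me (i j : 'I_2) : mfunT (fun g : amb => g.2 i j) by measurability.
have mi : mfunT (fun g : amb => (g.2 0 0 ^+ 2 + g.2 1 0 ^+ 2)^-1) by measurability.
apply: measurable_fun_mx => i j.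
have -> : (fun g : amb => gammaV g.2 i j) = (fun g => (g.2 0 0 ^+ 2 + g.2 1 0 ^+ 2)^-1 *
    (if j == 0 then g.2 0 0 else g.2 1 0)).
  by apply/funext => g; rewrite /gammaV !mxE.
apply: measurable_funM; first exact: mi.
by case: (j == 0); exact: me.
Qed.

(** The zero row is included, since [gamma] and [gammaV] both send zero to zero. A left inverse on
    the whole space is what sigma-finiteness of the pushforward [mu_K] needs. *)
Lemma gammaVK_all : cancel (@kgamma R) (fun g : amb => gammaV g.2).
Proof.
move=> w; rewrite /kgamma /=; have [->|w0] := eqVneq w 0; last exact: gammaK.
rewrite /gammaV gammaE !mxE/= mul0r expr0n addr0 invr0 scale0r.
by [].
Qed.

Let K_sigma_finite : sigma_finite setT (@mu_K R).
Proof. exact: (pushforward_sigma_finite (@mu_orow R) measurable_gammaV gammaVK_all). Qed.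

HB.instance Definition _ := Measure_isSigmaFinite.Build _ _ _ (@mu_K R)
  K_sigma_finite.

Let Rstar_sigma_finite : sigma_finite setT (@mu_Rstar R).
Proof.
apply: density_sigma_finite.
- exact: measurable_Rstar.
- by measurability.
- by move=> t; rewrite invr_ge0.
Qed.

HB.instance Definition _ := Measure_isSigmaFinite.Build _ _ _ (@mu_Rstar R)
  Rstar_sigma_finite.

(** A name for the product measure, to which the sigma-finite instance is attached; [mu_X] and
    [leb3] are introduced for the same reason. *)
Definition cV2GL2 : set amb -> \bar R := (@lebesgue_cV2 R \x @mu_GL2 R)%E.

HB.instance Definition _ := Measure.copy cV2GL2 (@lebesgue_cV2 R \x @mu_GL2 R)%E.

Let cV2GL2_sigma_finite : sigma_finite setT cV2GL2.
Proof. exact: product_sigma_finite. Qed.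

HB.instance Definition _ := Measure_isSigmaFinite.Build _ _ _ cV2GL2
  cV2GL2_sigma_finite.

Let G2_sigma_finite : sigma_finite setT (@mu_G2 R).
Proof.
have mw : mfunT (fun g : amb => `|\det g.2|^-1) by measurability.
have w0 (g : amb) : 0 <= `|\det g.2|^-1 by rewrite invr_ge0.
exact: (@density_sigma_finite _ _ _ cV2GL2 _ _ (@measurable_G2 R) mw w0).
Qed.

HB.instance Definition _ := Measure_isSigmaFinite.Build _ _ _ (@mu_G2 R)
  G2_sigma_finite.

Definition mu_X : set (amb * RL) -> \bar R := (@mu_K R \x @mu_Rstar R)%E.

HB.instance Definition _ := Measure.copy mu_X (@mu_K R \x @mu_Rstar R)%E.

Let X_sigma_finite : sigma_finite setT mu_X.
Proof. exact: product_sigma_finite. Qed.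

HB.instance Definition _ := Measure_isSigmaFinite.Build _ _ _ mu_X X_sigma_finite.

End sigma_finiteness.

Section hilbert_space.
Context (R : realType).
Local Notation RL := (measurableTypeR R).
Local Notation amb := ('cV[R]_2 * 'M[R]_2)%type.
Local Notation mK := (@mu_K R).
Local Notation mR := (@mu_Rstar R).
Local Notation m := (@mu_X R).
Implicit Types F G : hfun R.

Definition unc F (p : amb * RL) : R[i] := F p.1 p.2.

Let n0 (h : amb * RL -> R[i]) z : (0 <= (nsq (h z))%:E)%E.
Proof. by rewrite lee_fin nsq_ge0. Qed.

Lemma integral_nsq_unc F : cmeasurable (unc F) ->
  (\int[mK]_k \int[mR]_t (nsq (F k t))%:E = \int[m]_p (nsq (unc F p))%:E)%E.
Proof.
move=> mF; exact: (esym (@fubini_tonelli1 _ _ _ _ R mK mR _ (measurable_EFin_nsq mF) (n0 (unc F)))).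
Qed.

Lemma cnorm2_sqr d (T : measurableType d) (mu : {measure set T -> \bar R}) (f : T -> R[i]) :
  (cnorm mu 2%:E f `^ 2 = \int[mu]_x (nsq (f x))%:E)%E.
Proof.
rewrite /cnorm poweR_Lnorm ?pnatr_eq0//; apply: eq_integral => x _ /=.
by rewrite ger0_norm ?normc_ge0// powR_mulrn ?normc_ge0// sqr_normc.
Qed.

Lemma hnorm_sqr F : cmeasurable (unc F) ->
  (hnorm F `^ 2 = \int[m]_p (nsq (unc F p))%:E)%E.
Proof.
move=> mF; rewrite /hnorm poweR_Lnorm ?pnatr_eq0// -integral_nsq_unc//.
apply: eq_integral => k _; rewrite gee0_abs ?Lnorm_ge0//; exact: cnorm2_sqr.
Qed.

Lemma hnormE F : cmeasurable (unc F) ->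
  (hnorm F = (\int[m]_p (nsq (unc F p))%:E) `^ 2^-1)%E.
Proof.
by move=> mF; rewrite -hnorm_sqr// -poweRrM mulfV ?pnatr_eq0// poweRe1// Lnorm_ge0.
Qed.

(** By Tonelli the iterated norm is the norm of L^2 for the product measure [mu_X]; from here on the
    Hilbert space is handled in this uncurried form. *)
Lemma hspaceP F : hspace F <-> cL2 m (unc F).
Proof.
split=> -[mF h]; split=> //.
- by rewrite -hnorm_sqr//; exact: poweR_lty.
- by rewrite hnormE//; exact: poweR_lty.
Qed.

Lemma hinnerE F G : hspace F -> hspace G -> hinner F G = ip m (unc F) (unc G).
Proof.
move=> /hspaceP cF /hspaceP cG; rewrite /ip.
have [mf f1] := cintegrable_ip cF cG.
rewrite -(cintegral_prod1 mf)//; move: f1; rewrite fubini_tonelli1//.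
- by measurability.
- by move=> z; rewrite lee_fin normc_ge0.
Qed.

Lemma ge0_ae_eq0 d (T : measurableType d) (mu : {measure set T -> \bar R}) (f : T -> \bar R) :
  mfunT f -> (forall x, 0 <= f x)%E -> (\int[mu]_x f x = 0)%E ->
  {ae mu, forall x, f x = 0%E}.
Proof.
move=> mf f0 h; have : ae_eq mu setT f (cst 0%E).
  apply/(ae_eq_integral_abs _ measurableT mf); rewrite -[RHS]h.
  by apply: eq_integral => x _; rewrite gee0_abs.
by apply: ae_mono => x /(_ I).
Qed.

Lemma heq_integral0 F G : cmeasurable (unc F) -> cmeasurable (unc G) ->
  (\int[m]_p (nsq (unc F p - unc G p))%:E = 0)%E -> heq F G.
Proof.
move=> mF mG; have mB : cmeasurable (unc (fun k t => F k t - G k t)) by exact: (cmeasurableB mF mG).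
rewrite -(integral_nsq_unc mB) => h0.
have mI : mfunT (fun k => \int[mR]_t (nsq (F k t - G k t))%:E)%E.
  exact: (measurable_integral1 mR (measurable_EFin_nsq mB) (n0 _)).
have := ge0_ae_eq0 mI (fun k => nsq_integral_ge0 mR _) h0.
apply: ae_mono => k hk.
have mk : mfunT (fun t : RL => (nsq (F k t - G k t))%:E).
  exact: measurable_EFin_nsq (cmeasurable_section1 k mB).
have nk (t : RL) : (0 <= (nsq (F k t - G k t))%:E)%E by rewrite lee_fin nsq_ge0.
apply: ae_mono (ge0_ae_eq0 mk nk hk) => t [] /eqP.
by rewrite nsq_eq0 subr_eq0 => /eqP.
Qed.

Lemma heq_ae F G : cmeasurable (unc F) -> cmeasurable (unc G) ->
  {ae m, forall p, unc F p = unc G p} -> heq F G.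
Proof.
move=> mF mG h; apply: heq_integral0 => //.
rewrite -[RHS](integral0 m setT); apply: ae_eq_integral.
- exact: measurableT.
- by apply: measurable_EFin_nsq; exact: cmeasurableB.
- exact: measurable_cst.
- by apply: ae_mono h => p -> _; rewrite subrr nsq0.
Qed.

Lemma heq_trans F G H : heq F G -> heq G H -> heq F H.
Proof.
move=> h1 h2; apply: ae_mono (ae_and h1 h2) => k [k1 k2].
by apply: ae_mono (ae_and k1 k2) => t [-> ->].
Qed.

Lemma heq_sym F G : heq F G -> heq G F.
Proof. by apply: ae_mono => k; apply: ae_mono => t ->. Qed.

Lemma hnorm_le (a : R) F G : 0 <= a -> cmeasurable (unc F) -> cmeasurable (unc G) ->
  (\int[m]_p (nsq (unc F p))%:E <= (a ^+ 2)%:E * \int[m]_p (nsq (unc G p))%:E)%E ->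
  (hnorm F <= a%:E * hnorm G)%E.
Proof.
move=> a0 mF mG h; rewrite !hnormE//.
have -> : (a%:E = (a ^+ 2)%:E `^ 2^-1)%E.
  by rewrite poweR_EFin -powR_mulrn// -powRrM mulfV ?pnatr_eq0// powRr1.
rewrite -poweRM ?lee_fin ?sqr_ge0//; last exact: nsq_integral_ge0.
have r0 : 0 <= 2^-1 :> R by rewrite invr_ge0.
have i0 G' : (\int[m]_p (nsq (unc G' p))%:E)%E \in `[0%E, +oo%E].
  by rewrite in_itv/= nsq_integral_ge0 leey.
apply: (gt0_ler_poweR r0) => //.
by rewrite in_itv/= leey andbT; apply: mule_ge0; [rewrite lee_fin sqr_ge0|exact: nsq_integral_ge0].
Qed.

(** Test against [F - G]. This makes [sigmaL1], known only by its matrix coefficients, unique up to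
    [heq]. *)
Lemma hspace_eq_weak F G : hspace F -> hspace G ->
  (forall eta, hspace eta -> hinner F eta = hinner G eta) -> heq F G.
Proof.
move=> hF hG h; have cF := (hspaceP F).1 hF; have cG := (hspaceP G).1 hG.
pose D : hfun R := fun k t => F k t - G k t.
have cD : cL2 m (unc D) by exact: (cL2B cF cG).
have hD : hspace D by exact/hspaceP.
apply: heq_integral0; [by case: cF|by case: cG|].
have cNG := cL2Z (-1) cG.
have E : ip m (unc D) (unc D) = 0.
  have -> : ip m (unc D) (unc D) = ip m (unc F) (unc D) + -1 * ip m (unc G) (unc D).
    rewrite -(ipZl _ cG cD) -(ipDl cF cNG cD).
    by congr ip; apply/funext => p; rewrite /unc /D mulN1r.
  by rewrite -!hinnerE// h// mulN1r subrr.
by have := N2E cD; rewrite -(ip_self cD) E /= => <-.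
Qed.

End hilbert_space.

(** * Integration in coordinates *)

(** The weights in use are inverses of quantities that vanish off [D]. With 0 as inverse of 0, the
    weight itself does the restriction to [D]. *)
Lemma densityT d (T : measurableType d) (R : realType) (mu : {measure set T -> \bar R})
    (D A : set T) (w : T -> R) : (forall x, ~ D x -> w x = 0) ->
  (density mu D w A = \int[mu]_(x in A) (w x)%:E)%E.
Proof.
move=> wD; rewrite /density setIC integral_mkcondr; apply: eq_integral => x _.
rewrite patchE; case: ifPn => // xD; rewrite wD//.
by move=> Dx; move/negP: xD; apply; rewrite inE.
Qed.

Section coordinates.
Context (R : realType).
Local Notation leb := (@lebesgue_measure R).
Local Notation RL := (measurableTypeR R).
Local Notation P := (RL * RL)%type.
Local Notation amb := ('cV[R]_2 * 'M[R]_2)%type.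
Local Notation leb2 := (@lebesgue2 R).
Local Notation mK := (@mu_K R).
Local Notation mR := (@mu_Rstar R).

Definition sqn (w : P) : R := w.1 ^+ 2 + w.2 ^+ 2.

Lemma sqn_ge0 w : 0 <= sqn w.
Proof. by rewrite addr_ge0 ?sqr_ge0. Qed.

Lemma measurable_sqn : mfunT sqn.
Proof. by apply: measurable_funD; [apply: measurable_funX; exact: measurable_fst|apply: measurable_funX; exact: measurable_snd]. Qed.

Lemma sqn_eq0 w : (sqn w == 0) = (w == (0, 0)).
Proof. by case: w => a b; rewrite /sqn paddr_eq0 ?sqr_ge0// !sqrf_eq0. Qed.

Lemma enorm_mkrow w : enorm (mkrow w) ^+ 2 = sqn w.
Proof. by rewrite enorm_sqr /sqn !mxE. Qed.

Lemma mkrow_eq0 (w : P) : (mkrow w == 0 :> 'rV[R]_2) = (w == (0, 0)).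
Proof. by rewrite -sqn_eq0 -enorm_mkrow sqrf_eq0 enorm_eq0. Qed.

Lemma ge0_integral_leb2 (phi : P -> \bar R) : mfunT phi ->
  (forall p, 0 <= phi p)%E ->
  (\int[leb2]_p phi p = \int[leb]_x \int[leb]_y phi (x, y))%E.
Proof. by move=> mphi phi0; exact: (@fubini_tonelli1 _ _ _ _ R leb leb phi mphi phi0). Qed.

Lemma ge0_integral_leb2_affine (a b c e g h : R) (phi : P -> \bar R) :
  a * e - b * c != 0 -> mfunT phi -> (forall p, 0 <= phi p)%E ->
  (\int[leb2]_p phi p = `|a * e - b * c|%:E *
    \int[leb2]_p phi (a * p.1 + b * p.2 + g, c * p.1 + e * p.2 + h)%R)%E.
Proof.
move=> D0 mphi phi0; rewrite ge0_integral_leb2// (ge0_integral_affine2 g h D0)//.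
congr (_ * _)%E; rewrite ge0_integral_leb2//.
by apply: (measurableT_comp mphi); exact: (measurable_affine2 a b c e g h).
Qed.

Lemma ge0_integral_Rstar (phi : RL -> \bar R) : mfunT phi ->
  (forall t, 0 <= phi t)%E ->
  (\int[mR]_t phi t = \int[leb]_t (phi t * (`|t|^-1)%:E))%E.
Proof.
move=> mphi phi0.
have mw : mfunT (fun t : RL => `|t|^-1) by measurability.
have w0 (t : RL) : 0 <= `|t|^-1 by rewrite invr_ge0.
apply: (ge0_integral_density (mu := leb) (nu := mR) mw w0) => // A mA.
apply: densityT => t /negP; rewrite negbK => /eqP ->.
by rewrite normr0 invr0.
Qed.

Lemma ge0_integral_K (phi : amb -> \bar R) : mfunT phi ->
  (forall k, 0 <= phi k)%E ->
  (\int[mK]_k phi k = \int[leb2]_w (phi (kgamma (mkrow w)) * ((sqn w)^-1)%:E))%E.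
Proof.
move=> mphi phi0.
have mk : mfunT (phi \o @kgamma R).
  by apply: measurableT_comp => //; exact: measurable_kgamma.
rewrite /mu_K (@ge0_integral_pushforward _ _ _ _ _ _ (@measurable_kgamma R) _ setT) ?preimage_setT//.
have mw : mfunT (fun w : 'rV[R]_2 => (enorm w ^+ 2)^-1).
  by apply: measurable_inv_ge0 => [w|]; [exact: sqr_ge0|exact: measurable_enorm_sqr].
have w0 (w : 'rV[R]_2) : 0 <= (enorm w ^+ 2)^-1 by rewrite invr_ge0 sqr_ge0.
rewrite (ge0_integral_density (mu := @lebesgue_rV2 R) (nu := @mu_orow R) mw w0 _ mk (fun w => phi0 _)); last first.
  move=> A mA; apply: densityT => w /negP; rewrite negbK => /eqP ->.
  by rewrite enorm_sqr !mxE expr0n addr0 invr0.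
rewrite /lebesgue_rV2 (@ge0_integral_pushforward _ _ _ _ _ _ (@measurable_mkrow R) _ setT) ?preimage_setT//.
- by apply: eq_integral => w _ /=; rewrite enorm_mkrow.
- by measurability.
- by move=> w _; rewrite mule_ge0 ?lee_fin ?invr_ge0 ?sqr_ge0//; exact: phi0.
Qed.

(* Density of [mu_G2] in the entries: [|det|^-2] from [mu_GL2] times [|det|^-1]. *)
Definition dens (a : P * P) : R := (`|\det (mkmx a)| ^+ 3)^-1.

Lemma dens_ge0 a : 0 <= dens a.
Proof. by rewrite invr_ge0 exprn_ge0. Qed.

Lemma measurable_dens : mfunT dens.
Proof.
apply: measurable_inv_ge0 => [a|]; first exact: exprn_ge0.
apply: measurable_funX; apply: measurableT_comp; first exact: normr_measurable.
exact: (measurableT_comp (@measurable_det2 R) (@measurable_mkmx R)).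
Qed.

Lemma measurable_mkG2 d (T : measurableType d) (x : T -> P) (a : T -> P * P) :
  mfunT x -> mfunT a ->
  mfunT (fun z => (mkcol (x z), mkmx (a z)) : amb).
Proof. by measurability. Qed.

Lemma ge0_integral_G2 (phi : amb -> \bar R) : mfunT phi ->
  (forall g, 0 <= phi g)%E ->
  (\int[@mu_G2 R]_g phi g = \int[@lebesgue4 R]_a
     ((dens a)%:E * \int[leb2]_x phi (mkcol x, mkmx a)))%E.
Proof.
move=> mphi phi0.
have mxd : mfunT (fun z : P * (P * P) => phi (mkcol z.1, mkmx z.2)) by measurability.
have mxp : mfunT (fun z : P * (P * P) => phi (mkcol z.1, mkmx z.2) * (dens z.2)%:E)%E.
  apply: emeasurable_funM => //; apply/measurable_EFinP.
  exact: (measurableT_comp measurable_dens measurable_snd).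
have xp0 (x : P) (a : P * P) : (0 <= phi (mkcol x, mkmx a) * (dens a)%:E)%E.
  by apply: mule_ge0; [exact: phi0|rewrite lee_fin dens_ge0].
transitivity (\int[leb2]_x \int[@lebesgue4 R]_a (phi (mkcol x, mkmx a) * (dens a)%:E))%E; last first.
  rewrite (@tonelli _ _ _ _ R leb2 (@lebesgue4 R) (fun x a => phi (mkcol x, mkmx a) * (dens a)%:E)%E mxp xp0).
  apply: eq_integral => a _; rewrite muleC.
  exact: (ge0_integralZTr leb2 (measurable_fun_pair1 a mxd) (fun _ => phi0 _) (dens_ge0 a)).
have md : mfunT (fun g : amb => \det g.2) by measurability.
have mw : mfunT (fun g : amb => `|\det g.2|^-1) by measurability.
have mw2 : mfunT (fun A : 'M[R]_2 => (`|\det A| ^+ 2)^-1) by measurability.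
have w0 (g : amb) : 0 <= `|\det g.2|^-1 by rewrite invr_ge0.
rewrite (ge0_integral_density (mu := @cV2GL2 R) (nu := @mu_G2 R) mw w0 _ mphi phi0); last first.
  move=> A mA; apply: (@densityT _ _ _ (@cV2GL2 R)) => g.
  rewrite /G2 /GL2/= unitmxE unitfE => /negP; rewrite negbK => /eqP ->.
  by rewrite normr0 invr0.
have mphiw : mfunT (fun g : amb => phi g * (`|\det g.2|^-1)%:E)%E by measurability.
have phiw0 g : (0 <= phi g * (`|\det g.2|^-1)%:E)%E.
  by rewrite mule_ge0// lee_fin invr_ge0.
transitivity (\int[@lebesgue_cV2 R]_x \int[@mu_GL2 R]_A (phi (x, A) * (`|\det A|^-1)%:E))%E.
  exact: (@fubini_tonelli1 _ _ _ _ R (@lebesgue_cV2 R) (@mu_GL2 R) _ mphiw phiw0).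
have mi : mfunT (fun x => \int[@mu_GL2 R]_A (phi (x, A) * (`|\det A|^-1)%:E))%E.
  exact: (measurable_integral1 (@mu_GL2 R) mphiw phiw0).
have i0 x : (0 <= \int[@mu_GL2 R]_A (phi (x, A) * (`|\det A|^-1)%:E))%E.
  by apply: integral_ge0 => A _; exact: (phiw0 (x, A)).
rewrite /lebesgue_cV2 (@ge0_integral_pushforward _ _ _ _ _ _ (@measurable_mkcol R) _ setT) ?preimage_setT//.
apply: eq_integral => x _ /=.
have mxA : mfunT (fun A : 'M[R]_2 => phi (mkcol x, A) * (`|\det A|^-1)%:E)%E.
  exact: (measurable_fun_pair2 (mkcol x) mphiw).
have w20 (A : 'M[R]_2) : 0 <= (`|\det A| ^+ 2)^-1 by rewrite invr_ge0 sqr_ge0.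
rewrite (ge0_integral_density (mu := @lebesgue_M2 R) (nu := @mu_GL2 R) mw2 w20 _ mxA (fun A => phiw0 (mkcol x, A))); last first.
  move=> B mB; apply: densityT => A.
  rewrite /GL2/= unitmxE unitfE => /negP; rewrite negbK => /eqP ->.
  by rewrite normr0 expr0n invr0.
rewrite /lebesgue_M2 (@ge0_integral_pushforward _ _ _ _ _ _ (@measurable_mkmx R) _ setT) ?preimage_setT//.
- apply: eq_integral => a _ /=; rewrite -muleA -EFinM -invfM /dens.
  by rewrite -exprS.
- by measurability.
- by move=> A _; rewrite mule_ge0 ?lee_fin ?invr_ge0 ?sqr_ge0//; exact: (phiw0 (mkcol x, A)).
Qed.

Lemma ge0_integral_Rstar_scale (a : R) (phi : RL -> \bar R) : a != 0 ->
  mfunT phi -> (forall t, 0 <= phi t)%E ->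
  (\int[mR]_t phi (a * t)%R = \int[mR]_t phi t)%E.
Proof.
move=> a0 mphi phi0.
have ms : mfunT (fun t : RL => (`|t|^-1)%:E) by measurability.
have mphi' : mfunT (fun t : RL => phi t * (`|t|^-1)%:E)%E by measurability.
have phi'0 (t : RL) : (0 <= phi t * (`|t|^-1)%:E)%E by rewrite mule_ge0// lee_fin invr_ge0.
have msc : mfunT (fun t : RL => phi (a * t)%R).
  by apply: (measurableT_comp mphi); apply: measurable_funM => //; exact: measurable_cst.
have mat : mfunT (fun t : RL => a * t : RL) by measurability.
have mA : mfunT (fun t : RL => phi (a * t)%R * (`|a * t|^-1)%:E)%E by measurability.
rewrite (ge0_integral_Rstar msc (fun t => phi0 _)) (ge0_integral_Rstar mphi phi0).
rewrite (ge0_integral_scale a0 mphi' phi'0).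
rewrite -(ge0_integralZT leb mA (fun t => phi'0 (a * t)%R) (normr_ge0 a)).
apply: eq_integral => t _; rewrite muleCA -EFinM normrM invfM mulrA divff ?mul1r//.
by rewrite normr_eq0.
Qed.

(* Uniqueness of Haar measure: integrate [phi (t^-1) * psi s] over the square
   and shear twice; [psi] is the indicator of a set of finite positive mass. *)
Lemma ge0_integral_Rstar_inv (phi : RL -> \bar R) :
  mfunT phi -> (forall t, 0 <= phi t)%E ->
  (\int[mR]_t phi (t^-1)%R = \int[mR]_t phi t)%E.
Proof.
move=> mphi phi0.
pose B : set RL := `[1%R, 2%R]%classic.
have mB : measurable B by exact: measurable_itv.
pose psi (s : RL) : \bar R := (\1_B s)%:E.
have mpsi : mfunT psi by apply/measurable_EFinP; exact: measurable_indic.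
have psi0 s : (0 <= psi s)%E by rewrite lee_fin.
have psiE : (\int[mR]_s psi s = mR B)%E by rewrite /psi integral_indic ?setIT.
have mRB : (mR B = \int[leb]_(t in B) (`|t|^-1)%:E)%E.
  apply: densityT => t /negP; rewrite negbK => /eqP ->; by rewrite normr0 invr0.
have lB : leb B = 1%E.
  by rewrite /B lebesgue_measure_itv/= lte_fin ltr1n -EFinB; congr EFin; ring.
have mabs : measurable_fun B (fun t : RL => (`|t|^-1)%:E).
  by apply: measurable_funTS; apply/measurable_EFinP; apply: measurable_inv_ge0 => [t|]; [exact: normr_ge0|exact: normr_measurable].
have inv0 (t : RL) : (0 <= (`|t|^-1)%:E)%E by rewrite lee_fin invr_ge0.
have cst1 (r : R) : measurable_fun B (fun _ : RL => r%:E) by exact: measurable_cst.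
have cstE (r : R) : (r%:E = \int[leb]_(t in B) r%:E)%E.
  apply/esym; apply: eq_trans (integral_cst leb mB r%:E) _.
  by apply: eq_trans (congr1 (fun z => r%:E * z)%E lB) _; exact: mule1.
(* The mass of [B] is the logarithm of 2; the bounds 1/2 and 1 are enough to divide by it. *)
have B1 : (mR B <= 1)%E.
  rewrite mRB [X in (_ <= X)%E]cstE.
  apply: ge0_le_integral; [exact: mB|by move=> t _; exact: inv0|exact: mabs|exact: cst1|].
  move=> t; rewrite /B/= in_itv/= => /andP[t1 t2]; have t0 := lt_le_trans ltr01 t1.
  by rewrite lee_fin (gtr0_norm t0) invf_le1.
have B2 : ((2^-1)%:E <= mR B)%E.
  rewrite mRB [X in (X <= _)%E]cstE.
  apply: ge0_le_integral; [exact: mB| |exact: cst1|exact: mabs|].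
    by move=> t _; rewrite lee_fin invr_ge0.
  move=> t; rewrite /B/= in_itv/= => /andP[t1 t2]; have t0 := lt_le_trans ltr01 t1.
  by rewrite lee_fin (gtr0_norm t0) lef_pV2 ?posrE.
have [c [c0 cE]] : exists c : R, 0 < c /\ mR B = c%:E.
  exists (fine (mR B)); split.
    by rewrite fine_gt0// (lt_le_trans _ B2) ?lte_fin ?invr_gt0// (le_lt_trans B1) ?ltry.
  by rewrite fineK// ge0_fin_numE ?measure_ge0// (le_lt_trans B1) ?ltry.
suff key : (\int[mR]_t phi (t^-1)%R * c%:E = \int[mR]_t phi t * c%:E)%E.
  have c1 : (c%:E * (c^-1)%:E = 1)%E by rewrite -EFinM divff// gt_eqF.
  by have := congr1 (fun z => z * (c^-1)%:E)%E key; rewrite -!muleA c1 !mule1.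
rewrite -cE -psiE.
have minv : mfunT (fun t : RL => phi (t^-1)%R) by measurability.
have cR : c%:E = (\int[mR]_s psi s)%E by rewrite psiE cE.
have prodE (f1 f2 : RL -> \bar R) : mfunT f1 -> (forall x, 0 <= f1 x)%E ->
    mfunT f2 -> (forall x, 0 <= f2 x)%E -> (\int[mR]_s f2 s = c%:E)%E ->
   (\int[mR]_t f1 t * \int[mR]_s f2 s = \int[mR]_t \int[mR]_s (f1 t * f2 s))%E.
  move=> m1 p1 m2 p2 fc; rewrite fc muleC -(ge0_integralZT mR m1 p1 (ltW c0)).
  apply: eq_integral => t _; rewrite -fc muleC ge0_integralZl//.
have mst (f1 f2 : P -> R) : mfunT f1 -> mfunT f2 ->
    mfunT (fun z : P => phi (f1 z) * psi (f2 z))%E by measurability.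
have pp0 (a b : RL) : (0 <= phi a * psi b)%E by exact: mule_ge0.
have mf1 : mfunT (fst : P -> RL) := measurable_fst.
have mf2 : mfunT (snd : P -> RL) := measurable_snd.
have mi1 : mfunT (fun z : P => z.1^-1) by measurability.
(* The density of [mu_Rstar] vanishes at 0, so integrands may be compared away from 0 only, where
   the shears are invertible. *)
have nz (Q1 Q2 : RL -> \bar R) : mfunT Q1 -> mfunT Q2 ->
   (forall t, 0 <= Q1 t)%E -> (forall t, 0 <= Q2 t)%E ->
   (forall t : R, t != 0 -> Q1 t = Q2 t) -> (\int[mR]_t Q1 t = \int[mR]_t Q2 t)%E.
  move=> m1 m2 p1 p2 E; rewrite !ge0_integral_Rstar//; apply: eq_integral => t _.
  have [->|t0] := eqVneq t (0 : R); first by rewrite normr0 invr0 !mule0.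
  by rewrite E.
have psic := etrans psiE cE.
rewrite (prodE _ _ minv (fun t => phi0 _) mpsi psi0 psic) (prodE _ _ mphi phi0 mpsi psi0 psic).
have mA : mfunT (fun z : P => phi (z.1^-1)%R * psi z.2)%E by exact: mst.
have mB' : mfunT (fun z : P => phi (z.1^-1)%R * psi (z.1 * z.2)%R)%E by measurability.
have mC : mfunT (fun z : P => phi (z.2 / z.1)%R * psi z.1)%E by measurability.
have mD : mfunT (fun z : P => phi z.1 * psi z.2)%E by exact: mst.
(* [s := t s], then [t := t / s], then [s := t s] again *)
transitivity (\int[mR]_t \int[mR]_s (phi (t^-1)%R * psi (t * s)%R))%E.
  apply: nz => [||t|t|t t0].
  - exact: (measurable_integralr mR mA (fun _ _ => pp0 _ _)).
  - exact: (measurable_integralr mR mB' (fun _ _ => pp0 _ _)).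
  - by apply: integral_ge0.
  - by apply: integral_ge0.
  - rewrite (@ge0_integral_Rstar_scale t (fun s => phi (t^-1)%R * psi s)%E)//.
    exact: (measurable_fun_pair2 t mA).
rewrite (@tonelli _ _ _ _ R mR mR (fun t s => phi (t^-1)%R * psi (t * s)%R)%E mB' (fun _ _ => pp0 _ _)).
transitivity (\int[mR]_s \int[mR]_t (phi (s / t)%R * psi t))%E.
  have mC' : mfunT (fun z : P => phi (z.1 / z.2)%R * psi z.2)%E by measurability.
  apply: nz => [||s|s|s s0].
  - exact: (measurable_integrall mR mB' (fun _ _ => pp0 _ _)).
  - exact: (measurable_integralr mR mC' (fun _ _ => pp0 _ _)).
  - by apply: integral_ge0.
  - by apply: integral_ge0.
  - rewrite -(@ge0_integral_Rstar_scale s (fun t => phi (s / t)%R * psi t)%E)//; last first.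
      exact: (measurable_fun_pair2 s mC').
    apply: eq_integral => t _; rewrite (mulrC s t); congr (phi _ * _)%E.
    by rewrite invfM mulrCA divff// mulr1.
rewrite (@tonelli _ _ _ _ R mR mR (fun s t => phi (s / t)%R * psi t)%E); last 2 first.
- by measurability.
- by move=> s t; exact: pp0.
rewrite [RHS](@tonelli _ _ _ _ R mR mR (fun t s => phi t * psi s)%E mD (fun _ _ => pp0 _ _)).
apply: nz => [||t|t|t t0].
- exact: (measurable_integralr mR mC (fun _ _ => pp0 _ _)).
- exact: (measurable_integrall mR mD (fun _ _ => pp0 _ _)).
- by apply: integral_ge0.
- by apply: integral_ge0.
- under eq_integral do rewrite mulrC.
  rewrite (@ge0_integral_Rstar_scale t^-1 (fun s => phi s * psi t)%E) ?invr_eq0//.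
  exact: (measurable_fun_pair1 t mD).
Qed.

End coordinates.

Ltac measurable_hook ::= match goal with
  | |- measurable_fun _ (fun _ => sqn _) => apply: (measurableT_comp (@measurable_sqn _))
  | |- measurable_fun _ (fun _ => dens _) => apply: (measurableT_comp (@measurable_dens _))
  end.

(** * Plancherel on the plane *)

Section plancherel2.
Context (R : realType).
Local Notation leb := (@lebesgue_measure R).
Local Notation RL := (measurableTypeR R).
Local Notation P := (RL * RL)%type.
Local Notation leb2 := (@lebesgue2 R).
Local Notation normc := (@Normc.normc R).
Variable c : R.
Hypothesis integral_ck : (\int[leb]_x (cauchy_kernel c x)%:E = 1)%E.

Definition fourier2 (f : P -> R[i]) (w : P) : R[i] :=
  cintegral leb2 (fun x => f x * expi (c * (w.1 * x.1 + w.2 * x.2))).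

Let n0 d (T : measurableType d) (h : T -> R[i]) z : (0 <= (nsq (h z))%:E)%E.
Proof. by rewrite lee_fin nsq_ge0. Qed.

Lemma cmeasurable_fourier2 d (Y : measurableType d) (f : Y * P -> R[i]) : cmeasurable f ->
  cmeasurable (fun z : Y * P => fourier2 (fun x => f (z.1, x)) z.2).
Proof.
move=> mf; rewrite /fourier2.
apply: (@cmeasurable_cintegral _ _ _ _ _ leb2
  (fun z : (Y * P) * P => f (z.1.1, z.2) * expi (c * (z.1.2.1 * z.2.1 + z.1.2.2 * z.2.2)))).
have m1 : mfunT (fun z : (Y * P) * P => z.1) by measurability.
have m11 := measurableT_comp measurable_fst m1.
have m12 := measurableT_comp measurable_snd m1.
apply: cmeasurableM.
  by apply: (cmeasurable_comp mf); exact: measurable_fun_pair.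
apply: cmeasurable_character; apply: measurable_funD; apply: measurable_funM.
- by measurability.
- by measurability.
- by measurability.
- by measurability.
Qed.

Section fourier_iterated.
Variable f : P -> R[i].
Hypothesis cf : cintegrable leb2 f.

Let mf : cmeasurable f. Proof. by case: cf. Qed.

Let f1 : (\int[leb]_x \int[leb]_y (normc (f (x, y)))%:E < +oo)%E.
Proof.
have [_] := cf; rewrite ge0_integral_leb2//; first exact: measurable_EFin_normc.
by move=> p; rewrite lee_fin normc_ge0.
Qed.

Let G (w2 x1 : RL) : R[i] := fourier c (fun x2 => f (x1, x2)) w2.

Let mG : cmeasurable (fun z : RL * RL => G z.2 z.1).
Proof. exact: cmeasurable_fourier. Qed.

Let mG' : cmeasurable (fun z : RL * RL => G z.1 z.2).
Proof.
apply: (cmeasurable_comp mG (g := fun z : RL * RL => (z.2, z.1))).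
by apply: measurable_fun_pair; [exact: measurable_snd|exact: measurable_fst].
Qed.

Let aecf : {ae leb, forall x, cintegrable leb (fun y => f (x, y))}.
Proof. exact: (ae_cintegrable1 mf f1). Qed.

Let mmul (tau : R) : mfunT (fun u : RL => u * tau).
Proof. by measurability. Qed.

Let mnf : mfunT (fun x : RL => \int[leb]_y (normc (f (x, y)))%:E)%E.
Proof.
apply: (measurable_integral1 leb (measurable_EFin_normc mf)) => z.
by rewrite lee_fin normc_ge0.
Qed.

Let cG w2 : (\int[leb]_x (normc (G w2 x))%:E < +oo)%E.
Proof.
apply: le_lt_trans f1; apply: ae_ge0_le_integral.
- exact: measurableT.
- by move=> x _; rewrite lee_fin normc_ge0.
- by apply/measurable_EFinP; apply: measurable_normc; exact: (cmeasurable_section1 w2 mG').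
- by move=> x _; apply: integral_ge0 => y _; rewrite lee_fin normc_ge0.
- exact: mnf.
- apply: ae_mono aecf => x cx _; apply: le_trans (normc_cintegral_le _) _.
    exact: cintegrable_character.
  rewrite le_eqVlt; apply/orP; left; apply/eqP.
  by apply: eq_integral => y _; rewrite Normc.normcM normc_expi mulr1.
Qed.

Lemma fourier2E w : fourier2 f w = fourier c (G w.2) w.1.
Proof.
have mchar : cmeasurable (fun x : P => expi (c * (w.1 * x.1 + w.2 * x.2))).
  apply: cmeasurable_character; apply: measurable_funD.
    by apply: measurable_funM; [exact: measurable_cst|exact: measurable_fst].
  by apply: measurable_funM; [exact: measurable_cst|exact: measurable_snd].
pose h x := f x * expi (c * (w.1 * x.1 + w.2 * x.2)).
have mh : cmeasurable h by exact: cmeasurableM.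
have h1 : (\int[leb]_x \int[leb]_y (normc (h (x, y)))%:E < +oo)%E.
  apply: le_lt_trans f1; rewrite le_eqVlt; apply/orP; left; apply/eqP.
  apply: eq_integral => x _; apply: eq_integral => y _.
  by rewrite Normc.normcM normc_expi mulr1.
apply: eq_trans (esym (cintegral_prod1 mh h1)) _.
rewrite /fourier; apply: ae_eq_cintegral.
- exact: (cmeasurable_cintegral leb mh).
- apply: cmeasurableM; first exact: (cmeasurable_section1 w.2 mG').
  by apply: cmeasurable_character; exact: mmul.
- apply: ae_mono aecf => x cx; rewrite /G /fourier -cintegralZr; last exact: cintegrable_character.
  apply: eq_cintegral => y; rewrite /h/= -mulrA -expiD; congr (_ * expi _).
  by rewrite mulrDr addrC (mulrC x) (mulrC y).
Qed.

(** Plancherel in the second variable for almost every value of the first, then in the first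
    variable for every frequency of the second, where [cG] provides integrability. *)
Lemma plancherel2 : cL2 leb2 f ->
  (\int[leb2]_w (nsq (fourier2 f w))%:E = \int[leb2]_x (nsq (f x))%:E)%E.
Proof.
move=> [_ f2].
have mf2 : cmeasurable (fourier2 f).
  have mf' : cmeasurable (fun z : RL * P => f z.2).
    by apply: (cmeasurable_comp mf); exact: measurable_snd.
  exact: (cmeasurable_section1 (0 : RL) (cmeasurable_fourier2 mf')).
have f2E : (\int[leb2]_x (nsq (f x))%:E = \int[leb]_x \int[leb]_y (nsq (f (x, y)))%:E)%E.
  exact: (ge0_integral_leb2 (measurable_EFin_nsq mf) (fun z => n0 f z)).
have pl1 : (\int[leb]_x \int[leb]_t (nsq (G t x))%:E = \int[leb]_x \int[leb]_y (nsq (f (x, y)))%:E)%E.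
  have a1 : {ae leb, forall x, (\int[leb]_u (normc (f (x, u)))%:E < +oo)%E}.
    by apply: ae_mono aecf => x [].
  have a2 : (\int[leb]_x \int[leb]_u (nsq (f (x, u)))%:E < +oo)%E by rewrite -f2E.
  exact: (plancherel_partial integral_ck (nu := leb) mf a1 a2).
have sw : (\int[leb]_t \int[leb]_x (nsq (G t x))%:E = \int[leb]_x \int[leb]_t (nsq (G t x))%:E)%E.
  exact: (@tonelli _ _ _ _ R leb leb (fun t x => (nsq (G t x))%:E) (measurable_EFin_nsq mG') (fun t x => n0 (fun z : P => G z.1 z.2) (t, x))).
have pl2 : (\int[leb]_t \int[leb]_s (nsq (fourier c (G t) s))%:E = \int[leb]_t \int[leb]_x (nsq (G t x))%:E)%E.
  have a1 : {ae leb, forall t, (\int[leb]_u (normc (G t u))%:E < +oo)%E}.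
    by apply: nearW => t; case: (cG t).
  have a2 : (\int[leb]_t \int[leb]_u (nsq (G t u))%:E < +oo)%E by rewrite sw pl1 -f2E.
  exact: (plancherel_partial integral_ck (nu := leb) mG' a1 a2).
rewrite f2E -pl1 -sw -pl2 (ge0_integral_leb2 (measurable_EFin_nsq mf2) (fun z => n0 _ z)).
apply: eq_trans (@tonelli _ _ _ _ R leb leb (fun s t => (nsq (fourier2 f (s, t)))%:E) _ _) _.
- by have := measurable_EFin_nsq mf2; apply: eq_measurable_fun => -[s t] _.
- by move=> s t; exact: (n0 (fourier2 f)).
by apply: eq_integral => t _; apply: eq_integral => s _; rewrite fourier2E.
Qed.

End fourier_iterated.
End plancherel2.

(** * Parametrization of GL_2 by (w', u, v) *)

Section change_of_variables.
Context (R : realType).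
Local Notation leb := (@lebesgue_measure R).
Local Notation RL := (measurableTypeR R).
Local Notation P := (RL * RL)%type.
Local Notation amb := ('cV[R]_2 * 'M[R]_2)%type.
Local Notation leb2 := (@lebesgue2 R).
Local Notation leb4 := (@lebesgue4 R).
Local Notation mK := (@mu_K R).
Local Notation mR := (@mu_Rstar R).
Local Notation mX := (@mu_X R).

(* The rows of [gamma w *m mx2 1 0 u v *m invmx (gamma w')]. *)
Definition amx (w w' : P) (u v : RL) : P * P :=
  ((((w.1 - w.2 * u) * w'.1 + w.2 * v * w'.2) / sqn w,
    ((w.1 - w.2 * u) * w'.2 - w.2 * v * w'.1) / sqn w),
   (((w.2 + w.1 * u) * w'.1 - w.1 * v * w'.2) / sqn w,
    ((w.2 + w.1 * u) * w'.2 + w.1 * v * w'.1) / sqn w)).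

Lemma measurable_amx d (T : measurableType d) (w w' : T -> P) (u v : T -> RL) :
  mfunT w -> mfunT w' ->
  mfunT u -> mfunT v ->
  mfunT (fun z => amx (w z) (w' z) (u z) (v z)).
Proof.
move=> mw mw' mu mv.
have m1 := measurableT_comp measurable_fst mw.
have m2 := measurableT_comp measurable_snd mw.
have m1' := measurableT_comp measurable_fst mw'.
have m2' := measurableT_comp measurable_snd mw'.
have mn : mfunT (fun z => sqn (w z)) by measurability.
have M (f g : T -> RL) : mfunT f -> mfunT g ->
  mfunT (fun z => f z * g z) by measurability.
have A (f g : T -> RL) : mfunT f -> mfunT g ->
  mfunT (fun z => f z + g z) by measurability.
have B (f g : T -> RL) : mfunT f -> mfunT g ->
  mfunT (fun z => f z - g z) by measurability.
apply: measurable_fun_pair; apply: measurable_fun_pair; apply: measurable_div mn.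
- exact: (A _ _ (M _ _ (B _ _ m1 (M _ _ m2 mu)) m1') (M _ _ (M _ _ m2 mv) m2')).
- exact: (B _ _ (M _ _ (B _ _ m1 (M _ _ m2 mu)) m2') (M _ _ (M _ _ m2 mv) m1')).
- exact: (B _ _ (M _ _ (A _ _ m2 (M _ _ m1 mu)) m1') (M _ _ (M _ _ m1 mv) m2')).
- exact: (A _ _ (M _ _ (A _ _ m2 (M _ _ m1 mu)) m2') (M _ _ (M _ _ m1 mv) m1')).
Qed.

Lemma det_mkmx (a : P * P) : \det (mkmx a) = a.1.1 * a.2.2 - a.1.2 * a.2.1.
Proof. by rewrite det_mx2 !mxE. Qed.

Lemma det_amx w w' u v : sqn w != 0 ->
  \det (mkmx (amx w w' u v)) = v * sqn w' / sqn w.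
Proof.
move=> w0; rewrite det_mkmx /=; have := w0; rewrite /sqn => n0; field.
exact: n0.
Qed.

(* Jacobian of [(w', v, u) |-> A] with respect to [mu_K], [mu_Rstar] and Lebesgue
   measure, times [dens A]. *)
Definition jac (w w' : P) (v : RL) : R := sqn w * (sqn w')^-1 * (v ^+ 2)^-1.

Lemma jac_ge0 w w' v : 0 <= jac w w' v.
Proof. by rewrite /jac !mulr_ge0// ?invr_ge0 ?sqr_ge0 ?sqn_ge0. Qed.

Lemma measurable_jac d (T : measurableType d) (w w' : T -> P) (v : T -> RL) :
  mfunT w -> mfunT w' -> mfunT v ->
  mfunT (fun z => jac (w z) (w' z) (v z)).
Proof.
move=> mw mw' mv; apply: measurable_funM; last first.
  apply: measurable_inv_ge0 => [z|]; first exact: sqr_ge0.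
  exact: measurable_funX.
apply: measurable_div; exact: (measurableT_comp (@measurable_sqn R)).
Qed.

(** Total on the ambient type. It recovers [w] from [kgamma (mkrow w)]; elsewhere its value is a
    default, see [good]. *)
Definition crd (k : amb) : P := (gammaV k.2 0 0, gammaV k.2 0 1).

Lemma measurable_crd : mfunT crd.
Proof.
apply: measurable_fun_pair.
- exact: (measurableT_comp (@measurable_entry _ _ 1 2 0 0) (@measurable_gammaV R)).
- exact: (measurableT_comp (@measurable_entry _ _ 1 2 0 1) (@measurable_gammaV R)).
Qed.

Lemma crdK (w : P) : crd (kgamma (mkrow w)) = w.
Proof. by rewrite /crd gammaVK_all !mxE; case: w. Qed.

Lemma mkrow_crd k : mkrow (crd k) = gammaV k.2.
Proof.
apply/rowP => j; rewrite mxE /crd.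
by case: j => -[|[|//]] j2 /=; congr (gammaV _ _ _); exact/val_inj.
Qed.

(* For fixed [w], [A] is parametrized by [w' = w A] and by the second row of
   [invmx (gamma w) *m A *m gamma w']. *)
Lemma ge0_integral_leb4 (w : P) (psi : P * P -> \bar R) : w.1 != 0 ->
  mfunT psi -> (forall a, 0 <= psi a)%E ->
  (\int[leb4]_a (psi a * (dens a)%:E) =
   \int[mK]_k \int[mR]_v ((jac w (crd k) v)%:E * \int[leb]_u psi (amx w (crd k) u v)))%E.
Proof.
move=> w10 mpsi psi0.
have n0 : sqn w != 0.
  by rewrite sqn_eq0; apply: contra_neq w10 => ->.
pose Psi (a : P * P) : \bar R := (psi a * (dens a)%:E)%E.
have mPsi : mfunT Psi.
  by apply: emeasurable_funM => //; apply/measurable_EFinP; exact: measurable_dens.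
have Psi0 a : (0 <= Psi a)%E by apply: mule_ge0; [exact: psi0|rewrite lee_fin dens_ge0].
(* Solving [w' = w A] for the first row of [A] when the second row is [r1]; this division is the
   reason for [w.1 != 0]. The zero coefficients give the shape that the affine substitution
   expects. *)
pose r0 (w' r1 : P) : P := (w.1^-1 * w'.1 + 0 * w'.2 + - (w.2 * r1.1 / w.1),
                            0 * w'.1 + w.1^-1 * w'.2 + - (w.2 * r1.2 / w.1)).
have mPsw : mfunT (fun z : P * P => Psi (z.2, z.1)) by measurability.
have mPr : mfunT (fun z : P * P => Psi (r0 z.2 z.1, z.1)) by measurability.
have w20 : 0 <= (w.1 ^+ 2)^-1 by rewrite invr_ge0 sqr_ge0.
have E1 : (\int[leb4]_a Psi a =
    ((w.1 ^+ 2)^-1)%:E * \int[leb2]_w' \int[leb2]_r1 Psi (r0 w' r1, r1))%E.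
  transitivity (\int[leb2]_r1 \int[leb2]_r Psi (r, r1))%E.
    exact: (@fubini_tonelli2 _ _ _ _ R leb2 leb2 Psi mPsi Psi0).
  rewrite (_ : (\int[leb2]_w' \int[leb2]_r1 Psi (r0 w' r1, r1) =
     \int[leb2]_r1 \int[leb2]_w' Psi (r0 w' r1, r1))%E); last first.
    exact: (esym (@tonelli _ _ _ _ R leb2 leb2 (fun r1 w' => Psi (r0 w' r1, r1)) mPr (fun _ _ => Psi0 _))).
  rewrite -(ge0_integralZT leb2 (measurable_integralr leb2 mPr (fun _ _ => Psi0 _)) (fun r1 => integral_ge0T leb2 (fun w' => Psi0 _)) w20).
  apply: eq_integral => r1 _.
  have d0 : w.1^-1 * w.1^-1 - 0 * 0 != 0 by rewrite mulr0 subr0 mulf_neq0 ?invr_eq0.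
  have -> : (w.1 ^+ 2)^-1 = `|w.1^-1 * w.1^-1 - 0 * 0|.
    by rewrite mulr0 subr0 -expr2 ger0_norm ?sqr_ge0// exprVn.
  exact: (ge0_integral_leb2_affine _ _ d0 (measurable_fun_pair2 r1 mPsw) (fun r => Psi0 _)).
rewrite [LHS]E1.
have mJ : mfunT (fun z : (P * RL) => jac w z.1 z.2).
  by apply: measurable_jac; [exact: measurable_cst|exact: measurable_fst|exact: measurable_snd].
have mI : mfunT (fun z : (P * RL) * RL => psi (amx w z.1.1 z.2 z.1.2)).
  apply: (measurableT_comp mpsi); apply: measurable_amx.
  - exact: measurable_cst.
  - by measurability.
  - exact: measurable_snd.
  - by measurability.
pose H (w' : P) (v : RL) : \bar R := ((jac w w' v)%:E * \int[leb]_u psi (amx w w' u v))%E.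
have mIu := measurable_integral1 leb mI (fun _ => psi0 _).
have mH : mfunT (fun z : P * RL => H z.1 z.2) by measurability.
have H0 w' v : (0 <= H w' v)%E.
  by apply: mule_ge0; [rewrite lee_fin jac_ge0|exact: integral_ge0].
have mHi : mfunT (fun w' => \int[mR]_v H w' v)%E by exact: (measurable_integral1 mR mH (fun _ => H0 _ _)).
rewrite (_ : (\int[mK]_k _)%E = \int[mK]_k \int[mR]_v H (crd k) v)%E; last by [].
rewrite ge0_integral_K; first last.
- by move=> k; apply: integral_ge0 => v _; exact: H0.
- exact: (measurableT_comp mHi measurable_crd).
under [RHS]eq_integral do rewrite crdK.
rewrite -(ge0_integralZT leb2 _ _ w20); first last.
- by move=> w'; apply: integral_ge0 => r1 _; exact: Psi0.
- exact: (measurable_integrall leb2 mPr (fun _ _ => Psi0 _)).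
apply: eq_integral => w' _.
(* At [w' = 0] the right side vanishes through the inverse of 0; on the left both rows are
   proportional, so [dens] is 0. *)
have [w'0|n'0] := eqVneq (sqn w') 0.
  rewrite w'0 invr0 mule0 (_ : (\int[leb2]_r1 _)%E = 0%E) ?mule0//.
  apply: integral0_eq => r1 _; rewrite /Psi /dens det_mkmx /=.
  move/eqP: w'0; rewrite sqn_eq0 => /eqP ->; rewrite /r0 /= !mulr0 !add0r.
  rewrite (_ : _ - _ = 0) ?normr0 ?expr0n/= ?invr0 ?mule0//.
  by field.
have mPw : mfunT (fun r1 : P => Psi (r0 w' r1, r1)).
  exact: (measurable_fun_pair1 w' mPr).
(* For fixed [w'] the second row of [A] is affine in [(u, v)], and this is the determinant of its
   linear part. Its factor [w.1 ^+ 2] cancels the one left by solving for the first row. *)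
have DE : w.1 * w'.1 / sqn w * (w.1 * w'.1 / sqn w) - (- (w.1 * w'.2 / sqn w)) * (w.1 * w'.2 / sqn w) =
   w.1 ^+ 2 * sqn w' * (sqn w ^+ 2)^-1.
  by rewrite /sqn in n0 *; field.
have D0 : w.1 * w'.1 / sqn w * (w.1 * w'.1 / sqn w) - (- (w.1 * w'.2 / sqn w)) * (w.1 * w'.2 / sqn w) != 0.
  by rewrite DE !mulf_neq0// ?invr_eq0 ?expf_neq0.
rewrite (ge0_integral_leb2_affine (w.2 * w'.1 / sqn w) (w.2 * w'.2 / sqn w) D0 mPw (fun r => Psi0 _)) {}DE.
have aE (z : P) : (r0 w' (w.1 * w'.1 / sqn w * z.1 + - (w.1 * w'.2 / sqn w) * z.2 + w.2 * w'.1 / sqn w,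
     w.1 * w'.2 / sqn w * z.1 + w.1 * w'.1 / sqn w * z.2 + w.2 * w'.2 / sqn w),
    (w.1 * w'.1 / sqn w * z.1 + - (w.1 * w'.2 / sqn w) * z.2 + w.2 * w'.1 / sqn w,
     w.1 * w'.2 / sqn w * z.1 + w.1 * w'.1 / sqn w * z.2 + w.2 * w'.2 / sqn w)) = amx w w' z.1 z.2.
  by rewrite /r0 /amx /=; congr pair; congr pair; rewrite /sqn in n0 *; field; rewrite ?n0 ?w10.
under eq_integral do rewrite aE.
have mam : mfunT (fun z : P => Psi (amx w w' z.1 z.2)).
  apply: (measurableT_comp mPsi); apply: measurable_amx; try exact: measurable_cst.
  - exact: measurable_fst.
  - exact: measurable_snd.
have K0 : 0 <= w.1 ^+ 2 * sqn w' * (sqn w ^+ 2)^-1.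
  by apply: mulr_ge0; [apply: mulr_ge0; [exact: sqr_ge0|exact: sqn_ge0]|rewrite invr_ge0 sqr_ge0].
have K1 : 0 <= (w.1 ^+ 2)^-1 * (w.1 ^+ 2 * sqn w' * (sqn w ^+ 2)^-1) by exact: mulr_ge0.
rewrite (ger0_norm K0) muleA -EFinM ge0_integral_leb2//.
rewrite (@tonelli _ _ _ _ R leb leb (fun u v => Psi (amx w w' u v)) mam (fun _ _ => Psi0 _)).
have mHv : mfunT (H w') by exact: (measurable_fun_pair2 w' mH).
have n'i0 : 0 <= (sqn w')^-1 by rewrite invr_ge0 sqn_ge0.
have ti0 (t : RL) : 0 <= `|t|^-1 by rewrite invr_ge0.
have mHt : mfunT (fun t : RL => H w' t * (`|t|^-1)%:E)%E by measurability.
have Ht0 (t : RL) : (0 <= H w' t * (`|t|^-1)%:E)%E by apply: mule_ge0; [exact: H0|rewrite lee_fin].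
rewrite (ge0_integral_Rstar mHv (H0 w')) -(ge0_integralZTr leb mHt Ht0 n'i0).
rewrite -(ge0_integralZT leb (measurable_integrall leb mam (fun _ _ => Psi0 _)) (fun v => integral_ge0T leb (fun u => Psi0 _)) K1).
apply: eq_integral => v _.
have mu1 : mfunT (fun u : RL => psi (amx w w' u v)) by exact: (measurable_fun_pair2 (w', v) mI).
have d0 : 0 <= (`|v * sqn w' / sqn w| ^+ 3)^-1 by rewrite invr_ge0 exprn_ge0.
rewrite /H.
have -> : (\int[leb]_u Psi (amx w w' u v) = \int[leb]_u psi (amx w w' u v) * ((`|v * sqn w' / sqn w| ^+ 3)^-1)%:E)%E.
  rewrite -(ge0_integralZTr leb mu1 (fun u => psi0 _) d0); apply: eq_integral => u _.
  by rewrite /Psi /dens det_amx.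
rewrite [LHS]muleCA (muleC (jac w w' v)%:E) -[RHS]muleA -[RHS]muleA; congr (_ * _)%E.
rewrite -!EFinM; congr EFin.
have [->|v0] := eqVneq v (0 : R).
  by rewrite !mul0r normr0 expr0n/= invr0 mul0r !mulr0.
rewrite /jac !normrM normfV (ger0_norm (sqn_ge0 w)) (ger0_norm (sqn_ge0 w')) -(real_normK (num_real v)).
have v1 : `|v| != 0 by rewrite normr_eq0.
by field; rewrite n0 n'0 v1 w10.
Qed.

(** Inversion followed by a dilation. It passes between the matrix coordinate [v] and the kernel
    variable [s], related by [v = t / s]. *)
Lemma ge0_integral_Rstar_flip (t : R) (phi : RL -> \bar R) : t != 0 ->
  mfunT phi -> (forall s, 0 <= phi s)%E ->
  (\int[mR]_s phi (t / s)%R = \int[mR]_s phi s)%E.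
Proof.
move=> t0 mphi phi0.
have mt : mfunT (fun s : RL => phi (t * s)%R).
  by apply: (measurableT_comp mphi); apply: measurable_funM; [exact: measurable_cst|exact: measurable_id].
rewrite (ge0_integral_Rstar_inv mt (fun s => phi0 _)).
exact: ge0_integral_Rstar_scale.
Qed.

(** The measure on the fibre variables [(u, x)]: what is left of a group element once [w'] and [v]
    are fixed. *)
Definition leb3 : set (RL * P) -> \bar R := (leb \x leb2)%E.

HB.instance Definition _ := Measure.copy leb3 (leb \x leb2)%E.

Let leb3_sigma_finite : sigma_finite setT leb3.
Proof. exact: product_sigma_finite. Qed.

HB.instance Definition _ := Measure_isSigmaFinite.Build _ _ _ leb3 leb3_sigma_finite.

Definition point (w w' : P) (v : RL) (z : RL * P) : amb :=
  (mkcol z.2, mkmx (amx w w' z.1 v)).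

Lemma measurable_point d (T : measurableType d) (w w' : T -> P) (v : T -> RL) (z : T -> RL * P) :
  mfunT w -> mfunT w' ->
  mfunT v -> mfunT z ->
  mfunT (fun y => point (w y) (w' y) (v y) (z y)).
Proof.
move=> mw mw' mv mz; apply: measurable_mkG2; first exact: (measurableT_comp measurable_snd mz).
apply: measurable_amx => //; exact: (measurableT_comp measurable_fst mz).
Qed.

Lemma ge0_integral_G2_coord (w : P) (phi : amb -> \bar R) : w.1 != 0 ->
  mfunT phi -> (forall g, 0 <= phi g)%E ->
  (\int[@mu_G2 R]_g phi g =
   \int[mK]_k \int[mR]_v ((jac w (crd k) v)%:E *
     \int[leb3]_z phi (point w (crd k) v z)))%E.
Proof.
move=> w10 mphi phi0; rewrite ge0_integral_G2//.
have mxa : mfunT (fun z : P * (P * P) => phi (mkcol z.1, mkmx z.2)) by measurability.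
pose psi (a : P * P) : \bar R := (\int[leb2]_x phi (mkcol x, mkmx a))%E.
have mpsi : mfunT psi by exact: (measurable_integral2 leb2 mxa (fun _ => phi0 _)).
have psi0 a : (0 <= psi a)%E by apply: integral_ge0 => x _; exact: phi0.
under eq_integral do rewrite muleC -/(psi _).
rewrite (ge0_integral_leb4 w10 mpsi psi0).
apply: eq_integral => k _; apply: eq_integral => v _; congr (_ * _)%E.
have mpt : mfunT (fun z => phi (point w (crd k) v z)).
  apply: (measurableT_comp mphi); apply: measurable_point; try exact: measurable_cst.
  exact: measurable_id.
apply: esym; exact: (@fubini_tonelli1 _ _ _ _ R leb leb2 _ mpt (fun _ => phi0 _)).
Qed.

End change_of_variables.

Ltac measurable_hook ::= match goal with
  | |- measurable_fun _ (fun _ => sqn _) => apply: (measurableT_comp (@measurable_sqn _))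
  | |- measurable_fun _ (fun _ => dens _) => apply: (measurableT_comp (@measurable_dens _))
  | |- measurable_fun _ (fun _ => crd _) => apply: (measurableT_comp (@measurable_crd _))
  | |- measurable_fun _ (fun _ => jac _ _ _) => apply: measurable_jac
  | |- measurable_fun _ (fun _ => amx _ _ _ _) => apply: measurable_amx
  | |- measurable_fun _ (fun _ => point _ _ _ _) => apply: measurable_point
  end.

(** * The representation sigma *)

Section integrated_operator.
Context dX dG (X : measurableType dX) (G : measurableType dG) (R : realType).
Variables (mu : {sigma_finite_measure set X -> \bar R}).
Variables (nu : {sigma_finite_measure set G -> \bar R}).
Local Notation normc := (@Normc.normc R).
Variables (f : G -> R[i]) (h : X * G -> R[i]) (B : R).
Hypothesis cf : cintegrable nu f.
Hypothesis mh : cmeasurable h.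
Hypothesis hB : {ae nu, forall x, (\int[mu]_p (nsq (h (p, x)))%:E <= B%:E)%E}.

(** A pointwise form of sigma(f), in the abstract: [h (., x)] stands for sigma(x) applied to a fixed
    vector, and [B] bounds its squared norm uniformly in [x], as unitarity will provide. *)
Definition integrated (p : X) : R[i] := cintegral nu (fun x => f x * h (p, x)).

Let mf : cmeasurable f. Proof. by case: cf. Qed.

Let mf2 : cmeasurable (fun z : X * G => f z.2).
Proof. by measurability. Qed.

Let mfh : cmeasurable (fun z : X * G => f z.2 * h z).
Proof. exact: cmeasurableM. Qed.

Lemma cmeasurable_integrated : cmeasurable integrated.
Proof. exact: (cmeasurable_cintegral nu mfh). Qed.

Let N1 : R := fine (\int[nu]_x (normc (f x))%:E).

Let N1E : (N1%:E = \int[nu]_x (normc (f x))%:E)%E.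
Proof.
have i0 : (0 <= \int[nu]_x (normc (f x))%:E)%E.
  by apply: integral_ge0T => x; rewrite lee_fin normc_ge0.
by rewrite fineK// ge0_fin_numE//; case: cf.
Qed.

Let N10 : 0 <= N1.
Proof. by rewrite -lee_fin N1E; apply: integral_ge0T => x; rewrite lee_fin normc_ge0. Qed.

Let W (p : X) (x : G) : \bar R := (normc (f x) * nsq (h (p, x)))%:E.

Let W0 p x : (0 <= W p x)%E.
Proof. by rewrite lee_fin mulr_ge0// ?normc_ge0 ?nsq_ge0. Qed.

Let mW : mfunT (fun z : X * G => W z.1 z.2).
Proof. by measurability. Qed.

Let mn : mfunT (fun x => (normc (f x))%:E).
Proof. by measurability. Qed.

Let intW : (\int[mu]_p \int[nu]_x W p x <= (N1 * B)%:E)%E.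
Proof.
rewrite (@tonelli _ _ _ _ R mu nu W mW W0) EFinM muleC N1E.
(* A negative [B] contradicts [hB] at every point, so [nu] is then zero and both sides vanish. *)
have [B0|B0] := leP 0 B; last first.
  have : {ae nu, forall x, False}.
    apply: ae_mono hB => x hx; have : (0 <= B%:E)%E.
      by apply: le_trans hx; apply: integral_ge0T => p; rewrite lee_fin nsq_ge0.
    by rewrite lee_fin leNgt B0.
  move=> aeF; have E0 (g : G -> \bar R) : mfunT g -> (\int[nu]_x g x = 0)%E.
    move=> mg; rewrite -[RHS](integral0 nu setT); apply: ae_eq_integral.
    - exact: measurableT.
    - exact: mg.
    - exact: measurable_cst.
    - by apply: ae_mono aeF.
  by rewrite (E0 _ (measurable_integrall mu mW W0)) (E0 _ mn) mule0.
have n0 x : (0 <= (normc (f x))%:E)%E by rewrite lee_fin normc_ge0.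
rewrite -(ge0_integralZT nu mn n0 B0).
apply: ae_ge0_le_integral.
- exact: measurableT.
- by move=> x _; apply: integral_ge0T.
- exact: (measurable_integrall mu mW W0).
- by move=> x _; apply: mule_ge0.
- exact: measurable_funeM.
- apply: ae_mono hB => x hx _.
  have -> : (\int[mu]_p W p x = (normc (f x))%:E * \int[mu]_p (nsq (h (p, x)))%:E)%E.
    rewrite -(ge0_integralZT mu _ _ (normc_ge0 _)).
    - by apply: eq_integral => p _; rewrite /W EFinM.
    - by measurability.
    - by move=> p; rewrite lee_fin nsq_ge0.
  by rewrite muleC; apply: lee_wpmul2r.
Qed.

(** Splitting |f h| as sqrt|f| times sqrt|f| |h| lets only one power of |f| enter each factor, so
    its L^1 norm suffices. *)
Let cs p : ((\int[nu]_x (normc (f x * h (p, x)))%:E) * (\int[nu]_x (normc (f x * h (p, x)))%:E) <=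
  N1%:E * \int[nu]_x W p x)%E.
Proof.
have mhp := cmeasurable_section1 p mh.
have ms : mfunT (fun x => Num.sqrt (normc (f x))) by measurability.
have := @cauchy_schwarz _ _ R nu _ _ ms (measurable_funM ms (measurable_normc mhp)).
have -> : (\int[nu]_x `|Num.sqrt (normc (f x)) * (Num.sqrt (normc (f x)) * normc (h (p, x)))|%:E =
   \int[nu]_x (normc (f x * h (p, x)))%:E)%E.
  apply: eq_integral => x _; rewrite mulrA -expr2 sqr_sqrtr ?normc_ge0// Normc.normcM.
  by rewrite ger0_norm// mulr_ge0// normc_ge0.
have -> : (\int[nu]_x (Num.sqrt (normc (f x)) ^+ 2)%:E = N1%:E)%E.
  by rewrite N1E; apply: eq_integral => x _; rewrite sqr_sqrtr// normc_ge0.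
have -> // : (\int[nu]_x ((Num.sqrt (normc (f x)) * normc (h (p, x))) ^+ 2)%:E = \int[nu]_x W p x)%E.
by apply: eq_integral => x _; rewrite exprMn sqr_sqrtr ?normc_ge0// sqr_normc.
Qed.

Lemma ae_cintegrable_integrated : {ae mu, forall p, cintegrable nu (fun x => f x * h (p, x))}.
Proof.
have := ae_lty (measurable_integralr nu mW W0) (fun p => integral_ge0T nu (W0 p)) (le_lt_trans intW (ltry _)).
apply: ae_mono => p Wp; split; first exact: (cmeasurable_section1 p mfh).
apply: mule_self_lty; first by apply: integral_ge0T => x; rewrite lee_fin normc_ge0.
apply: le_lt_trans (cs p) _; apply: lte_mul_pinfty; [by rewrite lee_fin|by []|exact: Wp].
Qed.

(* Cauchy-Schwarz for the measure [|f| nu]. *)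
Lemma nsq_integrated_le :
  (\int[mu]_p (nsq (integrated p))%:E <= (N1 ^+ 2 * B)%:E)%E.
Proof.
apply: (@le_trans _ _ (\int[mu]_p (N1%:E * \int[nu]_x W p x))%E).
  apply: ae_ge0_le_integral.
  - exact: measurableT.
  - by move=> p _; rewrite lee_fin nsq_ge0.
  - exact: (measurable_EFin_nsq cmeasurable_integrated).
  - by move=> p _; apply: mule_ge0; [rewrite lee_fin|exact: integral_ge0T].
  - by apply: measurable_funeM; exact: (measurable_integralr nu mW W0).
  - apply: ae_mono ae_cintegrable_integrated => p cp _; apply: le_trans (cs p).
    have h1 := normc_cintegral_le cp.
    rewrite -sqr_normc expr2 EFinM; apply: lee_pmul => //; rewrite lee_fin normc_ge0//.
rewrite (ge0_integralZT mu (measurable_integralr nu mW W0) (fun p => integral_ge0T nu (W0 p)) N10).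
by rewrite expr2 -mulrA EFinM; apply: lee_wpmul2l; [rewrite lee_fin|exact: intW].
Qed.

(** Fubini. By AM-GM the product of [h] and [eta] is dominated by the sum of their squared moduli,
    whose integral over [mu] is bounded uniformly in [x]; what remains is a multiple of |f|. The
    absolute value of [B] keeps that multiple nonnegative. *)
Lemma ip_integrated eta : cL2 mu eta ->
  ip mu integrated eta = cintegral nu (fun x => f x * ip mu (fun p => h (p, x)) eta).
Proof.
move=> ceta; have [meta e2] := ceta.
have meta1 : cmeasurable (fun z : X * G => (eta z.1)^*).
  by apply: cmeasurableJ; apply: (cmeasurable_comp meta); exact: measurable_fst.
pose D (z : X * G) := f z.2 * h z * (eta z.1)^*.
have mD : cmeasurable D by exact: cmeasurableM.
pose E2 := N2 mu eta.
have E2E : (E2%:E = \int[mu]_p (nsq (eta p))%:E)%E by exact: N2E.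
pose g (x : G) (p : X) : \bar R := ((normc (f x))%:E * (2^-1 * (nsq (h (p, x)) + nsq (eta p)))%:E)%E.
have aeL2 : {ae nu, forall x, cL2 mu (fun p => h (p, x))}.
  apply: ae_mono hB => x hx; split; first exact: cmeasurable_section2.
  exact: le_lt_trans hx (ltry _).
have D0 (p : X) (x : G) : (0 <= (normc (D (p, x)))%:E)%E by rewrite lee_fin normc_ge0.
have foo : (\int[mu]_p \int[nu]_x (normc (D (p, x)))%:E < +oo)%E.
  have mnD : mfunT (fun z : X * G => (normc (D (z.1, z.2)))%:E) by measurability.
  rewrite (@tonelli _ _ _ _ R mu nu (fun p x => (normc (D (p, x)))%:E) mnD); last first.
    by move=> p x; rewrite lee_fin normc_ge0.
  have nn0 : {ae nu, forall x, setT x -> (\int[mu]_p (normc (D (p, x)))%:E <= (`|B| + E2)%:E * (normc (f x))%:E)%E}.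
    apply: ae_mono (ae_and hB aeL2) => x [hx cx] _.
    have [mx _] := cx.
    have mn2 := measurable_EFin_nsq mx; have me2 := measurable_EFin_nsq meta.
    have p1 p : (0 <= (nsq (h (p, x)))%:E)%E by rewrite lee_fin nsq_ge0.
    have p2 p : (0 <= (nsq (eta p))%:E)%E by rewrite lee_fin nsq_ge0.
    apply: (@le_trans _ _ (\int[mu]_p ((normc (f x))%:E * ((nsq (h (p, x)))%:E + (nsq (eta p))%:E)))%E).
      apply: ge0_le_integralT.
      - by measurability.
      - by move=> p; rewrite lee_fin normc_ge0.
      - by measurability.
      - move=> p; rewrite /D/= -EFinD -EFinM lee_fin -mulrA Normc.normcM.
        apply: ler_wpM2l; first exact: normc_ge0.
        apply: le_trans (normcM_le _ _) _; rewrite nsqJ.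
        have := nsq_ge0 (h (p, x)); have := nsq_ge0 (eta p).
        by move: (nsq _) (nsq _) => a b a0 b0; lra.
    rewrite (ge0_integralZT mu (emeasurable_funD mn2 me2) (fun p => adde_ge0 (p1 p) (p2 p)) (normc_ge0 _)).
    rewrite (ge0_integralDT mu mn2 p1 me2 p2) -E2E muleC.
    apply: lee_wpmul2r; first by rewrite lee_fin normc_ge0.
    rewrite EFinD; apply: leeD2r; apply: le_trans hx _.
    by rewrite lee_fin ler_norm.
  have BE0 : 0 <= `|B| + E2.
    by rewrite addr_ge0// -lee_fin E2E; apply: integral_ge0T => p; rewrite lee_fin nsq_ge0.
  apply: le_lt_trans (_ : _ <= \int[nu]_x ((`|B| + E2)%:E * (normc (f x))%:E))%E _.
    apply: ae_ge0_le_integral.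
    - exact: measurableT.
    - by move=> x _; apply: integral_ge0T => p; rewrite lee_fin normc_ge0.
    - exact: (measurable_integrall (f := fun p x => (normc (D (p, x)))%:E) mu mnD D0).
    - by move=> x _; rewrite mule_ge0// lee_fin// normc_ge0.
    - exact: measurable_funeM.
    - exact: nn0.
  rewrite ge0_integralZT//; last by move=> x; rewrite lee_fin normc_ge0.
  by rewrite -N1E -EFinM ltry.
transitivity (cintegral mu (fun p => cintegral nu (fun x => D (p, x)))).
  apply: ae_eq_cintegral.
  - by apply: cmeasurableM; [exact: cmeasurable_integrated|exact: cmeasurableJ].
  - exact: (cmeasurable_cintegral nu mD).
  - by apply: ae_mono ae_cintegrable_integrated => p cp; rewrite /D/= cintegralZr.
rewrite (cintegral_fubini mD foo).
apply: ae_eq_cintegral.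
- have mD' : cmeasurable (fun z : G * X => D (z.2, z.1)).
    by apply: (cmeasurable_comp mD); apply: measurable_fun_pair; [exact: measurable_snd|exact: measurable_fst].
  exact: (cmeasurable_cintegral mu mD').
- apply: cmeasurableM => //.
  have mD' : cmeasurable (fun z : G * X => h (z.2, z.1) * (eta z.2)^*).
    apply: (cmeasurable_comp (cmeasurableM mh meta1)).
    by apply: measurable_fun_pair; [exact: measurable_snd|exact: measurable_fst].
  exact: (cmeasurable_cintegral mu mD').
- apply: ae_mono aeL2 => x cx; rewrite /ip -(cintegralZ _ (cintegrable_ip cx ceta)).
  by apply: eq_cintegral => p; rewrite /D/= mulrA.
Qed.

End integrated_operator.

Section sigma_representation.
Context (R : realType).
Local Notation leb := (@lebesgue_measure R).
Local Notation RL := (measurableTypeR R).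
Local Notation P := (RL * RL)%type.
Local Notation amb := ('cV[R]_2 * 'M[R]_2)%type.
Local Notation leb2 := (@lebesgue2 R).
Local Notation mK := (@mu_K R).
Local Notation mR := (@mu_Rstar R).
Local Notation mX := (@mu_X R).
Local Notation mG := (@mu_G2 R).

Lemma mul_mx2 (a b c e a' b' c' e' : R) : mx2 a b c e *m mx2 a' b' c' e' =
  mx2 (a * a' + b * c') (a * b' + b * e') (c * a' + e * c') (c * b' + e * e').
Proof.
apply/matrixP => i j; rewrite !mxE !big_ord_recl big_ord0 addr0 !mxE/=.
by case: ifP; case: ifP.
Qed.

Lemma mul_row2 (w : 'rV[R]_2) (A : 'M[R]_2) j : (w *m A) 0 j = w 0 0 * A 0 j + w 0 1 * A 1 j.
Proof.
rewrite !mxE !big_ord_recl big_ord0 addr0.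
by congr (_ * _ + w _ _ * A _ _); exact/val_inj.
Qed.

(** Also true at [w = 0]: there [gamma] is 0, and [invmx] returns a singular matrix unchanged. Hence
    the formulas of [uv_entry] hold everywhere and give measurability without case distinction. *)
Lemma invmx_gamma (w : 'rV[R]_2) : invmx (gamma w) = mx2 (w 0 0) (w 0 1) (- w 0 1) (w 0 0).
Proof.
have [->|w0] := eqVneq w 0.
  have -> : gamma (0 : 'rV[R]_2) = 0.
    apply/matrixP => i j; rewrite gammaE !mxE !mul0r oppr0.
    by case: ifP => _; case: ifP.
  rewrite /invmx unitmxE unitfE det_mx2 ![in X in X != 0]mxE mul0r subr0 eqxx/=.
  by apply/matrixP => i j; rewrite !mxE oppr0; case: ifP => _; case: ifP.
have g1 := gamma_unit w0.
have n0 : enorm w ^+ 2 != 0 by rewrite sqrf_eq0 enorm_eq0.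
have E : gamma w *m mx2 (w 0 0) (w 0 1) (- w 0 1) (w 0 0) = 1%:M.
  rewrite gammaE mul_mx2; apply/matrixP => i j; rewrite !mxE.
  have en : w 0 0 ^+ 2 + w 0 1 ^+ 2 = enorm w ^+ 2 by rewrite enorm_sqr.
  move: (enorm w ^+ 2) n0 en => q n0 en.
  case: i j => -[|[|//]] i2 [] [|[|//]] j2 /=; rewrite /eq_op /=.
  - by rewrite -(divff n0) -[X in _ = X / _]en; ring.
  - by field; exact: n0.
  - by field; exact: n0.
  - by rewrite -(divff n0) -[X in _ = X / _]en; ring.
by rewrite -[LHS]mulmx1 -E mulmxA mulVmx// mul1mx.
Qed.

Lemma uv_entry (w : 'rV[R]_2) (A : 'M[R]_2) :
  u_ w A = ((- w 0 1 * A 0 0 + w 0 0 * A 1 0) * (w *m A) 0 0 +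
            (- w 0 1 * A 0 1 + w 0 0 * A 1 1) * (w *m A) 0 1) / enorm (w *m A) ^+ 2 /\
  v_ w A = ((- w 0 1 * A 0 1 + w 0 0 * A 1 1) * (w *m A) 0 0 -
            (- w 0 1 * A 0 0 + w 0 0 * A 1 0) * (w *m A) 0 1) / enorm (w *m A) ^+ 2.
Proof.
rewrite /u_ /v_ /uv_mx invmx_gamma gammaE [A in _ *m A *m _]mx2E !mul_mx2.
by split; rewrite !mxE/= ; ring.
Qed.

Lemma measurable_enorm : mfunT (@enorm R).
Proof.
apply: (@measurableT_comp _ _ _ _ _ _ (@Num.sqrt R)).
  by apply: continuous_measurable_fun; exact: sqrt_continuous.
by apply: measurable_funD; apply: measurable_funX; exact: measurable_entry.
Qed.

Section measurability.
Context d (T : measurableType d) (w : T -> 'rV[R]_2) (A : T -> 'M[R]_2).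
Hypotheses (mw : mfunT w) (mA : mfunT A).

Lemma measurable_mul_row : mfunT (fun z => w z *m A z).
Proof.
apply: measurable_fun_mx => i j; rewrite (ord1 i).
under eq_fun do rewrite mul_row2.
by apply: measurable_funD; apply: measurable_funM;
  ((exact: (measurableT_comp (@measurable_entry _ _ _ _ _ _) mw)) ||
   (exact: (measurableT_comp (@measurable_entry _ _ _ _ _ _) mA))).
Qed.

Let mwe i j : mfunT (fun z => w z i j).
Proof. by measurability. Qed.

Let mAe i j : mfunT (fun z => A z i j).
Proof. by measurability. Qed.

Let mwA i j : mfunT (fun z => (w z *m A z) i j).
Proof. exact: (measurableT_comp (@measurable_entry _ _ _ _ _ _) measurable_mul_row). Qed.

Let mx0 j : mfunT (fun z => - w z 0 1 * A z 0 j + w z 0 0 * A z 1 j).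
Proof. by measurability. Qed.

Let mi : mfunT (fun z => enorm (w z *m A z) ^+ 2).
Proof. exact: (measurableT_comp (@measurable_enorm_sqr R) measurable_mul_row). Qed.

Lemma measurable_u_ : mfunT (fun z => u_ (w z) (A z)).
Proof.
under eq_fun do rewrite (uv_entry _ _).1.
by apply: measurable_div => //; apply: measurable_funD; exact: measurable_funM.
Qed.

Lemma measurable_v_ : mfunT (fun z => v_ (w z) (A z)).
Proof.
under eq_fun do rewrite (uv_entry _ _).2.
by apply: measurable_div => //; apply: measurable_funB; exact: measurable_funM.
Qed.

End measurability.

Lemma cmeasurable_sigma d (T : measurableType d) (F : hfun R) (g k : T -> amb) (t : T -> RL) :
  cmeasurable (unc F) -> mfunT g -> mfunT k ->
  mfunT t -> cmeasurable (fun z => sigma (g z) F (k z) (t z)).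
Proof.
move=> mF mg mk mt.
have mw : mfunT (fun z => gammaV (k z).2) by exact: (measurableT_comp (@measurable_gammaV R) mk).
have mx := measurableT_comp measurable_fst mg.
have mA := measurableT_comp measurable_snd mg.
have mwA := measurable_mul_row mw mA.
have mti : mfunT (fun z => (t z)^-1) by measurability.
rewrite /sigma; apply: cmeasurableM; first apply: cmeasurableM.
- apply: cmeasurable_real; apply: measurable_div; last exact: (measurableT_comp measurable_enorm mwA).
  apply: measurable_funM; last exact: (measurableT_comp measurable_enorm mw).
  apply: (@measurableT_comp _ _ _ _ _ _ (@Num.sqrt R)).
    by apply: continuous_measurable_fun; exact: sqrt_continuous.
  apply: measurableT_comp; first exact: normr_measurable.
  exact: (measurableT_comp (@measurable_det2 R) mA).
- apply: cmeasurable_expi; apply: measurable_funM; first exact: measurable_cst.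
  apply: measurable_funD.
    have e z : (gammaV (k z).2 *m (g z).1) 0 0 = gammaV (k z).2 0 0 * (g z).1 0 0 + gammaV (k z).2 0 1 * (g z).1 1 0.
      by rewrite mxE !big_ord_recl big_ord0 addr0 (_ : lift ord0 ord0 = 1)//; exact/val_inj.
    under eq_fun do rewrite e.
    have me i j : mfunT (fun z => gammaV (k z).2 i j) by measurability.
    have me' i j : mfunT (fun z => (g z).1 i j) by measurability.
    by apply: measurable_funD; exact: measurable_funM.
  by apply: measurable_funM => //; exact: measurable_u_.
- apply: (cmeasurable_comp mF (g := fun z => (kgamma (gammaV (k z).2 *m (g z).2), (v_ (gammaV (k z).2) (g z).2)^-1 * t z))).
  apply: measurable_fun_pair; first exact: (measurableT_comp (@measurable_kgamma R) mwA).
  apply: measurable_funM => //.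
  exact: (measurableT_comp (@measurable_invr R) (measurable_v_ mw mA)).
Qed.

Lemma v_neq0 (w : 'rV[R]_2) (A : 'M[R]_2) : w != 0 -> A \in unitmx -> v_ w A != 0.
Proof.
move=> w0 uA.
have : uv_mx w A \in unitmx.
  rewrite /uv_mx !unitmx_mul unitmx_inv uA gamma_unit// gamma_unit//.
  exact: orow_mul.
by rewrite uv_mxE// unitmxE unitfE det_mx2 !mxE/= mul1r mul0r subr0.
Qed.

(** The phase has modulus 1 and the dilation in [t] preserves [mu_Rstar]. The squared weight [al] of
    [sigma] is exactly the Jacobian of [w |-> w A] for the measure dw / |w|^2 that defines
    [mu_K]. *)
Lemma sigma_unitary (x : 'cV[R]_2) (A : 'M[R]_2) (F : hfun R) : A \in unitmx ->
  cmeasurable (unc F) ->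
  (\int[mX]_p (nsq (unc (sigma (x, A) F) p))%:E = \int[mX]_p (nsq (unc F p))%:E)%E.
Proof.
move=> uA mF.
have mS : cmeasurable (unc (sigma (x, A) F)).
  exact: cmeasurable_sigma.
rewrite -(integral_nsq_unc mS) -(integral_nsq_unc mF).
pose Phi k : \bar R := (\int[mR]_t (nsq (F k t))%:E)%E.
have Phi0 k : (0 <= Phi k)%E by exact: nsq_integral_ge0.
have n0 z : (0 <= (nsq (unc F z))%:E)%E by rewrite lee_fin nsq_ge0.
have mPhi : mfunT Phi by exact: (measurable_integral1 mR (measurable_EFin_nsq mF) n0).
pose al (w : 'rV[R]_2) : R := `|\det A| * enorm w ^+ 2 / enorm (w *m A) ^+ 2.
have al0 w : 0 <= al w by rewrite divr_ge0 ?sqr_ge0// mulr_ge0 ?sqr_ge0.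
have mal : mfunT al.
  apply: measurable_div.
    by apply: measurable_funM; [exact: measurable_cst|exact: measurable_enorm_sqr].
  apply: (measurableT_comp (@measurable_enorm_sqr R)).
  by apply: measurable_mul_row; [exact: measurable_id|exact: measurable_cst].
pose Psi (w : 'rV[R]_2) : \bar R := ((al w)%:E * Phi (kgamma (w *m A)))%E.
have mwA : mfunT (fun w : 'rV[R]_2 => w *m A).
  by apply: measurable_mul_row; [exact: measurable_id|exact: measurable_cst].
have mPsi : mfunT Psi.
  apply: emeasurable_funM; first exact/measurable_EFinP.
  exact: (measurableT_comp mPhi (measurableT_comp (@measurable_kgamma R) mwA)).
have Psi0 w : (0 <= Psi w)%E by apply: mule_ge0; [rewrite lee_fin|exact: Phi0].
transitivity (\int[mK]_k Psi (gammaV k.2))%E.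
  apply: eq_integral => k _; set w := gammaV k.2.
  have sE t : nsq (sigma (x, A) F k t) = al w * nsq (F (kgamma (w *m A)) ((v_ w A)^-1 * t)).
    rewrite /sigma /= -/w !nsqM nsq_expi nsq_real mulr1; congr (_ * _).
    by rewrite /al expr_div_n exprMn sqr_sqrtr.
  under eq_integral do rewrite sE EFinM.
  have mFk : mfunT (fun t : RL => (nsq (F (kgamma (w *m A)) t))%:E).
    exact: measurable_EFin_nsq (cmeasurable_section1 (kgamma (w *m A)) mF).
  have ms : mfunT (fun t : RL => (nsq (F (kgamma (w *m A)) ((v_ w A)^-1 * t)))%:E).
    by apply: (measurableT_comp mFk); apply: measurable_funM; [exact: measurable_cst|exact: measurable_id].
  have ns (a : RL) : (0 <= (nsq (F (kgamma (w *m A)) a))%:E)%E by rewrite lee_fin nsq_ge0.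
  rewrite (ge0_integralZT mR ms (fun t => ns _) (al0 w)) /Psi.
  (* The dilation needs [v_ w A] nonzero, which fails at the zero row; there [al] vanishes. *)
  have [w0|w0] := eqVneq w 0.
    have -> : al w = 0 by rewrite /al w0 enorm_sqr !mxE expr0n addr0 mulr0 mul0r.
    by rewrite !mul0e.
  congr (_ * _)%E; apply: (@ge0_integral_Rstar_scale R (v_ w A)^-1 _ _ mFk ns).
  by rewrite invr_eq0; exact: v_neq0.
rewrite (ge0_integral_K (measurableT_comp mPsi (@measurable_gammaV R)) (fun k => Psi0 _)).
rewrite (ge0_integral_K mPhi Phi0).
have msi : mfunT (fun w : P => ((sqn w)^-1)%:E).
  apply/measurable_EFinP; apply: measurable_inv_ge0; [exact: sqn_ge0|exact: measurable_sqn].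
have mq : mfunT (fun w : P => Phi (kgamma (mkrow w)) * ((sqn w)^-1)%:E)%E by measurability.
have q0 (w : P) : (0 <= Phi (kgamma (mkrow w)) * ((sqn w)^-1)%:E)%E.
  by apply: mule_ge0; [exact: Phi0|rewrite lee_fin invr_ge0 sqn_ge0].
have dA : A 0 0 * A 1 1 - A 1 0 * A 0 1 = \det A by rewrite det_mx2; ring.
have dA0 : A 0 0 * A 1 1 - A 1 0 * A 0 1 != 0 by rewrite dA -unitfE -unitmxE.
rewrite [RHS](ge0_integral_leb2_affine 0 0 dA0 mq q0) dA.
pose wA (w : P) : P := (A 0 0 * w.1 + A 1 0 * w.2 + 0, A 0 1 * w.1 + A 1 1 * w.2 + 0).
have mwA2 : mfunT wA by exact: (measurable_affine2 (A 0 0) (A 1 0) (A 0 1) (A 1 1) 0 0).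
rewrite -[RHS](ge0_integralZT leb2 (measurableT_comp mq mwA2) (fun w => q0 _) (normr_ge0 _)).
apply: eq_integral => w _ /=.
have wAE : mkrow (wA w) = mkrow w *m A.
  apply/rowP => j; rewrite mul_row2 !mxE /wA /= !addr0.
  by case: j => -[|[|//]] j2 /=; rewrite (mulrC _ w.1) (mulrC _ w.2); congr (w.1 * A _ _ + w.2 * A _ _); exact/val_inj.
rewrite gammaVK_all /Psi -/(wA w) wAE muleAC muleC [RHS]muleCA; congr (_ * _)%E.
rewrite -!EFinM; congr EFin; rewrite /al -wAE !enorm_mkrow.
have [w0|w0] := eqVneq (sqn w) 0.
  have -> : wA w = (0, 0).
    by move/eqP: w0; rewrite sqn_eq0 => /eqP ->; rewrite /wA/= !mulr0 !addr0.
  by rewrite w0 /sqn/= expr0n addr0 invr0 !mulr0.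
by rewrite mulrAC mulfK.
Qed.

End sigma_representation.

(** * The integrated representation sigma(f) *)

Section sigma_L1.
Context (R : realType).
Local Notation RL := (measurableTypeR R).
Local Notation amb := ('cV[R]_2 * 'M[R]_2)%type.
Local Notation mK := (@mu_K R).
Local Notation mR := (@mu_Rstar R).
Local Notation mX := (@mu_X R).
Local Notation mG := (@mu_G2 R).
Variable f : amb -> R[i].
Hypothesis cf : cintegrable mG f.

Definition coef (F : hfun R) (z : (amb * RL) * amb) : R[i] := sigma z.2 F z.1.1 z.1.2.

(** The integral is taken separately at each point [(k, t)], which gives values to compare with a
    kernel; [sigmaL1] has prescribed matrix coefficients only. *)
Definition sigma_int : hop R := fun F k t => integrated mG f (coef F) (k, t).

Lemma cmeasurable_coef F : cmeasurable (unc F) -> cmeasurable (coef F).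
Proof.
move=> mF; exact: (cmeasurable_sigma mF measurable_snd
  (measurableT_comp measurable_fst measurable_fst)
  (measurableT_comp measurable_snd measurable_fst)).
Qed.

Lemma ae_GL2 : {ae mG, forall g, g.2 \in unitmx}.
Proof.
exists (~` @G2 R); split.
- by apply: measurableC; exact: measurable_G2.
- exact: mu_G2_setC.
- by move=> g /= h1 h2; apply: h1.
Qed.

Lemma coef_nsq F : cL2 mX (unc F) ->
  {ae mG, forall g, (\int[mX]_p (nsq (coef F (p, g)))%:E <= (N2 mX (unc F))%:E)%E}.
Proof.
move=> cF; apply: ae_mono ae_GL2 => -[x A] uA; rewrite (N2E cF).
by rewrite le_eqVlt; apply/orP; left; apply/eqP; case: cF => mF _; exact: (sigma_unitary x uA mF).
Qed.

Let mlin (a : R[i]) F G : cmeasurable (unc F) -> cmeasurable (unc G) ->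
  cmeasurable (unc (fun k t => a * F k t + G k t)).
Proof.
move=> mF mG'; change (cmeasurable (fun p => a * unc F p + unc G p)).
by apply: cmeasurableD mG'; apply: cmeasurableM mF; exact: cmeasurable_cst.
Qed.

Let unc_sigma_int F : unc (sigma_int F) = integrated mG f (coef F).
Proof. by apply/funext => -[]. Qed.

Lemma cmeasurable_sigma_int F : cmeasurable (unc F) -> cmeasurable (unc (sigma_int F)).
Proof.
move=> mF; rewrite unc_sigma_int.
exact: (cmeasurable_integrated cf (cmeasurable_coef mF)).
Qed.

Lemma hspace_sigma_int F : hspace F -> hspace (sigma_int F).
Proof.
move=> /hspaceP cF; have [mF _] := cF; apply/hspaceP; split; first exact: cmeasurable_sigma_int.
rewrite unc_sigma_int; apply: le_lt_trans (ltry _).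
exact: (nsq_integrated_le cf (cmeasurable_coef mF) (coef_nsq cF)).
Qed.

Lemma bounded_sigma_int : bounded_op sigma_int.
Proof.
split; first exact: hspace_sigma_int.
- move=> a F G /hspaceP cF /hspaceP cG; have [mF _] := cF; have [mG' _] := cG.
  have mFG : cmeasurable (unc (fun k t => a * F k t + G k t)).
    exact: mlin.
  apply: heq_ae.
  + exact: cmeasurable_sigma_int.
  + exact: mlin (cmeasurable_sigma_int mF) (cmeasurable_sigma_int mG').
  + have aF := ae_cintegrable_integrated cf (cmeasurable_coef mF) (coef_nsq cF).
    have aG := ae_cintegrable_integrated cf (cmeasurable_coef mG') (coef_nsq cG).
    apply: ae_mono (ae_and aF aG) => -[k t] [iF iG].
    rewrite /unc /= /sigma_int /integrated -(cintegralZ a iF) -(cintegralD (cintegrableZ a iF) iG).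
    apply: eq_cintegral => x; rewrite /coef /sigma /=; ring.
- exists (fine (\int[mG]_x (Normc.normc (f x))%:E)) => F /hspaceP cF; have [mF _] := cF.
  apply: hnorm_le.
  + by apply: fine_ge0; apply: integral_ge0T => x; rewrite lee_fin normc_ge0.
  + exact: cmeasurable_sigma_int.
  + exact: mF.
  + rewrite unc_sigma_int -(N2E cF) -EFinM.
    exact: (nsq_integrated_le cf (cmeasurable_coef mF) (coef_nsq cF)).
Qed.

Lemma hinner_sigma_int F eta : hspace F -> hspace eta ->
  hinner (sigma_int F) eta = cintegral mG (fun x => f x * hinner (sigma x F) eta).
Proof.
move=> hF he; have hS := hspace_sigma_int hF; rewrite (hinnerE hS he).
have [/hspaceP cF /hspaceP ce] := (hF, he); have [mF _] := cF; have [me _] := ce.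
have mc := cmeasurable_coef mF.
rewrite unc_sigma_int (ip_integrated cf mc (coef_nsq cF) ce).
have mce : cmeasurable (fun z : (amb * amb) * RL => coef F ((z.1.2, z.2), z.1.1) * (eta z.1.2 z.2)^*).
  have m1 : mfunT (fun z : (amb * amb) * RL => (z.1.2, z.2)) by measurability.
  apply: cmeasurableM; last by apply: cmeasurableJ; exact: (cmeasurable_comp me m1).
  apply: (cmeasurable_comp mc); apply: measurable_fun_pair; first exact: m1.
  exact: (measurableT_comp measurable_fst measurable_fst).
have cLs g : g.2 \in unitmx -> hspace (sigma g F).
  case: g => x A uA; apply/hspaceP; split; first exact: (cmeasurable_section2 (x, A) mc).
  by rewrite (sigma_unitary x uA mF); case: cF.
apply: ae_eq_cintegral.
- apply: cmeasurableM; first by case: cf.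
  have mce2 : cmeasurable (fun z : amb * (amb * RL) => coef F (z.2, z.1) * (unc eta z.2)^*).
    apply: cmeasurableM; last by apply: cmeasurableJ; apply: (cmeasurable_comp me); exact: measurable_snd.
    by apply: (cmeasurable_comp mc); apply: measurable_fun_pair; [exact: measurable_snd|exact: measurable_fst].
  exact: (cmeasurable_cintegral mX mce2).
- apply: cmeasurableM; first by case: cf.
  exact: (cmeasurable_cintegral mK (cmeasurable_cintegral mR mce)).
- by apply: ae_mono ae_GL2 => g uA; rewrite (hinnerE (cLs g uA) he).
Qed.

(** [sigma_int] witnesses that the set from which [xget] chooses is inhabited, so the chosen
    operator has the prescribed coefficients; these determine it up to [heq]. *)
Lemma heq_sigmaL1 F : hspace F -> heq (sigmaL1 f F) (sigma_int F).
Proof.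
move=> hF.
have [[hS _ _] wS] := xgetPex (fun _ _ _ => 0) (ex_intro _ _ (conj bounded_sigma_int hinner_sigma_int) : exists S, [set S | bounded_op S /\
       forall xi eta, hspace xi -> hspace eta ->
         hinner (S xi) eta =
         cintegral (@mu_G2 R) (fun x => f x * hinner (sigma x xi) eta)] S).
apply: hspace_eq_weak; [exact: hS|exact: hspace_sigma_int|move=> eta he].
by rewrite (hinner_sigma_int hF he); exact: wS.
Qed.

End sigma_L1.

(** * The kernel of sigma(f) T *)

Section ae_product.
Context d1 d2 (T1 : measurableType d1) (T2 : measurableType d2) (R : realType).
Variables (m1 : {sigma_finite_measure set T1 -> \bar R}).
Variables (m2 : {sigma_finite_measure set T2 -> \bar R}).

Lemma ae_prod_fst (Q : T1 -> Prop) : {ae m1, forall x, Q x} ->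
  {ae (m1 \x m2)%E, forall z, Q z.1}.
Proof.
move=> [N [mN N0 QN]]; exists (N `*` setT); split.
- exact: measurableX.
- apply: eq_trans (product_measure1E m1 m2 mN (@measurableT _ T2)) _.
  exact: eq_trans (congr1 (fun z => z * m2 setT)%E N0) (mul0e _).
- by move=> z /= h; split=> //; exact: QN.
Qed.

Lemma ae_prod_snd (Q : T2 -> Prop) : {ae m2, forall x, Q x} ->
  {ae (m1 \x m2)%E, forall z, Q z.2}.
Proof.
move=> [N [mN N0 QN]]; exists (setT `*` N); split.
- exact: measurableX.
- apply: eq_trans (product_measure1E m1 m2 (@measurableT _ T1) mN) _.
  exact: eq_trans (congr1 (fun z => m1 setT * z)%E N0) (mule0 _).
- by move=> z /= h; split=> //; exact: QN.
Qed.

End ae_product.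

Section almost_everywhere.
Context (R : realType).
Local Notation leb := (@lebesgue_measure R).
Local Notation RL := (measurableTypeR R).
Local Notation P := (RL * RL)%type.
Local Notation amb := ('cV[R]_2 * 'M[R]_2)%type.
Local Notation leb2 := (@lebesgue2 R).
Local Notation leb3 := (@leb3 R).
Local Notation mK := (@mu_K R).
Local Notation mR := (@mu_Rstar R).
Local Notation mX := (@mu_X R).
Local Notation mG := (@mu_G2 R).

Lemma ae_Rstar : {ae mR, forall t, t != 0 :> R}.
Proof.
exists (~` @Rstar R); split.
- by apply: measurableC; exact: measurable_Rstar.
- exact: mu_Rstar_setC.
- by move=> t h1 h2; apply: h1.
Qed.

Lemma ae_leb_neq0 : {ae leb, forall t, t != 0 :> R}.
Proof.
exists [set (0 : R)]; split; [by []|exact: lebesgue_measure_set1|].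
by move=> t /= /negP; rewrite negbK => /eqP.
Qed.

Lemma ae_leb2_fst : {ae leb2, forall w, w.1 != 0 :> R}.
Proof. exact: (@ae_prod_fst _ _ _ _ R leb leb _ ae_leb_neq0). Qed.

(** The second condition places [k] in the range of [kgamma], where [crd] is a true inverse; the
    first is what the parametrization of matrices by [(w', u, v)] asks for. *)
Definition good (k : amb) := (crd k).1 != 0 /\ kgamma (mkrow (crd k)) = k.

Lemma good_sqn k : good k -> sqn (crd k) != 0.
Proof. by move=> [k1 _]; rewrite sqn_eq0; apply: contra_neq k1 => ->. Qed.

Lemma ae_K (Q : P -> Prop) : {ae leb2, forall w, Q w} -> {ae mK, forall k, Q (crd k)}.
Proof.
move=> [N [mN N0 QN]]; exists (@crd R @^-1` N).
have mB : measurable (@crd R @^-1` N).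
  by rewrite -[X in measurable X]setTI; exact: (@measurable_crd R).
split; [exact: mB| |by move=> k h; exact: QN].
rewrite -[LHS]mule1 -[1%E]/(1%:E) muleC -[LHS](integral_cst mK mB).
rewrite integral_mkcond (_ : _ \_ _ = fun k => (\1_N (crd k))%:E); last first.
  apply/funext => k; rewrite patchE indicE /=.
  rewrite (_ : (k \in _) = (crd k \in N)); first by case: (_ \in _).
  by apply/idP/idP; rewrite !inE.
have mI : mfunT (fun k => (\1_N (crd k))%:E : \bar R).
  by apply/measurable_EFinP; apply: (measurableT_comp (measurable_indic mN)); exact: measurable_crd.
rewrite (ge0_integral_K mI); last by move=> k; rewrite lee_fin.
rewrite -[RHS](integral0 leb2 setT); apply: ae_eq_integral.
- exact: measurableT.
- apply: emeasurable_funM; apply/measurable_EFinP.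
    under eq_fun do rewrite crdK.
    exact: measurable_indic.
  by apply: measurable_inv_ge0; [exact: sqn_ge0|exact: measurable_sqn].
- exact: measurable_cst.
- exists N; split => // w /= h; apply: contrapT => Nw; apply: h => _.
  by rewrite crdK indicE memNset// mul0e.
Qed.

Lemma ae_good : {ae mK, forall k, good k}.
Proof.
(* Equality of ambient points is tested on each real entry [e]. The exceptional set of an entry is
   measurable, and its preimage under [kgamma] is empty. *)
have aE (e : amb -> R) : mfunT e ->
    {ae mK, forall k, e (kgamma (mkrow (crd k))) = e k}.
  move=> me; pose D k := e (kgamma (mkrow (crd k))) - e k.
  have mD : mfunT D.
    apply: measurable_funB => //; apply: (measurableT_comp me).
    exact: (measurableT_comp (@measurable_kgamma R) (measurableT_comp (@measurable_mkrow R) (@measurable_crd R))).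
  exists (D @^-1` (~` [set 0])); split.
  - by rewrite -[X in measurable X]setTI; apply: mD => //; exact: measurableC.
  - rewrite /mu_K /pushforward (_ : _ @^-1` _ = set0) ?measure0//.
    apply/seteqP; split=> // w /=; apply.
    by rewrite /D mkrow_crd gammaVK_all subrr.
  - by move=> k /= h1 h2; apply: h1; apply/eqP; rewrite -subr_eq0; exact/eqP.
have e1 i : mfunT (fun k : amb => k.1 i 0) by measurability.
have e2 i j : mfunT (fun k : amb => k.2 i j) by measurability.
have a0 := ae_K ae_leb2_fst.
have a1 := ae_and (aE _ (e1 0)) (aE _ (e1 1)).
have a2 := ae_and (aE _ (e2 0 0)) (aE _ (e2 0 1)).
have a3 := ae_and (aE _ (e2 1 0)) (aE _ (e2 1 1)).
apply: ae_mono (ae_and a0 (ae_and a1 (ae_and a2 a3))) => k [k1 [[h1 h2] [[h3 h4] [h5 h6]]]].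
split=> //; rewrite [RHS]surjective_pairing [LHS]surjective_pairing; congr pair.
  apply/colP => i; case: i => -[|[|//]] i2.
    by rewrite (_ : Ordinal i2 = 0); [exact: h1|exact/val_inj].
  by rewrite (_ : Ordinal i2 = 1); [exact: h2|exact/val_inj].
by rewrite [LHS]mx2E [RHS]mx2E h3 h4 h5 h6.
Qed.

Lemma ae_good2 : {ae mX, forall p, good p.1 /\ p.2 != 0 :> R}.
Proof.
apply: ae_and; first exact: (@ae_prod_fst _ _ _ _ R mK mR _ ae_good).
exact: (@ae_prod_snd _ _ _ _ R mK mR _ ae_Rstar).
Qed.

Lemma mul_amx (w w' : P) (u v : RL) : sqn w != 0 -> mkrow w *m mkmx (amx w w' u v) = mkrow w' :> 'rV[R]_2.
Proof.
rewrite /sqn => w0; apply/rowP => j; rewrite mul_row2 !mxE/=.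
by case: ifP => _; rewrite /sqn; field.
Qed.

Lemma uv_amx (w w' : P) (u v : RL) : sqn w != 0 -> sqn w' != 0 ->
  u_ (mkrow w) (mkmx (amx w w' u v)) = u /\ v_ (mkrow w) (mkmx (amx w w' u v)) = v.
Proof.
move=> w0 w'0; have [-> ->] := uv_entry (mkrow w) (mkmx (amx w w' u v)).
rewrite mul_amx// enorm_mkrow !mxE/=; move: w0 w'0; rewrite /sqn => w0 w'0.
by split; rewrite /sqn; field; rewrite w0 w'0.
Qed.

(** Since |det A| equals [sqn w' / sqn w] times |v|, the norms in the weight of [sigma] cancel and
    only the square root of |v| survives. *)
Lemma sigma_point (w' : P) (v : RL) (z : RL * P) (F : hfun R) (k : amb) (t : R) :
  sqn (crd k) != 0 -> sqn w' != 0 ->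
  sigma (point (crd k) w' v z) F k t =
  (Num.sqrt `|v|)%:C *
  expi (2 * pi * ((crd k).1 * z.2.1 + (crd k).2 * z.2.2) + 2 * pi * (z.1 * t^-1)) *
  F (kgamma (mkrow w')) (v^-1 * t).
Proof.
set w := crd k => w0 w'0; rewrite /sigma /= -mkrow_crd -/w.
have [-> ->] := uv_amx z.1 v w0 w'0.
rewrite mul_amx//; congr (_%:C * expi _ * _).
  have n0 : 0 < sqn w by rewrite lt0r w0 sqn_ge0.
  have n'0 : 0 < sqn w' by rewrite lt0r w'0 sqn_ge0.
  rewrite det_amx// !normrM normfV (gtr0_norm n0) (gtr0_norm n'0).
  have e (y : P) : enorm (mkrow y) = Num.sqrt (sqn y) by rewrite -enorm_mkrow sqrtr_sqr ger0_norm ?enorm_ge0.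
  have h1 : 0 <= `|v| * sqn w' by rewrite mulr_ge0// ltW.
  rewrite !e (sqrtrM (sqn w)^-1 h1) (sqrtrM (sqn w') (normr_ge0 v)) (sqrtrV (ltW n0)).
  have s0 : Num.sqrt (sqn w) != 0 by rewrite gt_eqF// sqrtr_gt0.
  have s'0 : Num.sqrt (sqn w') != 0 by rewrite gt_eqF// sqrtr_gt0.
  by rewrite mulfVK// mulfK.
rewrite -mulrDr (mulrC z.1); congr (_ * (_ + _)).
by rewrite mxE !big_ord_recl big_ord0 addr0 !mxE.
Qed.

End almost_everywhere.

Section kernel.
Context (R : realType).
Local Notation leb := (@lebesgue_measure R).
Local Notation RL := (measurableTypeR R).
Local Notation P := (RL * RL)%type.
Local Notation amb := ('cV[R]_2 * 'M[R]_2)%type.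
Local Notation X := (amb * RL)%type.
Local Notation leb2 := (@lebesgue2 R).
Local Notation leb3 := (@leb3 R).
Local Notation mK := (@mu_K R).
Local Notation mR := (@mu_Rstar R).
Local Notation mX := (@mu_X R).
Local Notation mG := (@mu_G2 R).
Local Notation normc := (@Normc.normc R).

Lemma ge0_integral_X (phi : X -> \bar R) : mfunT phi -> (forall p, 0 <= phi p)%E ->
  (\int[mX]_p phi p = \int[mK]_k \int[mR]_t phi (k, t))%E.
Proof. by move=> mphi phi0; exact: (@fubini_tonelli1 _ _ _ _ R mK mR phi mphi phi0). Qed.

Let mI (w : P) (phi : amb -> \bar R) : mfunT phi -> (forall g, 0 <= phi g)%E ->
  mfunT (fun q : X => (jac w (crd q.1) q.2)%:E * \int[leb3]_z phi (point w (crd q.1) q.2 z))%E.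
Proof.
move=> mphi phi0.
have m1 : mfunT (fun q : X => crd q.1) by measurability.
apply: emeasurable_funM.
  apply/measurable_EFinP; apply: measurable_jac; [exact: measurable_cst|exact: m1|exact: measurable_snd].
have mp : mfunT (fun y : X * (RL * P) => phi (point w (crd y.1.1) y.1.2 y.2)) by measurability.
exact: (measurable_integral1 leb3 mp (fun _ => phi0 _)).
Qed.

Let I0 (w : P) (phi : amb -> \bar R) q v : (forall g, 0 <= phi g)%E ->
  (0 <= (jac w (crd q) v)%:E * \int[leb3]_z phi (point w (crd q) v z))%E.
Proof. by move=> phi0; apply: mule_ge0; [rewrite lee_fin jac_ge0|exact: integral_ge0T]. Qed.

Lemma ge0_integral_G2_X (w : P) (phi : amb -> \bar R) : w.1 != 0 ->
  mfunT phi -> (forall g, 0 <= phi g)%E ->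
  (\int[mG]_g phi g = \int[mX]_q ((jac w (crd q.1) q.2)%:E * \int[leb3]_z phi (point w (crd q.1) q.2 z)))%E.
Proof.
move=> w0 mphi phi0; rewrite (ge0_integral_X (mI w mphi phi0) (fun q => I0 _ _ _ phi0)).
exact: ge0_integral_G2_coord.
Qed.

Lemma ge0_integral_G2_X_flip (w : P) (t : R) (phi : amb -> \bar R) : w.1 != 0 -> t != 0 ->
  mfunT phi -> (forall g, 0 <= phi g)%E ->
  (\int[mG]_g phi g = \int[mX]_q ((jac w (crd q.1) (t / q.2))%:E * \int[leb3]_z phi (point w (crd q.1) (t / q.2)%R z)))%E.
Proof.
move=> w0 t0 mphi phi0.
have mt : mfunT (fun q : X => (q.1, t / q.2)) by measurability.
rewrite (ge0_integral_X (measurableT_comp (mI w mphi phi0) mt) (fun q => I0 _ _ _ phi0)).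
rewrite (ge0_integral_G2_X w0 mphi phi0) (ge0_integral_X (mI w mphi phi0) (fun q => I0 _ _ _ phi0)).
apply: eq_integral => k _; apply: esym.
exact: (ge0_integral_Rstar_flip t0 (measurable_fun_pair2 k (mI w mphi phi0)) (fun v => I0 _ _ _ phi0)).
Qed.

Variable f : amb -> R[i].
Hypothesis cf : cintegrable mG f.

Let mf : cmeasurable f. Proof. by case: cf. Qed.

Definition hat (w : P) (a : P * P) : R[i] := fourier2 (2 * pi) (fun x => f (mkcol x, mkmx a)) w.

Let mfx : cmeasurable (fun z : (P * P) * P => f (mkcol z.2, mkmx z.1)).
Proof. by measurability. Qed.

Lemma cmeasurable_hat d (T : measurableType d) (w : T -> P) (a : T -> P * P) :
  mfunT w -> mfunT a -> cmeasurable (fun z => hat (w z) (a z)).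
Proof.
move=> mw ma; apply: (cmeasurable_comp (cmeasurable_fourier2 (2 * pi) mfx) (g := fun z => (a z, w z))).
exact: measurable_fun_pair.
Qed.

(** The transfer formula for |f| has a finite total, so almost every fibre integral times [jac] is
    finite, and [jac] is positive at good points. [V] is left open because both [v = q.2] and
    [v = t / s] occur. *)
Lemma ae_fiber (w : P) (V : X -> RL) : sqn w != 0 -> mfunT V ->
  {ae mX, forall q, V q != 0 :> R} ->
  (forall phi : amb -> \bar R, mfunT phi -> (forall g, 0 <= phi g)%E ->
     (\int[mG]_g phi g = \int[mX]_q ((jac w (crd q.1) (V q))%:E * \int[leb3]_z phi (point w (crd q.1) (V q) z)))%E) ->
  {ae mX, forall q, cintegrable leb3 (fun z => f (point w (crd q.1) (V q) z))}.
Proof.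
move=> w0 mV V0 tr.
have mn : mfunT (fun g => (normc (f g))%:E) by measurability.
have n0 g : (0 <= (normc (f g))%:E)%E by rewrite lee_fin normc_ge0.
have mq : mfunT (fun q : X => (q.1, V q)) by measurability.
have mJ := measurableT_comp (mI w mn n0) mq.
have h0 := proj2 cf; rewrite (tr _ mn n0) in h0.
have aelt := ae_lty mJ (fun q => I0 _ _ _ n0) h0.
have ae1 := ae_and V0 (@ae_good2 R).
have ae2 := ae_and aelt ae1.
apply: ae_mono ae2 => q [ltq [Vq [gq q2]]].
have J0 : 0 < jac w (crd q.1) (V q).
  have w'0 := good_sqn gq.
  rewrite lt0r jac_ge0 andbT /jac !mulf_neq0 ?invr_eq0// expf_neq0//.
have mpt : mfunT (fun z => point w (crd q.1) (V q) z) by measurability.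
split; first exact: (cmeasurable_comp mf mpt).
move: ltq => /=; set I := (\int[leb3]_z _)%E.
have : (0 <= I)%E by exact: integral_ge0T.
by case: I => [r||]//; rewrite ?ltry// gt0_muley ?lte_fin.
Qed.

Section fiber.
Variables (w w' : P) (v : RL).
Hypothesis cf3 : cintegrable leb3 (fun z => f (point w w' v z)).

Let g (z : RL * P) := f (point w w' v z) * expi (2 * pi * (w.1 * z.2.1 + w.2 * z.2.2)).

Let mphase : mfunT (fun z : RL * P => w.1 * z.2.1 + w.2 * z.2.2).
Proof. by measurability. Qed.

Let mg : cmeasurable g.
Proof. by apply: cmeasurableM; [case: cf3|exact: cmeasurable_character]. Qed.

Let foo (h : RL * P -> R[i]) : cmeasurable h ->
  (forall z, normc (h z) = normc (f (point w w' v z))) ->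
  (\int[leb]_u \int[leb2]_x (normc (h (u, x)))%:E < +oo)%E.
Proof.
move=> mh hE; have [_] := cf3.
rewrite (@fubini_tonelli1 _ _ _ _ R leb leb2 (fun z => (normc (f (point w w' v z)))%:E)).
- apply: le_lt_trans; rewrite le_eqVlt; apply/orP; left; apply/eqP.
  by apply: eq_integral => u _; apply: eq_integral => x _; rewrite hE.
- by case: cf3 => m _; apply/measurable_EFinP; exact: measurable_normc.
- by move=> z; rewrite lee_fin normc_ge0.
Qed.

Let gE z : normc (g z) = normc (f (point w w' v z)).
Proof. by rewrite Normc.normcM normc_expi mulr1. Qed.

Lemma cintegrable_hat : cintegrable leb (fun u => hat w (amx w w' u v)).
Proof. exact: (cintegrable_cintegral mg (foo mg gE)). Qed.

Lemma cintegrable_phase (tau : RL) : cintegrable leb3 (fun z => f (point w w' v z) *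
  expi (2 * pi * (w.1 * z.2.1 + w.2 * z.2.2) + 2 * pi * (z.1 * tau))).
Proof.
apply: cintegrable_le cf3 _ => [|z]; last by rewrite Normc.normcM normc_expi mulr1.
apply: cmeasurableM; first by case: cf3.
apply: cmeasurable_expi; apply: measurable_funD; apply: measurable_funM; try exact: measurable_cst.
- exact: mphase.
- by measurability.
Qed.

(** The phase is a sum of a term in the translation variable and one in [u], so the fibre integral
    factors into two successive Fourier transforms. *)
Lemma fourier_hat (tau : RL) :
  cintegral leb3 (fun z => f (point w w' v z) *
    expi (2 * pi * (w.1 * z.2.1 + w.2 * z.2.2) + 2 * pi * (z.1 * tau))) =
  fourier (2 * pi) (fun u => hat w (amx w w' u v)) tau.
Proof.
have mz : mfunT (fun z : RL * P => z.1 * tau) by measurability.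
pose h (z : RL * P) := g z * expi (2 * pi * (z.1 * tau)).
have mh : cmeasurable h by apply: cmeasurableM mg _; exact: cmeasurable_character.
have hE z : normc (h z) = normc (f (point w w' v z)) by rewrite Normc.normcM normc_expi mulr1 gE.
transitivity (cintegral leb3 h).
  by apply: eq_cintegral => z; rewrite /h /g expiD mulrA.
apply: eq_trans (esym (cintegral_prod1 mh (foo mh hE))) _; apply: ae_eq_cintegral.
- exact: (cmeasurable_cintegral leb2 mh).
- apply: cmeasurableM; first by case: cintegrable_hat.
  by apply: cmeasurable_character; apply: measurable_funM; [exact: measurable_id|exact: measurable_cst].
- by apply: ae_mono (ae_cintegrable1 mg (foo mg gE)) => u cu; rewrite /h/= cintegralZr.
Qed.

End fiber.

(* The product of [jac] with the weights of [sigma] and [opT]; see [kconstE]. *)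
Definition kconst (p q : X) : R :=
  sqn (crd p.1) * `|q.2| * (Num.sqrt (`|p.2| ^+ 3))^-1 * (Num.sqrt (sqn (crd q.1)))^-1.

Definition kern (z : X * X) : R[i] := (kconst z.1 z.2)%:C *
  fourier (2 * pi) (fun u => hat (crd z.1.1) (amx (crd z.1.1) (crd z.2.1) u (z.1.2 / z.2.2))) (z.1.2)^-1.

Lemma cmeasurable_kern : cmeasurable kern.
Proof.
have m1 : mfunT (fun z : X * X => z.1) by measurability.
have m2 : mfunT (fun z : X * X => z.2) by measurability.
have m11 := measurableT_comp (@measurable_crd R) (measurableT_comp measurable_fst m1).
have m21 := measurableT_comp (@measurable_crd R) (measurableT_comp measurable_fst m2).
have m12 := measurableT_comp measurable_snd m1.
have m22 := measurableT_comp measurable_snd m2.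
have ms := @measurable_sqn R.
apply: cmeasurableM.
  apply: cmeasurable_real; apply: measurable_div; first apply: measurable_div; first apply: measurable_funM.
  - by measurability.
  - by measurability.
  - by measurability.
  - by measurability.
have mh : cmeasurable (fun y : (X * X) * RL =>
    hat (crd y.1.1.1) (amx (crd y.1.1.1) (crd y.1.2.1) y.2 (y.1.1.2 / y.1.2.2))).
  apply: cmeasurable_hat; first exact: (measurableT_comp m11 measurable_fst).
  apply: measurable_amx.
  - by measurability.
  - by measurability.
  - exact: measurable_snd.
  - by measurability.
apply: (cmeasurable_comp (cmeasurable_fourier (2 * pi) mh) (g := fun z : X * X => (z, (z.1.2)^-1))).
apply: measurable_fun_pair; first exact: measurable_id.
exact: (measurableT_comp (@measurable_invr R) m12).
Qed.

Lemma kconstE (p q : X) : good q.1 -> p.2 != 0 -> q.2 != 0 ->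
  jac (crd p.1) (crd q.1) (p.2 / q.2) * Num.sqrt `|p.2 / q.2| * (`|\det q.1.2 * q.2| `^ (- 2^-1)) = kconst p q.
Proof.
case: q => k' s; case: p => k t /= gk t0 s0.
have w'0 := good_sqn gk; have n'0 : 0 < sqn (crd k') by rewrite lt0r w'0 sqn_ge0.
have dk : \det k'.2 = (sqn (crd k'))^-1.
  have dg (y : 'rV[R]_2) : orow y -> \det (gamma y) = (enorm y ^+ 2)^-1.
    by move=> y0; rewrite gammaE det_mx2 !mxE/= mulNr opprK -!expr2 enorm_sqr_gamma.
  rewrite -[in LHS](proj2 gk) /kgamma /= dg ?enorm_mkrow//.
  by rewrite /orow /= mkrow_eq0 -sqn_eq0.
rewrite dk powRN powR12_sqrt ?normr_ge0// /kconst /jac /=.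
have [a0 b0] : 0 < `|t| /\ 0 < `|s| by rewrite !normr_gt0.
rewrite !normrM !normfV (gtr0_norm n'0).
rewrite (_ : (t / s) ^+ 2 = (`|t| / `|s|) ^+ 2); last by rewrite -[LHS]real_normK ?num_real// normrM normfV.
set a := `|t| in a0 *; set b := `|s| in b0 *; set m := sqn (crd k') in n'0 w'0 *.
(* Writing the positive quantities as squares resolves all square roots and leaves an identity of
   rational functions for [field]. *)
have sq (y : R) : 0 < y -> exists2 z, 0 < z & y = z ^+ 2.
  by move=> y0; exists (Num.sqrt y); [rewrite sqrtr_gt0|rewrite sqr_sqrtr// ltW].
have [a1 a10 ->] := sq a a0; have [b1 b10 ->] := sq b b0; have [m1 m10 ->] := sq m n'0.
have sE (y : R) : 0 < y -> Num.sqrt (y ^+ 2) = y by move=> y0; rewrite sqrtr_sqr gtr0_norm.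
have -> : a1 ^+ 2 / b1 ^+ 2 = (a1 / b1) ^+ 2 by rewrite expr_div_n.
have -> : (m1 ^+ 2)^-1 * b1 ^+ 2 = (b1 / m1) ^+ 2 by rewrite expr_div_n mulrC.
have -> : (a1 ^+ 2) ^+ 3 = (a1 ^+ 3) ^+ 2 by rewrite -!exprM.
rewrite !sE ?divr_gt0 ?exprn_gt0//.
by field; rewrite !gt_eqF.
Qed.

(** [F] in the domain of [T] makes the group integral converge absolutely at almost every [p]. At
    such a [p], pass to coordinates and integrate over the fibre first: for almost every [q] this
    yields the kernel times the value of [F] at [q]. *)
Lemma kernel_op_sigma_int F : hspace F -> hspace (opT F) ->
  {ae mX, forall p, kernel_op mX kern (unc F) p = unc (sigma_int f (opT F)) p}.
Proof.
move=> hF hG; have /hspaceP cG := hG; have [mG' _] := cG; have /hspaceP [mF _] := hF.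
have mc := cmeasurable_coef mG'.
have ai := ae_cintegrable_integrated cf mc (coef_nsq cG).
have ae1 := ae_and ai (@ae_good2 R).
apply: ae_mono ae1 => -[k t] [ip [/= gk t0]].
set w := crd k; have w10 : w.1 != 0 := proj1 gk; have n0 : sqn w != 0 := good_sqn gk.
have mV : mfunT (fun q : X => t / q.2) by measurability.
have m1 : mfunT (fun q : X => crd q.1) by measurability.
have mJ : mfunT (fun q : X => jac w (crd q.1) (t / q.2)) by measurability.
pose S (y : X * (RL * P)) : amb := point w (crd y.1.1) (t / y.1.2) y.2.
have mS : mfunT S.
  apply: measurable_point.
  - exact: measurable_cst.
  - by measurability.
  - by measurability.
  - exact: measurable_snd.
have tr (phi : amb -> \bar R) : mfunT phi -> (forall x, 0 <= phi x)%E ->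
    (\int[mG]_x phi x = \int[(mX \x leb3)%E]_y (phi (S y) * (jac w (crd y.1.1) (t / y.1.2))%:E))%E.
  move=> mphi phi0; rewrite (ge0_integral_G2_X_flip w10 t0 mphi phi0).
  have mpS := measurableT_comp mphi mS.
  rewrite (@fubini_tonelli1 _ _ _ _ R mX leb3).
  - apply: eq_integral => q _ /=; rewrite muleC.
    exact: (esym (ge0_integralZTr (f := fun z => phi (S (q, z))) leb3 (measurable_fun_pair2 q mpS) (fun z => phi0 _) (jac_ge0 w (crd q.1) (t / q.2)))).
  - by measurability.
  - by move=> y; apply: mule_ge0; [exact: phi0|rewrite lee_fin jac_ge0].
pose G := opT F.
pose I (x : amb) := f x * coef G ((k, t), x).
have [mI' _] := ip.
apply: esym; rewrite /unc /= /sigma_int /integrated.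
rewrite (cintegral_transfer (nu := (mX \x leb3)%E) (S := S) (w := fun y => jac w (crd y.1.1) (t / y.1.2)) (fun y => jac_ge0 _ _ _) tr mI').
pose H (y : X * (RL * P)) : R[i] := (jac w (crd y.1.1) (t / y.1.2))%:C * I (S y).
have mH : cmeasurable H.
  apply: cmeasurableM; last exact: (cmeasurable_comp mI' mS).
  by apply: cmeasurable_real; exact: (measurableT_comp mJ measurable_fst).
have Hoo : (\int[mX]_q \int[leb3]_z (normc (H (q, z)))%:E < +oo)%E.
  have mnI : mfunT (fun x => (normc (I x))%:E) by measurability.
  have n0I x : (0 <= (normc (I x))%:E)%E by rewrite lee_fin normc_ge0.
  apply: le_lt_trans (proj2 ip); rewrite le_eqVlt; apply/orP; left; apply/eqP.
  rewrite (ge0_integral_G2_X_flip w10 t0 mnI n0I).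
  apply: eq_integral => q _.
  rewrite -(ge0_integralZT leb3 (measurable_fun_pair2 q (measurableT_comp mnI mS)) (fun z => n0I _) (jac_ge0 _ _ _)).
  by apply: eq_integral => z _; rewrite /H Normc.normcM normc_real ger0_norm ?jac_ge0// EFinM.
apply: eq_trans (esym (cintegral_prod1 mH Hoo)) _; apply: ae_eq_cintegral.
- exact: (cmeasurable_cintegral leb3 mH).
- by apply: cmeasurableM mF; exact: (cmeasurable_section1 (k, t) cmeasurable_kern).
have V0 : {ae mX, forall q : X, t / q.2 != 0}.
  by apply: ae_mono (@ae_good2 R) => q [_ q2]; rewrite mulf_neq0// invr_eq0.
have af := ae_fiber n0 mV V0 (fun phi => ge0_integral_G2_X_flip w10 t0 (phi := phi)).
have ae2 := ae_and af (@ae_good2 R).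
apply: ae_mono ae2 => -[k' s] [cq [/= gq s0]].
set w' := crd k'; have n'0 : sqn w' != 0 := good_sqn gq.
have v0 : t / s != 0 by rewrite mulf_neq0// invr_eq0.
rewrite /kern /= -/w -/w' -(fourier_hat cq) mulrAC -(cintegralZ _ (cintegrable_phase cq t^-1)).
apply: eq_cintegral => z; rewrite /H /I /S /coef /= -/w'.
rewrite (sigma_point _ _ _ _ n0 n'0) (proj2 gq) /opT -/w.
(* This is what dictates [v = t / s]: the dilated argument of [F] in [sigma] becomes the kernel
   variable. *)
have -> : (t / s)^-1 * t = s by rewrite invf_div divfK.
rewrite -(kconstE (p := (k, t)) (q := (k', s)) gq t0 s0) /= -/w -/w'.
rewrite (_ : G k' s = (`|\det k'.2 * s| `^ (- 2^-1))%:C * F k' s) // !rmorphM.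
by move: (expi _) => e; ring.
Qed.

End kernel.

(** * The Hilbert-Schmidt norm of the kernel *)

Section hilbert_schmidt_norm.
Context (R : realType).
Local Notation leb := (@lebesgue_measure R).
Local Notation RL := (measurableTypeR R).
Local Notation P := (RL * RL)%type.
Local Notation amb := ('cV[R]_2 * 'M[R]_2)%type.
Local Notation X := (amb * RL)%type.
Local Notation leb2 := (@lebesgue2 R).
Local Notation leb3 := (@leb3 R).
Local Notation leb4 := (@lebesgue4 R).
Local Notation mK := (@mu_K R).
Local Notation mR := (@mu_Rstar R).
Local Notation mX := (@mu_X R).
Local Notation mG := (@mu_G2 R).
Local Notation normc := (@Normc.normc R).

Let ck := integral_cauchy_kernel R.

Variable f : amb -> R[i].
Hypothesis cf : cintegrable mG f.
Hypothesis c2f : cL2 mG f.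

Let mf : cmeasurable f. Proof. by case: cf. Qed.

Let fx (a : P * P) (x : P) : R[i] := f (mkcol x, mkmx a).

Let mfx : cmeasurable (fun z : (P * P) * P => fx z.1 z.2).
Proof.
by apply: (cmeasurable_comp mf); exact: measurable_mkG2.
Qed.

Let L (w : P) : \bar R := (\int[leb4]_a ((nsq (hat f w a))%:E * (dens a)%:E))%E.

Let mhat : cmeasurable (fun z : P * (P * P) => hat f z.1 z.2).
Proof. exact: (cmeasurable_hat cf measurable_fst measurable_snd). Qed.

Let mLint : mfunT (fun z : P * (P * P) => (nsq (hat f z.1 z.2))%:E * (dens z.2)%:E)%E.
Proof. by measurability. Qed.

Let Lint0 (w : P) (a : P * P) : (0 <= (nsq (hat f w a))%:E * (dens a)%:E)%E.
Proof. by apply: mule_ge0; rewrite lee_fin ?nsq_ge0 ?dens_ge0. Qed.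

Let mL : mfunT L.
Proof. exact: (measurable_integralr leb4 mLint Lint0). Qed.

Let L0 w : (0 <= L w)%E. Proof. exact: (integral_ge0T leb4 (Lint0 w)). Qed.

Let mn2 : mfunT (fun g => (nsq (f g))%:E).
Proof. by measurability. Qed.

Let n20 g : (0 <= (nsq (f g))%:E)%E. Proof. by rewrite lee_fin nsq_ge0. Qed.

Lemma integral_L : (\int[leb2]_w L w = \int[mG]_g (nsq (f g))%:E)%E.
Proof.
have mn1 : mfunT (fun g => (normc (f g))%:E) by measurability.
have n10 g : (0 <= (normc (f g))%:E)%E by rewrite lee_fin normc_ge0.
rewrite /L (@tonelli _ _ _ _ R leb2 leb4 (fun w a => (nsq (hat f w a))%:E * (dens a)%:E)%E mLint Lint0).
rewrite (ge0_integral_G2 mn2 n20).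
have mI (phi : amb -> \bar R) : mfunT phi -> (forall g, 0 <= phi g)%E ->
    mfunT (fun a => (dens a)%:E * \int[leb2]_x phi (mkcol x, mkmx a))%E.
  move=> mphi phi0; apply: emeasurable_funM; first by apply/measurable_EFinP; exact: measurable_dens.
  have mp : mfunT (fun z : (P * P) * P => phi (mkcol z.2, mkmx z.1)) by measurability.
  exact: (measurable_integral1 leb2 mp (fun _ => phi0 _)).
have I0 (phi : amb -> \bar R) a : (forall g, 0 <= phi g)%E ->
    (0 <= (dens a)%:E * \int[leb2]_x phi (mkcol x, mkmx a))%E.
  by move=> phi0; apply: mule_ge0; [rewrite lee_fin dens_ge0|exact: integral_ge0T].
apply: ge0_ae_eq_integral; [exact: (measurable_integrall leb2 mLint Lint0)|exact: (mI _ mn2 n20)|].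
have h1 := proj2 cf; rewrite (ge0_integral_G2 mn1 n10) in h1.
have h2 := proj2 c2f; rewrite (ge0_integral_G2 mn2 n20) in h2.
have a1 := ae_lty (mI _ mn1 n10) (fun a => I0 _ a n10) h1.
have a2 := ae_lty (mI _ mn2 n20) (fun a => I0 _ a n20) h2.
have a12 := ae_and a1 a2; apply: ae_mono a12 => a [f1 f2].
have mha : mfunT (fun w : P => (nsq (hat f w a))%:E).
  exact: measurable_EFin_nsq (cmeasurable_section2 a mhat).
rewrite (ge0_integralZTr leb2 mha _ (dens_ge0 a)); last by move=> w; rewrite lee_fin nsq_ge0.
(* Where [dens] is 0 nothing is known about the fibre of [f], but both sides vanish; elsewhere
   division by [dens] gives a fibre in L^1 and L^2. *)
rewrite muleC; have [d0|d0] := eqVneq (dens a) 0; first by rewrite d0 !mul0e.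
congr (_ * _)%E.
have dpos : 0 < dens a by rewrite lt0r d0 dens_ge0.
have fin_of (I : \bar R) : (0 <= I)%E -> ((dens a)%:E * I < +oo)%E -> (I < +oo)%E.
  by case: I => [r||]//; rewrite ?ltry// gt0_muley ?lte_fin.
have mfa : cmeasurable (fx a) := cmeasurable_section1 a mfx.
apply: (plancherel2 ck (f := fx a)); split; try exact: mfa.
- apply: fin_of f1; exact: integral_ge0T.
- apply: fin_of f2; exact: integral_ge0T.
Qed.

Let Phi (w : P) (q : X) (tau : RL) : R :=
  nsq (fourier (2 * pi) (fun u => hat f w (amx w (crd q.1) u q.2)) tau).

Let mh (w : P) : cmeasurable (fun y : X * RL => hat f w (amx w (crd y.1.1) y.2 y.1.2)).
Proof.
apply: (cmeasurable_hat cf); first exact: measurable_cst.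
apply: measurable_amx; first exact: measurable_cst.
- by measurability.
- exact: measurable_snd.
- by measurability.
Qed.

Let mPhi (w : P) : mfunT (fun z : X * RL => Phi w z.1 z.2).
Proof. exact: (measurable_nsq (cmeasurable_fourier (2 * pi) (mh w))). Qed.

Let Phi0 w q tau : 0 <= Phi w q tau. Proof. exact: nsq_ge0. Qed.

Let mjac (w : P) : mfunT (fun q : X => jac w (crd q.1) q.2).
Proof. by measurability. Qed.

(** Plancherel in [u] on almost every fibre, followed by [ge0_integral_leb4] read backwards.
    Integrability of the fibre comes from [ae_fiber] and its square-integrability from finiteness of
    [L w]. *)
Lemma integral_Phi (w : P) : w.1 != 0 -> (L w < +oo)%E ->
  (\int[mX]_q ((jac w (crd q.1) q.2)%:E * \int[leb]_tau (Phi w q tau)%:E) = L w)%E.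
Proof.
move=> w10 Lw.
have n0 : sqn w != 0 by rewrite sqn_eq0; apply: contra_neq w10 => ->.
have mpsi : mfunT (fun a => (nsq (hat f w a))%:E).
  exact: measurable_EFin_nsq (cmeasurable_section1 w mhat).
have psi0 a : (0 <= (nsq (hat f w a))%:E)%E by rewrite lee_fin nsq_ge0.
pose J (q : X) : \bar R := ((jac w (crd q.1) q.2)%:E *
  \int[leb]_u (nsq (hat f w (amx w (crd q.1) u q.2)))%:E)%E.
have mJ : mfunT J.
  apply: emeasurable_funM; first exact/measurable_EFinP.
  by apply: (measurable_integral1 leb (measurable_EFin_nsq (mh w))) => z; rewrite lee_fin nsq_ge0.
have J0 q : (0 <= J q)%E by apply: mule_ge0; [rewrite lee_fin jac_ge0|exact: nsq_integral_ge0].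
have LE : (L w = \int[mX]_q J q)%E.
  by rewrite (ge0_integral_X mJ J0); exact: (ge0_integral_leb4 w10 mpsi psi0).
rewrite LE in Lw *.
have mP : mfunT (fun q : X => (jac w (crd q.1) q.2)%:E * \int[leb]_tau (Phi w q tau)%:E)%E.
  apply: emeasurable_funM; first exact/measurable_EFinP.
  have mE : mfunT (fun z : X * RL => (Phi w z.1 z.2)%:E) by apply/measurable_EFinP; exact: mPhi.
  by apply: (measurable_integral1 leb mE) => z; rewrite lee_fin.
apply: ge0_ae_eq_integral; [exact: mP|exact: mJ|].
have V0 : {ae mX, forall q : X, q.2 != 0 :> R} by apply: ae_mono (@ae_good2 R) => q [].
have af := ae_fiber cf n0 measurable_snd V0 (fun phi => ge0_integral_G2_X w10 (phi := phi)).
have a1 := ae_and af (ae_lty mJ J0 Lw); have a2 := ae_and a1 (@ae_good2 R).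
apply: ae_mono a2 => q [[cq Jq] [gq q2]]; congr (_ * _)%E.
apply: (plancherel ck (f := fun u => hat f w (amx w (crd q.1) u q.2))).
  exact: (cintegrable_hat cq).
split; first by case: (cintegrable_hat cq).
have jpos : 0 < jac w (crd q.1) q.2.
  by rewrite lt0r jac_ge0 andbT /jac !mulf_neq0 ?invr_eq0 ?expf_neq0 ?good_sqn.
move: Jq; rewrite /J; set I := (\int[leb]_u _)%E.
have : (0 <= I)%E by exact: nsq_integral_ge0.
by case: I => [r||]//; rewrite ?ltry// gt0_muley ?lte_fin.
Qed.

Lemma integral_kern_fiber (k : amb) : good k ->
  (\int[mR]_t \int[mX]_q (nsq (kern f ((k, t), q)))%:E =
   (sqn (crd k))%:E * \int[mX]_q ((jac (crd k) (crd q.1) q.2)%:E * \int[leb]_tau (Phi (crd k) q tau)%:E))%E.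
Proof.
move=> gk; set w := crd k; have n0 : sqn w != 0 := good_sqn gk.
(* The squared kernel rewritten with [v] in place of [s]. Of the two Jacobians produced by squaring,
   the weights leave one [jac], to be used for the matrix coordinates. *)
pose E (t : RL) (q : X) : R := sqn w * jac w (crd q.1) q.2 * (`|t|^-1 * Phi w q t^-1).
have mnr : mfunT (fun t : RL => `|t|) by measurability.
have mninv : mfunT (fun t : RL => `|t|^-1) by measurability.
have mc : mfunT (fun q : X => sqn w * jac w (crd q.1) q.2) by measurability.
have mE1 : mfunT (fun z : RL * X => sqn w * jac w (crd z.2.1) z.2.2) by measurability.
have mE2 : mfunT (fun z : RL * X => `|z.1|^-1) by measurability.
have msw : mfunT (fun z : RL * X => (z.2, z.1^-1 : RL)) by measurability.
have mE3 : mfunT (fun z : RL * X => Phi w z.2 (z.1^-1)) by exact: (measurableT_comp (mPhi w) msw).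
have mE : mfunT (fun z : RL * X => (E z.1 z.2)%:E) by measurability.
have c0 (q : X) : 0 <= sqn w * jac w (crd q.1) q.2 by rewrite mulr_ge0 ?sqn_ge0 ?jac_ge0.
have E0 t q : (0 <= (E t q)%:E)%E.
  by rewrite lee_fin; apply: mulr_ge0 (c0 q) _; apply: mulr_ge0 (Phi0 _ _ _); rewrite invr_ge0.
have kE (t : RL) (k' : amb) (s : RL) : t != 0 ->
    nsq (kern f ((k, t), (k', s))) = E t (k', t / s).
  move=> t0; rewrite /kern /= -/w nsqM nsq_real /E /Phi /= mulrA; congr (_ * _).
  rewrite /kconst /jac /= -/w !exprMn !exprVn !sqr_sqrtr ?exprn_ge0 ?sqn_ge0//.
  rewrite invf_div -(real_normK (num_real t)) -(real_normK (num_real s)).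
  have a0 : `|t| != 0 by rewrite normr_eq0.
  move: (`|t|) a0 (`|s|) ((sqn (crd k'))^-1) => a a0 b n'.
  by field.
have mk : cmeasurable (fun q => kern f q) := cmeasurable_kern cf.
have mkE : mfunT (fun z : RL * X => (nsq (kern f ((k, z.1), z.2)))%:E) by measurability.
have nk t q : (0 <= (nsq (kern f ((k, t), q)))%:E)%E by rewrite lee_fin nsq_ge0.
transitivity (\int[mR]_t \int[mX]_q (E t q)%:E)%E.
  apply: ge0_ae_eq_integral.
  - exact: (measurable_integralr mX (f := fun t q => (nsq (kern f ((k, t), q)))%:E) mkE nk).
  - exact: (measurable_integralr mX (f := fun t q => (E t q)%:E) mE E0).
  apply: ae_mono (@ae_Rstar R) => t t0.
  rewrite (ge0_integral_X (measurable_fun_pair2 t mkE) (nk t)) (ge0_integral_X (measurable_fun_pair2 t mE) (E0 t)).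
  apply: eq_integral => k' _ /=; under eq_integral do rewrite (kE _ _ _ t0).
  exact: (ge0_integral_Rstar_flip t0 (measurable_fun_pair2 k' (measurable_fun_pair2 t mE)) (fun s => E0 t (k', s))).
rewrite (@tonelli _ _ _ _ R mR mX (fun t q => (E t q)%:E) mE E0).
have mPe : mfunT (fun z : X * RL => (Phi w z.1 z.2)%:E) by apply/measurable_EFinP; exact: mPhi.
have Pe0 (z : X * RL) : (0 <= (Phi w z.1 z.2)%:E)%E by rewrite lee_fin.
have mIP : mfunT (fun q : X => (jac w (crd q.1) q.2)%:E * \int[leb]_tau (Phi w q tau)%:E)%E.
  apply: emeasurable_funM; first exact/measurable_EFinP.
  exact: (measurable_integral1 leb mPe Pe0).
rewrite -(ge0_integralZT mX mIP _ (sqn_ge0 w)); last first.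
  by move=> q; apply: mule_ge0; [rewrite lee_fin jac_ge0|apply: integral_ge0T => tau; exact: (Pe0 (q, tau))].
apply: eq_integral => q _; rewrite muleA -EFinM.
have mq : mfunT (fun t : RL => Phi w q t) by exact: (measurable_fun_pair2 q (mPhi w)).
(* Its value at [t^-1] is the factor of [E] depending on [t]. After inversion, |t| cancels the
   density of [mu_Rstar] and leaves Lebesgue measure in the frequency. *)
pose phi (t : RL) : \bar R := (`|t| * Phi w q t)%:E.
have mphi : mfunT phi by apply/measurable_EFinP; exact: measurable_funM.
have phi0 t : (0 <= phi t)%E by rewrite lee_fin; apply: mulr_ge0.
have EE t : (E t q)%:E = ((sqn w * jac w (crd q.1) q.2)%:E * phi (t^-1)%R)%E.
  by rewrite /phi normfV -EFinM.
under eq_integral do rewrite EE.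
rewrite (ge0_integralZT mR (measurableT_comp mphi (@measurable_invr R)) (fun t => phi0 _) (c0 q)).
congr (_ * _)%E; rewrite (ge0_integral_Rstar_inv mphi phi0) (ge0_integral_Rstar mphi phi0).
apply: ge0_ae_eq_integral.
- by measurability.
- exact/measurable_EFinP.
- apply: ae_mono (@ae_leb_neq0 R) => t t0; rewrite /phi -EFinM mulrAC divff ?mul1r//.
  by rewrite normr_eq0.
Qed.

Lemma integral_kern :
  (\int[mX]_p \int[mX]_q (nsq (kern f (p, q)))%:E = \int[mG]_g (nsq (f g))%:E)%E.
Proof.
have mk2 := measurable_EFin_nsq (cmeasurable_kern cf).
have nk z : (0 <= (nsq (kern f z))%:E)%E by rewrite lee_fin nsq_ge0.
have mI : mfunT (fun p => \int[mX]_q (nsq (kern f (p, q)))%:E)%E.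
  exact: (measurable_integral1 mX mk2 nk).
have I0 p : (0 <= \int[mX]_q (nsq (kern f (p, q)))%:E)%E by exact: integral_ge0T.
rewrite (ge0_integral_X mI I0) -integral_L.
have Loo : {ae leb2, forall w, (L w < +oo)%E}.
  by apply: (ae_lty mL L0); rewrite integral_L; exact: (proj2 c2f).
have msL : mfunT (fun k : amb => (sqn (crd k))%:E * L (crd k))%E.
  apply: emeasurable_funM; last exact: (measurableT_comp mL (@measurable_crd R)).
  by apply/measurable_EFinP; exact: (measurableT_comp (@measurable_sqn R) (@measurable_crd R)).
transitivity (\int[mK]_k ((sqn (crd k))%:E * L (crd k)))%E.
  apply: ge0_ae_eq_integral; [exact: (measurable_integral1 mR mI I0)|exact: msL|].
  have a1 := ae_and (@ae_good R) (ae_K Loo); apply: ae_mono a1 => k [gk Lk].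
  by rewrite (integral_kern_fiber gk) (integral_Phi (proj1 gk) Lk).
rewrite (ge0_integral_K msL); last by move=> k; apply: mule_ge0; [rewrite lee_fin sqn_ge0|exact: L0].
have msi : mfunT (fun w : P => ((sqn w)^-1)%:E).
  by apply/measurable_EFinP; apply: measurable_inv_ge0; [exact: sqn_ge0|exact: measurable_sqn].
apply: ge0_ae_eq_integral; [|exact: mL|].
- apply: emeasurable_funM => //.
  exact: (measurableT_comp msL (measurableT_comp (@measurable_kgamma R) (@measurable_mkrow R))).
- apply: ae_mono (@ae_leb2_fst R) => w w10; rewrite crdK muleAC -EFinM divff ?mul1e//.
  by rewrite sqn_eq0; apply: contra_neq w10 => ->.
Qed.

End hilbert_schmidt_norm.

(** * Parseval for orthonormal bases, and the extension of sigma(f) T *)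

Section orthonormal_bases.
Context (R : realType).
Local Notation RL := (measurableTypeR R).
Local Notation amb := ('cV[R]_2 * 'M[R]_2)%type.
Local Notation mX := (@mu_X R).

Lemma basis_parseval (e : nat -> hfun R) (F : amb * RL -> R[i]) : orthonormal_basis e -> cL2 mX F ->
  (\sum_(j <oo) (nsq (ip mX F (unc (e j))))%:E = \int[mX]_x (nsq (F x))%:E)%E.
Proof.
move=> [he orth cvge] cF.
have ce j : cL2 mX (unc (e j)) by apply/hspaceP; exact: he.
pose F' : hfun R := fun k t => F (k, t).
have FE : F = unc F' by apply/funext => -[].
have hF' : hspace F' by apply/hspaceP; rewrite -FE.
apply: (parseval ce cF) => [i j|]; first by rewrite -(hinnerE (he i) (he j)).
pose Rem n p := F p - \sum_(j < n) ip mX F (unc (e j)) * unc (e j) p.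
have cRem n : cL2 mX (Rem n).
  by apply: cL2B => //; apply: cL2_sum => j; exact: cL2Z.
have N0 n : 0 <= N2 mX (Rem n) by rewrite -lee_fin N2E// nsq_integral_ge0.
have hE n : hnorm (fun k t => F' k t - \sum_(j < n) hinner F' (e j) * e j k t) = (Num.sqrt (N2 mX (Rem n)))%:E.
  have -> : (fun k t => F' k t - \sum_(j < n) hinner F' (e j) * e j k t) = (fun k t => Rem n (k, t)).
    apply/funext => k; apply/funext => t; rewrite /Rem; congr (_ - _).
    by apply: eq_bigr => j _; rewrite (hinnerE hF' (he j)) -FE.
  have uE : unc (fun k t => Rem n (k, t)) = Rem n by apply/funext => -[].
  rewrite hnormE uE; last by case: (cRem n).
  by rewrite -(N2E (cRem n)) poweR_EFin powR12_sqrt.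
have := cvge _ hF'; under eq_fun do rewrite hE.
move=> /fine_cvg /= h.
have -> : (fun n => N2 mX (Rem n)) = (fun n => Num.sqrt (N2 mX (Rem n)) * Num.sqrt (N2 mX (Rem n))).
  by apply/funext => n; rewrite -expr2 sqr_sqrtr.
by have := cvgM h h; rewrite mulr0 => H; exact: (H _).
Qed.

End orthonormal_bases.

Theorem proposition6p1 (R : realType) (f : 'cV[R]_2 * 'M[R]_2 -> R[i]) :
  cLp (@mu_G2 R) 1%:E f -> cLp (@mu_G2 R) 2%:E f ->
  exists S : hop R,
    [/\ hilbert_schmidt S,
        forall F, domT F -> heq (S F) (sigmaL1 f (opT F)) &
        forall e, orthonormal_basis e -> cnorm (@mu_G2 R) 2%:E f = hs_norm e S].
Proof.
move=> [mf f1] [_ f2].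
have cf : cintegrable (@mu_G2 R) f.
  split; first exact: mf.
  rewrite (_ : (\int[_]_x _)%E = cnorm (@mu_G2 R) 1%:E f) // /cnorm Lnorm1.
  by apply: eq_integral => x _ /=; rewrite ger0_norm ?normc_ge0.
have n2 : (\int[@mu_G2 R]_g (nsq (f g))%:E = cnorm (@mu_G2 R) 2%:E f `^ 2)%E by rewrite cnorm2_sqr.
have c2f : cL2 (@mu_G2 R) f by split; [exact: mf|rewrite n2; exact: poweR_lty].
have mk := cmeasurable_kern cf; have kE := integral_kern cf c2f.
have k2 : (\int[@mu_X R]_p \int[@mu_X R]_q (nsq (kern f (p, q)))%:E < +oo)%E by rewrite kE; exact: (proj2 c2f).
(* [S] acts on [F] itself rather than on [opT F], because the weight of [T] sits in the kernel; this
   makes it defined on the whole space. *)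
pose S : hop R := fun F k t => kernel_op (@mu_X R) (kern f) (unc F) (k, t).
have SE F : unc (S F) = kernel_op (@mu_X R) (kern f) (unc F) by apply/funext => -[].
have mS F : cmeasurable (unc F) -> cmeasurable (unc (S F)).
  by move=> mF; rewrite SE; exact: cmeasurable_kernel_op.
have bS : bounded_op S.
  split.
  - by move=> F /hspaceP cF; apply/hspaceP; rewrite SE; exact: cL2_kernel_op.
  - move=> a F G /hspaceP cF /hspaceP cG; apply: heq_ae.
    + apply: mS; case: (cL2D (cL2Z a cF) cG) => m _; exact: m.
    + have [m _] := cL2D (cL2Z a (cL2_kernel_op mk k2 cF)) (cL2_kernel_op mk k2 cG).
      by rewrite -!SE in m.
    + exact: ae_mono (kernel_op_linear mk k2 a cF cG) => -[k t] h; exact: h.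
  - set K2 := (\int[@mu_X R]_p \int[@mu_X R]_q (nsq (kern f (p, q)))%:E)%E in k2.
    have K20 : (0 <= K2)%E by apply: integral_ge0T => p; exact: nsq_integral_ge0.
    exists (Num.sqrt (fine K2)) => F /hspaceP cF; apply: hnorm_le.
    + exact: sqrtr_ge0.
    + by apply: mS; case: cF.
    + by case: cF.
    + rewrite sqr_sqrtr ?fine_ge0// fineK ?ge0_fin_numE// SE.
      exact: (kernel_op_le mk k2 cF).
have hs e : orthonormal_basis e -> cnorm (@mu_G2 R) 2%:E f = hs_norm e S.
  move=> be; have [he _ _] := be.
  have ce j : cL2 (@mu_X R) (unc (e j)) by apply/hspaceP; exact: he.
  rewrite /hs_norm (eq_eseriesr (g := fun j => \int[@mu_X R]_p (nsq (kernel_op (@mu_X R) (kern f) (unc (e j)) p))%:E)%E); last first.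
    by move=> j _; rewrite (hnorm_sqr (mS _ (proj1 (ce j)))) SE.
  rewrite (kernel_op_hs mk k2 ce) => [|F cF]; last exact: basis_parseval.
  by rewrite kE n2 -poweRrM mulfV ?pnatr_eq0// poweRe1// Lnorm_ge0.
exists S; split; [split; [exact: bS|]| |exact: hs].
- by move=> e be; rewrite -(hs e be).
- move=> F [hF hG]; apply: heq_trans (heq_sym (heq_sigmaL1 cf hG)).
  apply: heq_ae.
  + by apply: mS; case/hspaceP: hF.
  + by apply: (cmeasurable_sigma_int cf); case/hspaceP: hG.
  + by rewrite SE; exact: kernel_op_sigma_int.
Qed.
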